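(* Let $L$ and $f$ be as in the context and assume (F-1$'$), (F-2$'$), (F-3) and (F-4a) hold. Suppose that $u\equiv0$ is the only classical solution of the Cauchy problem (1.1) with initial data $g=0$. Then every solution $W$ of the stationary equation (1.3) satisfies $W(x)\le c_0$ for all $x\in\mathbb{R}^n$, where $c_0$ is the largest root of $G(u)=0$, with $G$ as in (F-4a). In particular, if $G(u)<0$ for all $u>0$, then (1.3) has no nontrivial solutions.
   Context: Let $L=\sum_{i,j=1}^n a_{ij}(x)\frac{\partial^2}{\partial x_i\partial x_j}+\sum_{i=1}^n b_i(x)\frac{\partial}{\partial x_i}$ with $a_{ij},b_i\in C^{\alpha}(\mathbb{R}^n)$ and $\sum_{i,j}a_{ij}(x)\nu_i\nu_j>0$ for all $x\in\mathbb{R}^n$, $\nu\in\mathbb{R}^n\setminus\{0\}$. Let $f:\mathbb{R}^n\times[0,\infty)\to\mathbb{R}$ be locally Lipschitz in $x$ and in $u$. The Cauchy problem (1.1) with initial data $g\in C(\mathbb{R}^n)$, $g\ge0$: $u_t=Lu+f(x,u)$ in $\mathbb{R}^n\times(0,\infty)$, $u(x,0)=g(x)$, $u\ge0$; a classical solution is $u\in C^{2,1}(\mathbb{R}^n\times(0,\infty))\cap C(\mathbb{R}^n\times[0,\infty))$ satisfying these. The stationary equation (1.3): $LW+f(x,W)=0$ in $\mathbb{R}^n$, $W\ge0$, $W\in C^2(\mathbb{R}^n)$. Let $F(u)=\sup_{x\in\mathbb{R}^n}f(x,u)$ and let $\log^{(i)}$ be the $i$-th iterate of $\log$, with $\prod_{i=1}^0\log^{(i)}u=1$.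 (F-1$'$): $\sup_{u>0}F(u)<\infty$. (F-2$'$): there exist an integer $m\ge0$ and $\epsilon>0$ with $\lim_{u\to\infty}\frac{F(u)}{u(\prod_{i=1}^m\log^{(i)}u)^2(\log^{(m+1)}u)^{2+\epsilon}}=-\infty$. (F-3): $f(x,0)=0$ for all $x$, and $F$ is locally Lipschitz. (F-4a): the function $G(u)=\sup_{x\in\mathbb{R}^n}\sup_{v\ge u}\big(f(x,v)-f(x,v-u)\big)$ is locally Lipschitz, is negative for all sufficiently large $u$, and satisfies $\int^\infty\frac{du}{-G(u)}<\infty$. *)

(* Defs.v *)
From HB Require Import structures.
From mathcomp Require Import all_boot all_order all_algebra.
From mathcomp Require Import all_classical all_reals all_analysis.
Set Implicit Arguments. Unset Strict Implicit. Unset Printing Implicit Defensive.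
Import Order.TTheory GRing.Theory Num.Theory.
Import numFieldNormedType.Exports.
Local Open Scope classical_set_scope.
Local Open Scope ring_scope.

Section Defs.
Variables (R : realType) (n : nat).
Notation V := 'rV[R]_n.

Definition evec (i : 'I_n) : V := delta_mx 0 i.

Definition pd (i : 'I_n) (h : V -> R) (x : V) : R := 'D_(evec i) h x.

Definition C2 (h : V -> R) : Prop :=
  continuous h /\
  (forall i x, derivable h x (evec i)) /\
  (forall i, continuous (pd i h)) /\
  (forall i j x, derivable (pd j h) x (evec i)) /\
  (forall i j, continuous (pd i (pd j h))).

Definition loc_holder (alpha : R) (h : V -> R) : Prop :=
  forall (x0 : V) (r : R), exists C : R, forall x y : V,
    `|x - x0| <= r -> `|y - x0| <= r -> `|h x - h y| <= C * (`|x - y| `^ alpha).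

Definition Lop (a : 'I_n -> 'I_n -> V -> R) (b : 'I_n -> V -> R)
  (h : V -> R) (x : V) : R :=
  \sum_(i < n) \sum_(j < n) a i j x * pd i (pd j h) x + \sum_(i < n) b i x * pd i h x.

Definition f_loc_lip (f : V -> R -> R) : Prop :=
  forall (x0 : V) (r M : R), exists C : R, forall (x y : V) (u v : R),
    `|x - x0| <= r -> `|y - x0| <= r -> 0 <= u <= M -> 0 <= v <= M ->
    `|f x u - f y v| <= C * (`|x - y| + `|u - v|).

Definition loc_lip0 (h : R -> R) : Prop :=
  forall M : R, exists C : R, forall u v : R, 0 <= u <= M -> 0 <= v <= M ->
    `|h u - h v| <= C * `|u - v|.

Definition Fsup (f : V -> R -> R) (u : R) : R := sup (range (fun x => f x u)).

Definition Gset (f : V -> R -> R) (u : R) : set R :=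
  [set f x v - f x (v - u) | x in setT & v in [set v | u <= v]].
Definition Gsup (f : V -> R -> R) (u : R) : R := sup (Gset f u).

Definition unc (u : V -> R -> R) : V * R -> R := fun p => u p.1 p.2.

Definition C21 (u : V -> R -> R) : Prop :=
  (forall x t, 0 < t -> derivable (u x) t 1) /\
  (forall p : V * R, 0 < p.2 -> {for p, continuous (fun q : V * R => 'D_1 (u q.1) q.2)}) /\
  (forall i x t, 0 < t -> derivable (fun y => u y t) x (evec i)) /\
  (forall i (p : V * R), 0 < p.2 ->
      {for p, continuous (fun q : V * R => pd i (fun y => u y q.2) q.1)}) /\
  (forall i j x t, 0 < t -> derivable (pd j (fun y => u y t)) x (evec i)) /\
  (forall i j (p : V * R), 0 < p.2 ->
      {for p, continuous (fun q : V * R => pd i (pd j (fun y => u y q.2)) q.1)}).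

Definition classical_sol (a : 'I_n -> 'I_n -> V -> R) (b : 'I_n -> V -> R)
  (f : V -> R -> R) (g : V -> R) (u : V -> R -> R) : Prop :=
  C21 u /\
  {within [set p : V * R | 0 <= p.2], continuous (unc u)} /\
  (forall x t, 0 < t -> 'D_1 (u x) t = Lop a b (fun y => u y t) x + f x (u x t)) /\
  (forall x, u x 0 = g x) /\
  (forall x t, 0 <= t -> 0 <= u x t).

Definition stationary_sol (a : 'I_n -> 'I_n -> V -> R) (b : 'I_n -> V -> R)
  (f : V -> R -> R) (W : V -> R) : Prop :=
  C2 W /\ (forall x, 0 <= W x) /\ (forall x, Lop a b W x + f x (W x) = 0).

End Defs.

Definition logi (R : realType) (i : nat) (u : R) : R := iter i (@ln R) u.

(* Main.v *)
Require Import Defs.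
From HB Require Import structures.
From mathcomp Require Import all_boot all_order all_algebra.
From mathcomp Require Import all_classical all_reals all_analysis.
From mathcomp Require Import measurable_realfun.
From mathcomp Require Import ring lra zify.
Import Order.TTheory GRing.Theory Num.Theory.
Import numFieldNormedType.Exports.
Set Implicit Arguments. Unset Strict Implicit. Unset Printing Implicit Defensive.
Local Open Scope classical_set_scope.
Local Open Scope ring_scope.

(** Put [z = W - u].  A solution [u] of the Cauchy problem with zero data, lying
    between [0] and [W], corresponds to a solution [z] of
    [z_t = L z + f(x, W) - f(x, W - z)] with [z(., 0) = W] and [0 <= z <= W].
    Such a [z] is obtained as an ultrafilter limit of monotone explicit finite
    difference schemes on growing balls.  Monotonicity requires writing the
    second order part as a nonnegative combination of second differences along
    integer directions, with locally Hölder coefficients.  Comparison of the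
    scheme with the constants of the Euler scheme for [y' = G(y) / 2] gives
    [z(., t) <= c] after a time depending only on the integral of [-1/G], for
    every [c > c0].  The limit is a classical solution because of interior
    Schauder estimates for the scheme, proved at the discrete level by the
    maximum principle: a doubling of variables bounds first differences of the
    frozen equation, and this is applied to second differences of the scheme.
    By uniqueness [u = 0], so [W = z <= c]. *)

(** [W] may be unbounded; what makes the bound on [z] independent of [W] is the inequality
    [f(x, W) - f(x, W - y) <= G(y)], valid for every [y <= W(x)]. Where the constant [y] exceeds
    [W(x)], the reaction is clipped to [f(x, W)], and knowing [z <= W] up to a small error costs at
    most half of the decay; hence the factor [1/2] in the Euler scheme. Finiteness of the integral
    makes the descent time independent of the starting height, which grows with the ball. In the
    Schauder estimate the obstacle is uniformity in the mesh: a seminorm of third differences is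
    finite on any grid, but a priori only with a constant of order [h ^- 3]. An absorption argument
    over shrinking cylinders, gaining a factor 16 against a loss of 8, removes this dependence. The
    ultrafilter provides limits at all points and for all difference quotients at once, without
    extracting subsequences. Continuity at time 0 lies outside the interior estimates and comes from
    a quadratic barrier below [z]. *)

Ltac vring := apply/rowP => ?; rewrite !mxE; ring.

(** * First and second differences along integer directions *)

Section Differences.
Variables (R : realType) (n : nat).
Implicit Types (h : R) (x y a b : 'rV[R]_n) (u w : 'rV[R]_n -> R).

Lemma coord_le_norm x i : `|x 0 i| <= `|x|.
Proof.
have -> : `|x| = \big[Num.max/0]_ij `|x ij.1 ij.2| by exact: mx_normrE.
exact: (le_bigmax _ (fun ij : 'I_1 * 'I_n => `|x ij.1 ij.2|) (0, i)).
Qed.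

Lemma norm_le_coord x (c : R) : 0 <= c -> (forall i, `|x 0 i| <= c) -> `|x| <= c.
Proof.
move=> c0 H; have -> : `|x| = \big[Num.max/0]_ij `|x ij.1 ij.2| by exact: mx_normrE.
by apply: bigmax_le => // -[i j] _ /=; rewrite (ord1 i).
Qed.

Lemma evecE (i j : 'I_n) : evec R i 0 j = (j == i)%:R.
Proof. by rewrite /evec mxE eqxx /= eq_sym. Qed.

Lemma norm_evec (i : 'I_n) : `|evec R i| <= 1.
Proof.
by apply: norm_le_coord => // j; rewrite evecE; case: eqP; rewrite ?normr1 ?normr0.
Qed.


Lemma norm_scale_evec h (i : 'I_n) : 0 <= h -> `|h *: evec R i| <= h.
Proof.
by move=> h0; rewrite normrZ ger0_norm // -[leRHS]mulr1 ler_wpM2l ?norm_evec.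
Qed.

Definition df a u x := u (x + a) - u x.

Lemma dfC a b u : df a (df b u) = df b (df a u).
Proof. by apply/funext => x; rewrite /df (addrAC x b a); ring. Qed.

Lemma df_ext a u w : u =1 w -> df a u =1 df a w.
Proof. by move=> e x; rewrite /df !e. Qed.

Lemma dfD a b u x : df (a + b) u x = df a u x + df b u (x + a).
Proof. by rewrite /df addrA; ring. Qed.

Lemma dfN a u x : df (- a) u x = - df a u (x - a).
Proof. by rewrite /df subrK opprB. Qed.

Definition stepv (p : 'I_n * bool) : 'rV[R]_n := if p.2 then evec R p.1 else - evec R p.1.
(** An integer direction is encoded as a list of signed unit steps, so that a difference along it
    telescopes into unit differences; the length of the list measures the reach of the stencil. *)
Definition vec (s : seq ('I_n * bool)) : 'rV[R]_n := \sum_(p <- s) stepv p.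

Lemma vec_cons p s : vec (p :: s) = stepv p + vec s.
Proof. by rewrite /vec big_cons. Qed.

Lemma stepvE p i : stepv p 0 i = (if p.2 then 1 else -1) * (i == p.1)%:R.
Proof. rewrite /stepv; case: p.2; first by rewrite evecE mul1r.
by rewrite mulN1r -evecE mxE. Qed.

Lemma norm_stepv p : `|stepv p| <= 1.
Proof. by rewrite /stepv; case: p.2; rewrite ?normrN norm_evec. Qed.

Lemma norm_vec s : `|vec s| <= (size s)%:R.
Proof.
elim: s => [|p s IH]; first by rewrite /vec big_nil normr0.
rewrite vec_cons /= -natr1 addrC (le_trans (ler_normD _ _)) //.
by apply: lerD => //; exact: norm_stepv.
Qed.

Lemma norm_hvec h s : 0 <= h -> `|h *: vec s| <= h * (size s)%:R.
Proof. by move=> h0; rewrite normrZ ger0_norm // ler_wpM2l ?norm_vec. Qed.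

(** Telescoping along the list of steps, with [p] in the role of a gradient. The radius in the
    hypothesis leaves room for all intermediate points. *)
Lemma df_steps h w (p : 'I_n -> R) (e : R) s x : 0 <= h ->
  (forall y i, `|y - x| <= h * (size s)%:R ->
     `|df (h *: evec R i) w y - h * p i| <= h * e) ->
  `|df (h *: vec s) w x - h * \sum_i vec s 0 i * p i| <= (size s)%:R * (h * e).
Proof.
move=> h0; elim: s x => [|q s IH] x H.
  rewrite /vec big_nil scaler0 /df addr0 subrr big1 ?mulr0 ?subr0 ?normr0 ?mul0r //.
  by move=> i _; rewrite mxE mul0r.
rewrite vec_cons scalerDr dfD.
have -> : \sum_i (stepv q + vec s) 0 i * p i =
    (if q.2 then p q.1 else - p q.1) + \sum_i vec s 0 i * p i.
  under eq_bigr do rewrite mxE mulrDl.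
  rewrite big_split /=; congr (_ + _).
  rewrite (bigD1 q.1) //= big1 => [|i iq].
    by rewrite stepvE eqxx addr0 mulr1; case: q.2; rewrite ?mul1r ?mulN1r.
  by rewrite stepvE (negbTE iq) mulr0 mul0r.
have H1 : `|df (h *: stepv q) w x - h * (if q.2 then p q.1 else - p q.1)| <= h * e.
  rewrite /stepv; case: q.2.
    by apply: H; rewrite subrr normr0 mulr_ge0.
  rewrite scalerN dfN mulrN -opprB normrN opprK addrC; apply: H.
  rewrite addrC addKr normrN (le_trans (norm_scale_evec _ h0)) //.
  by rewrite -[leLHS]mulr1 ler_wpM2l // ler1n.
have H2 : `|df (h *: vec s) w (x + h *: stepv q) - h * \sum_i vec s 0 i * p i|
          <= (size s)%:R * (h * e).
  apply: IH => y i yx; apply: H.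
  have -> : y - x = (y - (x + h *: stepv q)) + h *: stepv q by vring.
  rewrite (le_trans (ler_normD _ _)) // /= -natr1 mulrDr mulr1 lerD //.
  by rewrite normrZ ger0_norm // -[leRHS]mulr1 ler_wpM2l // norm_stepv.
rewrite /= -natr1 mulrDl mul1r mulrDr opprD addrACA addrC.
by rewrite (le_trans (ler_normD _ _)) // lerD.
Qed.

Definition sd h s w x := w (x + h *: vec s) + w (x - h *: vec s) - 2 * w x.

Lemma sd_df h s w x : sd h s w x = df (h *: vec s) (df (h *: vec s) w) (x - h *: vec s).
Proof. by rewrite /sd /df subrK; ring. Qed.

(** [df_steps] applied twice, with [Q] in the role of a Hessian. The factor 3 in the radius accounts
    for the backward shift by [h *: vec s] and for the two walks along [s]. *)
Lemma sd_approx h s w (Q : 'I_n -> 'I_n -> R) (e : R) x : 0 <= h ->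
  (forall y i j, `|y - x| <= 3 * (h * (size s)%:R) ->
     `|df (h *: evec R i) (df (h *: evec R j) w) y - h ^+ 2 * Q i j| <= h ^+ 2 * e) ->
  `|sd h s w x - h ^+ 2 * \sum_i \sum_j vec s 0 i * vec s 0 j * Q i j|
     <= (size s)%:R ^+ 2 * (h ^+ 2 * e).
Proof.
move=> h0 H; rewrite sd_df.
have := @df_steps h (df (h *: vec s) w) (fun i => h * \sum_j vec s 0 j * Q i j)
   ((size s)%:R * (h * e)) s (x - h *: vec s) h0.
have -> : \sum_i vec s 0 i * (h * \sum_j vec s 0 j * Q i j) =
   h * \sum_i \sum_j vec s 0 i * vec s 0 j * Q i j.
  rewrite mulr_sumr; apply: eq_bigr => i _; rewrite mulrCA; congr (_ * _).
  by rewrite mulr_sumr; apply: eq_bigr => j _; rewrite mulrA.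
have -> : (size s)%:R * (h * ((size s)%:R * (h * e))) = (size s)%:R ^+ 2 * (h ^+ 2 * e) by ring.
rewrite {1}[h * (h * \sum_i \sum_j _)]mulrA -expr2; apply => y i yx.
rewrite dfC.
have -> : h * ((size s)%:R * (h * e)) = (size s)%:R * (h * (h * e)) by ring.
have -> : h * (h * \sum_j vec s 0 j * Q i j) = h * \sum_j vec s 0 j * (h * Q i j).
  congr (_ * _); rewrite mulr_sumr; apply: eq_bigr => j _; ring.
apply: df_steps => // z j zy.
rewrite !(mulrA h h) -expr2 dfC; apply: H.
have -> : z - x = (z - y) + ((y - (x - h *: vec s)) - h *: vec s).
  by vring.
rewrite (le_trans (ler_normD _ _)) // (_ : 3 * _ = h * (size s)%:R + (h * (size s)%:R + h * (size s)%:R)); last by ring.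
apply: lerD => //; rewrite (le_trans (ler_normB _ _)) // lerD // norm_hvec //.
Qed.

Lemma sd_bound h s w (e : R) x : 0 <= h ->
  (forall y i j, `|y - x| <= 3 * (h * (size s)%:R) ->
     `|df (h *: evec R i) (df (h *: evec R j) w) y| <= h ^+ 2 * e) ->
  `|sd h s w x| <= (size s)%:R ^+ 2 * (h ^+ 2 * e).
Proof.
move=> h0 H; have := @sd_approx h s w (fun _ _ => 0) e x h0.
rewrite big1 ?mulr0 ?subr0 => [|i _]; last by rewrite big1 // => j _; rewrite mulr0.
by apply => y i j yx; rewrite subr0; apply: H.
Qed.

Lemma df_multi (m : nat) a w (p e : R) x :
  (forall k, (k < m)%N -> `|df a w (x + k%:R *: a) - p| <= e) ->
  `|df (m%:R *: a) w x - m%:R * p| <= m%:R * e.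
Proof.
elim: m => [|m IH] H.
  by rewrite scale0r /df addr0 subrr !mul0r subr0 normr0.
rewrite -natr1 scalerDl scale1r dfD !mulrDl !mul1r opprD addrACA.
rewrite (le_trans (ler_normD _ _)) // lerD ?H //.
by apply: IH => k km; apply: H; rewrite ltnS ltnW.
Qed.

Lemma df_multi0 (m : nat) a w (e : R) x :
  (forall k, (k < m)%N -> `|df a w (x + k%:R *: a)| <= e) ->
  `|df (m%:R *: a) w x| <= m%:R * e.
Proof.
move=> H; have := @df_multi m a w 0 e x; rewrite mulr0 subr0; apply => k km.
by rewrite subr0 H.
Qed.

End Differences.

Section Gradient.
Variables (R : realType) (n : nat).
Implicit Types x y : 'rV[R]_n.

(** The squared Euclidean norm. Unlike the sup norm, it has second differences that do not depend on
    the point, which suits a barrier. *)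
Definition qn (x : 'rV[R]_n) : R := \sum_i x 0 i ^+ 2.

Lemma qn_ge0 x : 0 <= qn x.
Proof. by apply: sumr_ge0 => i _; exact: sqr_ge0. Qed.

Lemma sqr_norm_le_qn x : `|x| ^+ 2 <= qn x.
Proof.
rewrite -[leRHS]sqr_sqrtr ?qn_ge0 // ler_sqr ?nnegrE ?sqrtr_ge0 //.
apply: norm_le_coord => [|i]; first exact: sqrtr_ge0.
rewrite -(@ler_sqr R) ?nnegrE ?sqrtr_ge0 // sqr_sqrtr ?qn_ge0 // real_normK ?num_real //.
by rewrite /qn (bigD1 i) //= lerDl; apply: sumr_ge0 => j _; exact: sqr_ge0.
Qed.

Lemma qn_second_difference x a : qn (x + a) + qn (x - a) - 2 * qn x = 2 * qn a.
Proof.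
rewrite /qn -big_split /= !mulr_sumr -sumrB.
by apply: eq_bigr => i _; rewrite !mxE; ring.
Qed.

(** The discrete maximum principle: the condition on the weights makes the update a combination of
    [p] and the neighbouring values with nonnegative coefficients, so absolute values can be taken
    inside. *)
Lemma averaging_bound (I : eqType) (r : seq I) (a f1 f2 b1 b2 : I -> R)
    (p q b g1 g2 c1 c2 : R) :
  (forall i, i \in r -> 0 <= a i) -> 0 <= b -> 2 * \sum_(i <- r) a i + 2 * b <= 1 ->
  (forall i, i \in r -> `|f1 i| <= b1 i) -> (forall i, i \in r -> `|f2 i| <= b2 i) ->
  `|p| <= q -> `|g1| <= c1 -> `|g2| <= c2 ->
  `|p + \sum_(i <- r) a i * (f1 i + f2 i - 2 * p) + b * (g1 + g2 - 2 * p)| <=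
    q + \sum_(i <- r) a i * (b1 i + b2 i - 2 * q) + b * (c1 + c2 - 2 * q).
Proof.
move=> a0 b0 ab H1 H2 pq G1 G2.
have E (f g : I -> R) s t : s + \sum_(i <- r) a i * (f i + g i - 2 * s) + b * t =
   (1 - 2 * \sum_(i <- r) a i) * s + \sum_(i <- r) a i * (f i + g i) + b * t.
  have -> : \sum_(i <- r) a i * (f i + g i - 2 * s) =
     \sum_(i <- r) a i * (f i + g i) - 2 * s * \sum_(i <- r) a i.
    by rewrite mulr_sumr -sumrB; apply: eq_bigr => i _; ring.
  by ring.
rewrite !E.
set A := \sum_(i <- r) a i in ab *.
have S : `|\sum_(i <- r) a i * (f1 i + f2 i)| <= \sum_(i <- r) a i * (b1 i + b2 i).
  rewrite (le_trans (ler_norm_sum _ _ _)) // big_seq [leRHS]big_seq.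
  apply: ler_sum => i ir; rewrite normrM ger0_norm ?a0 // ler_wpM2l ?a0 //.
  by rewrite (le_trans (ler_normD _ _)) // lerD ?H1 ?H2.
have -> (z s t u : R) : (1 - 2 * A) * s + z + b * (t + u - 2 * s) =
   (1 - 2 * A - 2 * b) * s + z + (b * t + b * u) by ring.
rewrite [leRHS](_ : _ = (1 - 2 * A - 2 * b) * q + \sum_(i <- r) a i * (b1 i + b2 i) + (b * c1 + b * c2)); last by ring.
rewrite (le_trans (ler_normD _ _)) // lerD //.
  rewrite (le_trans (ler_normD _ _)) // lerD // normrM ger0_norm; last by lra.
  by rewrite ler_wpM2l //; lra.
by rewrite (le_trans (ler_normD _ _)) // !normrM (ger0_norm b0) lerD // ler_wpM2l.
Qed.

Variables (I : eqType) (ds : seq I) (sg : I -> seq ('I_n * bool)) (w : I -> R).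
Variables (cc h tau La R0 ka : R) (i0 : 'I_n).
Let e : 'rV[R]_n := h *: evec R i0.
Hypotheses (h0 : 0 < h) (tau0 : 0 < tau) (cc0 : 0 < cc) (R00 : 0 < R0) (hR : 2 * h <= R0).
Hypothesis w0 : forall d, d \in ds -> 0 <= w d.
Hypothesis cfl : tau / h ^+ 2 * (2 * \sum_(d <- ds) w d + 3 * cc) <= 1.
Hypothesis wL : \sum_(d <- ds) w d * qn (vec R (sg d)) <= La.
Hypotheses (ka1 : 1 <= ka) (kaL : 2 * La + 2 <= 3 / 2 * cc * ka).
Hypothesis stencil : forall d, d \in ds -> h * (size (sg d))%:R <= R0.
Variables (v G : nat -> 'rV[R]_n -> R) (kend : nat) (y0 : 'rV[R]_n) (M gam : R).
Hypotheses (M0 : 0 <= M) (gam0 : 0 <= gam).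
Hypothesis room : R0 ^+ 2 <= kend%:R * tau.
(** The extra [tau] keeps the time level just before any level of the cylinder in range, as the
    induction requires. *)
Let inrange (k : nat) := (kend%:R * tau - R0 ^+ 2 - tau <= k%:R * tau).
Hypothesis veq : forall k x, (k < kend)%N -> inrange k -> `|x - y0| <= 4 * R0 ->
  v k.+1 x = v k x + tau * (\sum_(d <- ds) w d * sd h (sg d) (v k) x / h ^+ 2
     + cc * (v k (x + e) + v k (x - e) - 2 * v k x) / h ^+ 2 + G k x).
Hypothesis vosc : forall k y (s : nat), (k <= kend)%N -> inrange k -> `|y - y0| <= 2 * R0 ->
  (1 <= s)%N -> s%:R * h <= 2 * R0 -> `|v k (y + s%:R *: e) - v k (y + (1 - s%:R) *: e)| <= M.
Hypothesis Gb : forall k x, (k < kend)%N -> inrange k -> `|x - y0| <= 4 * R0 -> `|G k x| <= gam.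

(** [M] dominates on the boundary of the cylinder, the second term absorbs the source over a time
    [R0 ^+ 2]. *)
Let D := M + 2 * gam * R0 ^+ 2.
Let sig (s : R) := (s - 2^-1) * h / R0.
(** [sig s] is half the distance between the two doubled points, in units of [R0]. The concave term
    in [s] pays for the second differences of [qn] and for the clock. *)
Let B (k : nat) y (s : R) := qn (y - y0) / R0 ^+ 2 + (kend%:R - k%:R) * tau / R0 ^+ 2
   + ka * (3 * sig s - sig s ^+ 2).
(** Odd under the reflection [s -> 1 - s]; this symmetry replaces a boundary condition on the
    diagonal. *)
Let phi k y (s : R) := v k (y + s *: e) - v k (y + (1 - s) *: e).

Lemma norm_e_le (s : R) : `|s *: e| <= `|s| * h.
Proof. by rewrite normrZ ler_wpM2l // norm_scale_evec // ltW. Qed.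

(** Induction on time. Outside the cylinder of radius [R0] and duration [R0 ^+ 2], or when
    [sig s >= 1], the oscillation bound suffices because [B >= 1] there; the larger ranges [2 * R0]
    let the stencil of an interior point leave the cylinder. *)
Lemma barrier k : (k <= kend)%N -> inrange k -> forall y (s : nat),
  `|y - y0| <= 2 * R0 -> (1 <= s)%N -> s%:R * h <= 2 * R0 -> `|phi k y s%:R| <= D * B k y s%:R.
Proof.
move: (h0) (hR) (R00) (tau0) (cc0) (ka1) (kaL) (M0) (gam0) => h0' hR' R00' tau0' cc0' ka1' kaL' M0' gam0'.
have D0 : 0 <= D by rewrite addr_ge0 // mulr_ge0 ?sqr_ge0 // mulr_ge0.
have R02 : 0 < R0 ^+ 2 by rewrite exprn_gt0.
have triv j y (s : nat) : (j <= kend)%N -> inrange j -> `|y - y0| <= 2 * R0 ->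
    (1 <= s)%N -> s%:R * h <= 2 * R0 ->
    [\/ R0 <= `|y - y0|, R0 ^+ 2 <= (kend%:R - j%:R) * tau | 1 <= sig s%:R] ->
    `|phi j y s%:R| <= D * B j y s%:R.
  move=> jk jr yR s1 sR ca; rewrite (le_trans (vosc jk jr yR s1 sR)) //.
  have sp : 0 <= sig s%:R.
    by rewrite /sig !mulr_ge0 ?invr_ge0 // ?(ltW h0) ?(ltW R00) // subr_ge0 (@le_trans _ _ 1) ?ler1n //; lra.
  have s2 : sig s%:R <= 2.
    by rewrite /sig ler_pdivrMr // (le_trans _ sR) // ler_pM2r // gerBl invr_ge0.
  have b1 : 0 <= qn (y - y0) / R0 ^+ 2 by rewrite divr_ge0 ?qn_ge0 // ltW.
  have b2 : 0 <= (kend%:R - j%:R) * tau / R0 ^+ 2.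
    by rewrite divr_ge0 ?(ltW R02) // mulr_ge0 ?(ltW tau0) // subr_ge0 ler_nat.
  have b3 : 0 <= 3 * sig s%:R - sig s%:R ^+ 2 by nra.
  have b4 : 0 <= ka * (3 * sig s%:R - sig s%:R ^+ 2) by rewrite mulr_ge0 // (le_trans ler01).
  suff B1 : 1 <= B j y s%:R.
    apply: (@le_trans _ _ D); last by rewrite -[leLHS]mulr1 ler_wpM2l.
    by rewrite lerDl mulr_ge0 ?sqr_ge0 // mulr_ge0.
  rewrite /B; case: ca => [ca|ca|ca].
  - have : 1 <= qn (y - y0) / R0 ^+ 2.
      rewrite ler_pdivlMr // mul1r (le_trans _ (sqr_norm_le_qn _)) // ler_sqr ?nnegrE //.
      exact: ltW.
    by lra.
  - have : 1 <= (kend%:R - j%:R) * tau / R0 ^+ 2 by rewrite ler_pdivlMr // mul1r.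
    by lra.
  - have : 1 <= 3 * sig s%:R - sig s%:R ^+ 2 by nra.
    by nra.
elim: k => [|k IH] kk kr y s yR s1 sR.
  apply: triv => //; apply: Or32.
  by rewrite subr0.
have [ca1|yR1] := leP R0 `|y - y0|; first by apply: triv => //; apply: Or31.
have [ca2|tR1] := leP (R0 ^+ 2) ((kend%:R - k.+1%:R) * tau); first by apply: triv => //; apply: Or32.
have [ca3|sg1] := leP 1 (sig s%:R); first by apply: triv => //; apply: Or33.
have k_kend : (k <= kend)%N by exact: ltnW.
have kr0 : inrange k.
  by move: tR1; rewrite /inrange -natr1 mulrBl mulrDl mul1r; lra.
have {}IH := IH k_kend kr0.
have sh : s%:R * h < 5 / 4 * R0.
  by move: sg1; rewrite /sig ltr_pdivrMr // mul1r mulrBl; move: hR; lra.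
have s1R : 1 <= s%:R :> R by rewrite ler1n.
have sS : s.+1%:R = s%:R + 1 :> R by rewrite -natr1.
have bd (c : R) : `|c| * h <= 3 / 2 * R0 -> `|y + c *: e - y0| <= 4 * R0.
  move=> cR; rewrite addrAC (le_trans (ler_normD _ _)) //.
  apply: le_trans (lerD (ltW yR1) (le_trans (norm_e_le c) cR)) _.
  by lra.
have x1 : `|y + s%:R *: e - y0| <= 4 * R0.
  by apply: bd; rewrite ger0_norm; lra.
have x2 : `|y + (1 - s%:R) *: e - y0| <= 4 * R0.
  by apply: bd; rewrite ler0_norm; move: h0; nra.
(* Along the directions in [ds] both points move together. A step by [e] outwards at one point
   paired with a step by [e] outwards at the other is a unit step in [s], so the second differences
   of [v] along [e] become the one of [phi] in [s]. *)
have eqphi : phi k.+1 y s%:R = phi k y s%:R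
    + \sum_(d <- ds) tau * w d / h ^+ 2 * (phi k (y + h *: vec R (sg d)) s%:R
        + phi k (y - h *: vec R (sg d)) s%:R - 2 * phi k y s%:R)
    + tau * cc / h ^+ 2 * (phi k y (s.+1)%:R + phi k y (s%:R - 1) - 2 * phi k y s%:R)
    + tau * (G k (y + s%:R *: e) - G k (y + (1 - s%:R) *: e)).
  rewrite {1}/phi !veq //.
  have -> : \sum_(d <- ds) tau * w d / h ^+ 2 * (phi k (y + h *: vec R (sg d)) s%:R
        + phi k (y - h *: vec R (sg d)) s%:R - 2 * phi k y s%:R) =
     tau * \sum_(d <- ds) w d * sd h (sg d) (v k) (y + s%:R *: e) / h ^+ 2
     - tau * \sum_(d <- ds) w d * sd h (sg d) (v k) (y + (1 - s%:R) *: e) / h ^+ 2.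
    rewrite !mulr_sumr -sumrB; apply: eq_bigr => d _.
    rewrite /phi /sd !(addrAC _ (s%:R *: e)) !(addrAC _ ((1 - s%:R) *: e)); ring.
  rewrite /phi sS.
  have -> : y + s%:R *: e + e = y + (s%:R + 1) *: e by rewrite scalerDl scale1r addrA.
  have -> : y + s%:R *: e - e = y + (s%:R - 1) *: e by rewrite scalerBl scale1r addrA.
  have -> : y + (1 - s%:R) *: e + e = y + (1 - (s%:R - 1)) *: e.
    by rewrite -addrA -[X in _ + (_ + X)]scale1r -scalerDl; congr (_ + _ *: _); ring.
  have -> : y + (1 - s%:R) *: e - e = y + (1 - (s%:R + 1)) *: e.
    by rewrite -addrA -[X in _ + (_ - X)]scale1r -scalerBl; congr (_ + _ *: _); ring.
  ring.
have h20 : 0 < h ^+ 2 by rewrite exprn_gt0.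
pose a d := tau * w d / h ^+ 2.
pose b := tau * cc / h ^+ 2.
have a0 d : d \in ds -> 0 <= a d by move=> dd; rewrite /a divr_ge0 ?(ltW h20) // mulr_ge0 ?w0 // ltW.
have b0 : 0 <= b by rewrite /b divr_ge0 ?(ltW h20) // mulr_ge0 // ltW.
have ab : 2 * \sum_(d <- ds) a d + 3 * b <= 1.
  apply: le_trans cfl; rewrite le_eqVlt; apply/orP; left; apply/eqP.
  have -> : \sum_(d <- ds) a d = tau / h ^+ 2 * \sum_(d <- ds) w d.
    by rewrite mulr_sumr; apply: eq_bigr => d _; rewrite /a mulrAC.
  by rewrite /b; ring.
have yp d : d \in ds -> `|y + h *: vec R (sg d) - y0| <= 2 * R0.
  move=> dd; rewrite addrAC (le_trans (ler_normD _ _)) //.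
  by have := norm_hvec (sg d) (ltW h0); have := stencil dd; lra.
have ym d : d \in ds -> `|y - h *: vec R (sg d) - y0| <= 2 * R0.
  move=> dd; rewrite addrAC (le_trans (ler_normB _ _)) //.
  by have := norm_hvec (sg d) (ltW h0); have := stencil dd; lra.
have sR' : s.+1%:R * h <= 2 * R0 by rewrite sS mulrDl mul1r; lra.
have Bq d : B k (y + h *: vec R (sg d)) s%:R + B k (y - h *: vec R (sg d)) s%:R - 2 * B k y s%:R
   = 2 * h ^+ 2 * qn (vec R (sg d)) / R0 ^+ 2.
  have := qn_second_difference (y - y0) (h *: vec R (sg d)).
  have -> : qn (h *: vec R (sg d)) = h ^+ 2 * qn (vec R (sg d)).
    by rewrite /qn mulr_sumr; apply: eq_bigr => i _; rewrite mxE exprMn.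
  rewrite /B !(addrAC _ _ (- y0)) => E.
  by rewrite -(mulrA 2) -E; field; rewrite gt_eqF.
set T := \sum_(d <- ds) _ in eqphi.
(* [S] is the second difference of the barrier in [s]. Its negativity has to cover [2 * La] from the
   directions, one unit from the clock and one unit from the source, which is [kaL]. *)
have main (S : R) : S <= - (3 / 2) * ka * h ^+ 2 / R0 ^+ 2 ->
   `|phi k y s%:R + T + tau * cc / h ^+ 2 * (phi k y (s.+1)%:R + phi k y (s%:R - 1) - 2 * phi k y s%:R)|
     <= D * B k y s%:R + \sum_(d <- ds) a d * (D * B k (y + h *: vec R (sg d)) s%:R
         + D * B k (y - h *: vec R (sg d)) s%:R - 2 * (D * B k y s%:R)) + b * (D * S) ->
   `|phi k.+1 y s%:R| <= D * B k.+1 y s%:R.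
  move=> HS Hphi; rewrite eqphi.
  apply: le_trans (ler_normD _ _) _.
  have HG : `|tau * (G k (y + s%:R *: e) - G k (y + (1 - s%:R) *: e))| <= tau * (2 * gam).
    rewrite normrM gtr0_norm // ler_pM2l // (le_trans (ler_normB _ _)) //.
    by have := Gb kk kr0 x1; have := Gb kk kr0 x2; lra.
  apply: le_trans (lerD Hphi HG) _.
  have -> : \sum_(d <- ds) a d * (D * B k (y + h *: vec R (sg d)) s%:R
         + D * B k (y - h *: vec R (sg d)) s%:R - 2 * (D * B k y s%:R)) =
      D * (2 * tau / R0 ^+ 2) * \sum_(d <- ds) w d * qn (vec R (sg d)).
    rewrite mulr_sumr; apply: eq_bigr => d _.
    transitivity (a d * D * (B k (y + h *: vec R (sg d)) s%:R + B k (y - h *: vec R (sg d)) s%:R - 2 * B k y s%:R)); first by ring.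
    by rewrite Bq /a; field; rewrite !gt_eqF.
  have bS : b * (D * S) <= D * (- (3 / 2) * ka * cc * tau / R0 ^+ 2).
    rewrite mulrCA ler_wpM2l //.
    apply: (@le_trans _ _ (b * (- (3 / 2) * ka * h ^+ 2 / R0 ^+ 2))); first by rewrite ler_wpM2l.
    by rewrite le_eqVlt /b; apply/orP; left; apply/eqP; field; rewrite !gt_eqF.
  have -> : B k.+1 y s%:R = B k y s%:R - tau / R0 ^+ 2.
    by rewrite /B -natr1; field; rewrite gt_eqF.
  have Dt : 0 <= D * (2 * tau / R0 ^+ 2) by rewrite mulr_ge0 // divr_ge0 ?(ltW R02) // mulr_ge0 // ltW.
  have := ler_wpM2l Dt wL => HL.
  have tR : 0 <= tau / R0 ^+ 2 by rewrite divr_ge0 // ltW.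
  have Dg : tau * (2 * gam) <= D * (tau / R0 ^+ 2).
    rewrite [leRHS]mulrCA ler_pM2l // /D ler_pdivlMr //.
    by move: M0; lra.
  have Dk : D * (tau / R0 ^+ 2) * (2 * La + 2) <= D * (tau / R0 ^+ 2) * (3 / 2 * cc * ka).
    by rewrite ler_wpM2l // mulr_ge0.
  move: HL bS Dg Dk.
  rewrite (_ : D * (2 * tau / R0 ^+ 2) = 2 * (D * (tau / R0 ^+ 2))); last by ring.
  rewrite (_ : D * (- (3 / 2) * ka * cc * tau / R0 ^+ 2) = - (D * (tau / R0 ^+ 2)) * (3 / 2 * cc * ka)); last by ring.
  rewrite mulrBr; lra.
have Bs (u : R) : B k y (u + 1) + B k y (u - 1) - 2 * B k y u = - 2 * ka * h ^+ 2 / R0 ^+ 2.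
  by rewrite /B /sig; field; rewrite gt_eqF.
have kR : 0 <= ka * h ^+ 2 / R0 ^+ 2 by rewrite divr_ge0 ?(ltW R02) // mulr_ge0 ?(ltW h20) //; lra.
(* At [s = 1] the neighbour [0] is the reflection of [1], so [phi 2 + phi 0 - 2 phi 1 = phi 2 - 3
   phi 1]. This explains [3 * cc] in [cfl]; since [B 0 + B 1] may be slightly negative, the gain
   drops from [2] to the [3 / 2] of [kaL]. *)
have [s2|s2] := leqP 2 s; last first.
  have {s1 s2} s1 : s = 1%N by apply/eqP; rewrite eqn_leq s1 -ltnS s2.
  subst s.
  apply: (main (B k y 2 - 3 * B k y 1)).
    have := Bs 1; rewrite subrr (_ : 1 + 1 = 2) // => E.
    have : - (ka * h ^+ 2 / R0 ^+ 2 / 2) <= B k y 0 + B k y 1.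
      have -> : B k y 0 + B k y 1 = 2 * (qn (y - y0) / R0 ^+ 2) + 2 * ((kend%:R - k%:R) * tau / R0 ^+ 2)
           - (ka * h ^+ 2 / R0 ^+ 2 / 2).
        by rewrite /B /sig; field; rewrite gt_eqF.
      have : 0 <= qn (y - y0) / R0 ^+ 2 by rewrite divr_ge0 ?qn_ge0 // ltW.
      have : 0 <= (kend%:R - k%:R) * tau / R0 ^+ 2.
        by rewrite divr_ge0 ?(ltW R02) // mulr_ge0 ?(ltW tau0) // subr_ge0 ler_nat.
      by lra.
    by move: E; lra.
  have -> : phi k y (1%:R - 1) = - phi k y 1%:R.
    by rewrite /phi subrr subr0 scale0r scale1r addr0; ring.
  (* The expression [b (phi 2 - 3 phi 1)] is put in symmetric form with weight [3 / 2 * b] and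
     neighbouring values [2 / 3 * phi 2] and [0]. *)
  have := @averaging_bound I ds a (fun d => phi k (y + h *: vec R (sg d)) 1%:R)
     (fun d => phi k (y - h *: vec R (sg d)) 1%:R)
     (fun d => D * B k (y + h *: vec R (sg d)) 1%:R) (fun d => D * B k (y - h *: vec R (sg d)) 1%:R)
     (phi k y 1%:R) (D * B k y 1%:R) (3 / 2 * b) (2 / 3 * phi k y 2%:R) 0 (2 / 3 * (D * B k y 2%:R)) 0 a0.
  have -> : 3 / 2 * b * (2 / 3 * phi k y 2%:R + 0 - 2 * phi k y 1%:R) =
     tau * cc / h ^+ 2 * (phi k y 2%:R + - phi k y 1%:R - 2 * phi k y 1%:R).
    by rewrite /b; field; rewrite gt_eqF.
  have -> : 3 / 2 * b * (2 / 3 * (D * B k y 2%:R) + 0 - 2 * (D * B k y 1%:R)) =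
     b * (D * (B k y 2%:R - 3 * B k y 1%:R)) by field.
  apply => //.
  - by lra.
  - by lra.
  - by move=> d dd; apply: IH => //; exact: yp.
  - by move=> d dd; apply: IH => //; exact: ym.
  - by apply: IH.
  - by rewrite normrM gtr0_norm ?ler_pM2l //; apply: IH.
  - by rewrite normr0.
have sm : s%:R - 1 = s.-1%:R :> R by rewrite -{1}(prednK s1) -natr1 addrK.
apply: (main (B k y s.+1%:R + B k y (s%:R - 1) - 2 * B k y s%:R)).
  by rewrite sS Bs; lra.
rewrite -/b; have -> (p q r : R) : b * (D * (p + q - 2 * r)) = b * (D * p + D * q - 2 * (D * r)) by ring.
apply: averaging_bound => //.
- by lra.
- by move=> d dd; apply: IH => //; exact: yp.
- by move=> d dd; apply: IH => //; exact: ym.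
- by apply: IH.
- by apply: IH.
- rewrite sm; apply: IH => //; first by rewrite -ltnS prednK.
  by rewrite -sm; move: h0; nra.
Qed.

(* Doubling the variables along [e]: the barrier for [v (y + s e) - v (y + (1 - s) e)] vanishes
   to first order at [s = 1/2], which gives the gradient bound. *)
Lemma discrete_gradient_bound :
  `|df e (v kend) y0| <= 2 * ka * h * (M / R0 + 2 * gam * R0).
Proof.
move: (h0) (hR) (R00) (tau0) (cc0) (ka1) (kaL) (M0) (gam0) => h0' hR' R00' tau0' cc0' ka1' kaL' M0' gam0'.
have := @barrier kend (leqnn _) _ y0 1%N.
have -> : phi kend y0 1%:R = df e (v kend) y0.
  by rewrite /phi /df scale1r subrr scale0r addr0.
move=> H.
apply: le_trans (H _ _ _ _) _ => //.
- by rewrite /inrange; move: tau0 (sqr_ge0 R0); lra.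
- by rewrite subrr normr0; move: R00; lra.
- by move: hR h0; lra.
have R02 : 0 < R0 ^+ 2 by rewrite exprn_gt0.
rewrite /B subrr [qn 0](_ : _ = 0); last by rewrite /qn big1 // => i _; rewrite mxE expr0n.
rewrite subrr !mul0r !add0r /sig.
set s := (1 - 2^-1) * h / R0.
have -> : 2 * ka * h * (M / R0 + 2 * gam * R0) = D * (ka * (4 * s)).
  by rewrite /D /s; field; rewrite gt_eqF.
rewrite ler_wpM2l //; first by rewrite addr_ge0 // mulr_ge0 ?sqr_ge0 // mulr_ge0.
rewrite ler_wpM2l //; first by move: ka1; lra.
have s0 : 0 <= s by rewrite /s !mulr_ge0 ?invr_ge0 // ?(ltW h0) ?(ltW R00) //; lra.
by have := sqr_ge0 s; lra.
Qed.

End Gradient.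

Lemma dyadic_scale (R : realType) (h s : R) : 0 < h -> h <= s ->
  exists p : nat, (2 ^ p)%:R * h <= s < 2 * ((2 ^ p)%:R * h).
Proof.
move=> h0 hs.
have s0 : 0 < s := lt_le_trans h0 hs.
have : exists q, s < (2 ^ q)%:R * h.
  exists (Num.bound (s / h)); rewrite -ltr_pdivrMr //.
  rewrite (lt_le_trans (archi_boundP _)) ?divr_ge0 ?ltW // ltr_nat.
  by apply: (@ltn_expl 2).
move=> ex; case: (ex_minnP ex) => -[|q] sq qmin.
  by move: sq; rewrite expn0 mul1r ltNge hs.
exists q; apply/andP; split.
  by rewrite leNgt; apply/negP => /qmin; rewrite ltnn.
by rewrite mulrA -natrM -expnS.
Qed.

Lemma norm_div_le (R : realType) (a b c : R) : 0 < c -> `|a / c| <= b -> `|a| <= c * b.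
Proof. by move=> c0; rewrite normrM normfV (gtr0_norm c0) ler_pdivrMr // mulrC. Qed.

(** * Interior third difference estimate, uniform in the mesh *)

Section Schauder.
Variables (R : realType) (n : nat) (om : R -> R).
Hypothesis omM : forall x y, 0 <= x -> 0 <= y -> om (x * y) = om x * om y.
Hypothesis om_le : forall x y, 0 <= x -> x <= y -> om x <= om y.
Hypothesis om_ge : forall x, 0 <= x -> x <= 1 -> x <= om x.
Hypothesis om1 : om 1 = 1.
Hypothesis om2 : 1 < om 2.
Hypothesis om22 : om 2 <= 2.

Lemma om_ge0 x : 0 <= x -> 0 <= om x.
Proof.
move=> x0; case: (leP x 1) => [x1|/ltW x1]; first exact: le_trans (om_ge x0 x1).
by rewrite (le_trans _ (om_le _ x1)) // om1.
Qed.

Lemma om_le1 x : 0 <= x -> x <= 1 -> om x <= 1.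
Proof. by move=> x0 x1; rewrite -om1 om_le. Qed.

Variables (h tau s0 t0 t1 M : R) (xc : 'rV[R]_n) (u : nat -> 'rV[R]_n -> R).
Hypotheses (h0 : 0 < h) (h1 : h <= 1) (tau0 : 0 < tau) (tauh : tau <= h ^+ 2).
Hypotheses (s00 : 0 < s0) (s01 : s0 <= 1) (t00 : 0 <= t0) (M0 : 0 <= M).
Hypothesis uM : forall k x, `|x - xc| <= s0 -> t0 <= k%:R * tau -> k%:R * tau <= t1 -> `|u k x| <= M.

Local Notation E i := (h *: evec R i).
Implicit Types (x y : 'rV[R]_n) (i j l : 'I_n) (k m : nat) (r N : R).

(** The initial time moves linearly with the radius. As radii are at most 1, this leaves more room
    than the parabolic scaling asks for. *)
Definition in_time r k := (t0 + (s0 - r) <= k%:R * tau) && (k%:R * tau <= t1).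

Definition third_bound r N := forall k x i j l m, (0 < m)%N ->
  `|x - xc| + 3 * (m%:R * h) <= r -> in_time r k ->
  `|df (E l) (df (m%:R *: E i) (df (m%:R *: E j) (u k))) x| <= N * h * (m%:R * h) * om (m%:R * h).

Lemma norm_shift x i m : `|x + m%:R *: E i - xc| <= `|x - xc| + m%:R * h.
Proof.
rewrite addrAC (le_trans (ler_normD _ _)) // lerD2l normrZ normr_nat ler_wpM2l //.
by rewrite norm_scale_evec // ltW.
Qed.

Lemma mh0 m : 0 <= m%:R * h. Proof. by rewrite mulr_ge0 // ltW. Qed.

(** * Comparison of scales and interpolation *)

Section Downscale.
Variables (r N : R) (k : nat).
Hypotheses (N0 : 0 <= N) (TB : third_bound r N) (kr : in_time r k).

Lemma third_same_scale m x i j l : (0 < m)%N -> `|x - xc| + 4 * (m%:R * h) <= r ->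
  `|df (m%:R *: E l) (df (m%:R *: E i) (df (m%:R *: E j) (u k))) x| <=
    N * (m%:R * h) ^+ 2 * om (m%:R * h).
Proof.
move=> m0 xr; have -> : N * (m%:R * h) ^+ 2 * om (m%:R * h) =
   m%:R * (N * h * (m%:R * h) * om (m%:R * h)) by ring.
apply: df_multi0 => q qm; apply: TB => //.
have := norm_shift x l q.
have : q%:R * h <= m%:R * h by rewrite ler_pM2r // ler_nat ltnW.
by move: xr; lra.
Qed.

Lemma df_double (a : 'rV[R]_n) w x : df (2 *: a) w x = 2 * df a w x + df a (df a w) x.
Proof. by rewrite scaler_nat mulr2n /df addrA; ring. Qed.

(** By [df (2 a) = 2 df a + df a (df a)] in both directions, doubling the scale multiplies a second
    difference by 4 up to third differences. The fourth difference counts as two third ones, which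
    gives [2 + 2 + 1 + 1 = 6]. *)
Lemma second_double m x i j : (0 < m)%N -> `|x - xc| + 5 * (m%:R * h) <= r ->
  `|df ((2 * m)%:R *: E i) (df ((2 * m)%:R *: E j) (u k)) x
     - 4 * df (m%:R *: E i) (df (m%:R *: E j) (u k)) x| <= 6 * (N * (m%:R * h) ^+ 2 * om (m%:R * h)).
Proof.
move=> m0 xr; rewrite !natrM -!scalerA.
set a := m%:R *: E i; set b := m%:R *: E j.
have -> : df (2 *: a) (df (2 *: b) (u k)) x =
   4 * df a (df b (u k)) x + 2 * df b (df a (df b (u k))) x + 2 * df a (df a (df b (u k))) x
   + df a (df a (df b (df b (u k)))) x.
  have -> : df (2 *: b) (u k) = (fun y => 2 * df b (u k) y + df b (df b (u k)) y).
    by apply/funext => y; exact: df_double.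
  rewrite df_double.
  have -> : df b (df a (df b (u k))) = df a (df b (df b (u k))) by rewrite dfC.
  by rewrite /df; ring.
have ax : `|x + a - xc| <= `|x - xc| + m%:R * h by exact: norm_shift.
have mh := mh0 m.
have T1 := @third_same_scale m x i j j m0.
have T2 := @third_same_scale m x i j i m0.
have T3 := @third_same_scale m x j j i m0.
have T4 := @third_same_scale m (x + a) j j i m0.
set B := N * _ * _ in T1 T2 T3 T4 *.
have -> : df a (df a (df b (df b (u k)))) x = df a (df b (df b (u k))) (x + a) - df a (df b (df b (u k))) x by [].
have -> (p q z s t : R) : 4 * p + 2 * q + 2 * z + (s - t) - 4 * p = 2 * q + (2 * z + (s - t)) by ring.
apply: le_trans (ler_normD _ _) _; rewrite normrM normr_nat.
apply: le_trans (lerD (lexx _) (ler_normD _ _)) _; rewrite normrM normr_nat.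
apply: le_trans (lerD (lexx _) (lerD (lexx _) (ler_normB _ _))) _.
have {}T1 : `|df b (df a (df b (u k))) x| <= B by apply: T1; lra.
have {}T2 : `|df a (df a (df b (u k))) x| <= B by apply: T2; lra.
have {}T3 : `|df a (df b (df b (u k))) x| <= B by apply: T3; lra.
have {}T4 : `|df a (df b (df b (u k))) (x + a)| <= B by apply: T4; lra.
by lra.
Qed.

(** The fixed point of the dyadic recursion of [second_scale], that is the solution of
    [Ca * om 2 = Ca + 3 / 2]; it is nonnegative because [om 2 > 1]. *)
Definition Ca := locked (3 / 2 / (om 2 - 1)).
Lemma Ca_ge0 : 0 <= Ca. Proof. by rewrite /Ca -lock divr_ge0 // subr_ge0 ltW. Qed.
Lemma Ca_eq : Ca * om 2 = Ca + 3 / 2.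
Proof. by rewrite /Ca -lock; field; rewrite subr_eq0 gt_eqF. Qed.

(** Dyadic telescoping of second difference quotients: the errors between consecutive scales grow
    with ratio [om 2 > 1], so the coarsest one dominates their sum. *)
Lemma second_scale (p : nat) x i j : `|x - xc| + 5 * ((2 ^ p)%:R * h) <= r ->
  `|df ((2 ^ p)%:R *: E i) (df ((2 ^ p)%:R *: E j) (u k)) x / ((2 ^ p)%:R * h) ^+ 2
    - df (E i) (df (E j) (u k)) x / h ^+ 2| <= Ca * N * om ((2 ^ p)%:R * h).
Proof.
elim: p => [|p IH] xr.
  rewrite expn0 !scale1r mul1r subrr normr0.
  apply: mulr_ge0; first by apply: mulr_ge0 => //; exact: Ca_ge0.
  by apply: om_ge0; exact: ltW.
set m := (2 ^ p)%N.
have m0 : (0 < m)%N by rewrite expn_gt0.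
have mr : 0 < m%:R * h by rewrite mulr_gt0 // ltr0n.
have e2 : (2 ^ p.+1)%:R = 2 * m%:R :> R by rewrite expnS natrM.
have xr1 : `|x - xc| + 5 * (m%:R * h) <= r.
  by move: xr; rewrite e2 -mulrA; move: mr; lra.
have := IH xr1; have := second_double i j m0 xr1.
have eo : om (2 * (m%:R * h)) = om 2 * om (m%:R * h) by apply: omM => //; exact: ltW.
rewrite e2 natrM -(mulrA 2 m%:R h) eo.
have mh2 : 0 < (m%:R * h) ^+ 2 by rewrite exprn_gt0.
set A := df _ _ x; set B := df _ _ x; set q := df (E i) _ x; set mh := m%:R * h in mr mh2 * => H1 H2.
have H1' : `|A / (2 * mh) ^+ 2 - B / mh ^+ 2| <= 3 / 2 * (N * om mh).
  have -> : A / (2 * mh) ^+ 2 - B / mh ^+ 2 = (A - 4 * B) / (4 * mh ^+ 2).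
    by field; rewrite gt_eqF.
  rewrite normrM normfV [`|4 * _|]ger0_norm; last by rewrite mulr_ge0 // ltW.
  rewrite ler_pdivrMr; last by rewrite mulr_gt0.
  by apply: le_trans H1 _; rewrite le_eqVlt; apply/orP; left; apply/eqP; field.
have -> : A / (2 * mh) ^+ 2 - q / h ^+ 2 = (A / (2 * mh) ^+ 2 - B / mh ^+ 2) + (B / mh ^+ 2 - q / h ^+ 2).
  by rewrite addrA subrK.
apply: le_trans (ler_normD _ _) _; apply: le_trans (lerD H1' H2) _.
have -> : Ca * N * (om 2 * om mh) = (Ca * om 2) * N * om mh by ring.
by rewrite Ca_eq; rewrite le_eqVlt; apply/orP; left; apply/eqP; ring.
Qed.

Definition C4 := locked (2 * (2 * Ca + 1)).
Lemma C4_ge0 : 0 <= C4. Proof. by rewrite /C4 -lock mulr_ge0 // addr_ge0 // mulr_ge0 // Ca_ge0. Qed.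

(** The variation over [m] steps is measured at a dyadic scale [P >= m], where the third difference
    bound applies, and [second_scale] returns to the unit scale at both ends. The outer factor 2 in
    [C4] comes from [P h <= 2 m h] and [om 2 <= 2]. *)
Lemma second_holder m x i j l : (0 < m)%N -> `|x - xc| + 12 * (m%:R * h) <= r ->
  `|df (m%:R *: E l) (df (E i) (df (E j) (u k))) x| <= h ^+ 2 * (C4 * N * om (m%:R * h)).
Proof.
move=> m0 xr.
have [|p /andP[pm mp]] := @dyadic_scale R h (2 * (m%:R * h)) h0.
  have : 1 <= m%:R :> R by rewrite ler1n.
  by move: h0; nra.
set P := (2 ^ p)%N in pm mp *.
have mh := mh0 m.
have mP : (m <= P)%N by rewrite -(@ler_nat R) -(ler_pM2r h0); lra.
have P0 : (0 < P)%N by rewrite expn_gt0.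
have Ph : 0 < P%:R * h by rewrite mulr_gt0 // ltr0n.
have nx := norm_shift x l m.
have A1 : `|x - xc| + 5 * (P%:R * h) <= r by lra.
have A2 : `|x + m%:R *: E l - xc| + 5 * (P%:R * h) <= r by lra.
have := second_scale i j A1; have := second_scale i j A2.
set D := df (P%:R *: E i) (df (P%:R *: E j) (u k)); rewrite -/P.
set q := df (E i) (df (E j) (u k)) => H2 H1.
have H3 : `|df (m%:R *: E l) D x| <= N * (P%:R * h) ^+ 2 * om (P%:R * h).
  apply: (@le_trans _ _ (m%:R * (N * h * (P%:R * h) * om (P%:R * h)))).
    apply: df_multi0 => a am; apply: TB => //.
    have := norm_shift x l a.
    have : a%:R * h <= m%:R * h by rewrite ler_pM2r // ler_nat ltnW.
    by lra.
  have -> : N * (P%:R * h) ^+ 2 * om (P%:R * h) = P%:R * (N * h * (P%:R * h) * om (P%:R * h)) by ring.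
  by rewrite ler_wpM2r ?ler_nat // !mulr_ge0 ?om_ge0 ?(ltW h0) ?(ltW Ph).
have h20 : 0 < h ^+ 2 by rewrite exprn_gt0.
have P20 : 0 < (P%:R * h) ^+ 2 by rewrite exprn_gt0.
have {}H3 : `|(D (x + m%:R *: E l) - D x) / (P%:R * h) ^+ 2| <= N * om (P%:R * h).
  rewrite normrM normfV (ger0_norm (ltW P20)) ler_pdivrMr //.
  by apply: le_trans H3 _; rewrite le_eqVlt mulrAC eqxx.
have Hq : `|(q (x + m%:R *: E l) - q x) / h ^+ 2| <= (2 * Ca + 1) * N * om (P%:R * h).
  have -> : (q (x + m%:R *: E l) - q x) / h ^+ 2 =
     (D (x + m%:R *: E l) - D x) / (P%:R * h) ^+ 2
      - (D (x + m%:R *: E l) / (P%:R * h) ^+ 2 - q (x + m%:R *: E l) / h ^+ 2)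
      + (D x / (P%:R * h) ^+ 2 - q x / h ^+ 2) by ring.
  apply: le_trans (ler_normD _ _) _; apply: le_trans (lerD (ler_normB _ _) (lexx _)) _.
  by apply: le_trans (lerD (lerD H3 H2) H1) _; rewrite le_eqVlt; apply/orP; left; apply/eqP; ring.
apply: (norm_div_le h20).
apply: le_trans Hq _.
have : om (P%:R * h) <= 2 * om (m%:R * h).
  apply: le_trans (om_le (ltW Ph) pm) _; rewrite omM // ler_wpM2r //; exact: om_ge0.
have : 0 <= (2 * Ca + 1) * N by rewrite mulr_ge0 // addr_ge0 // mulr_ge0 // Ca_ge0.
rewrite /C4 -lock; nra.
Qed.

Hypothesis rs0 : r <= s0.
Lemma uM' x : `|x - xc| <= r -> `|u k x| <= M.
Proof.
move=> xr; move: kr => /andP[k1 k2]; apply: uM => //; first exact: le_trans xr rs0.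
by apply: le_trans k1; move: rs0; lra.
Qed.

Lemma df_le_2 (a : 'rV[R]_n) w (b : R) x : `|w x| <= b -> `|w (x + a)| <= b -> `|df a w x| <= 2 * b.
Proof. by move=> w1 w2; apply: le_trans (ler_normB _ _) _; lra. Qed.

(* Interpolation between the sup norm and the third difference seminorm. *)
Lemma interpolation_second (s : R) x i j : h <= s -> `|x - xc| + 5 * s <= r ->
  `|df (E i) (df (E j) (u k)) x| <= h ^+ 2 * (16 * M / s ^+ 2 + Ca * N * om s).
Proof.
move=> hs xr; have s00' : 0 < s := lt_le_trans h0 hs.
have [p /andP[ps sp]] := dyadic_scale h0 hs.
set P := (2 ^ p)%N in ps sp *.
have Ph : 0 < P%:R * h by rewrite mulr_gt0 // ltr0n expn_gt0.
have A1 : `|x - xc| + 5 * (P%:R * h) <= r by lra.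
have := second_scale i j A1; rewrite -/P.
set D := df _ _ x; set q := df _ _ x => H.
have HD : `|D| <= 2 * (2 * M).
  have n1 := norm_shift x i P; have n2 := norm_shift x j P.
  have n3 := norm_shift (x + P%:R *: E i) j P.
  by apply: df_le_2; apply: df_le_2; apply: uM'; lra.
have h20 : 0 < h ^+ 2 by rewrite exprn_gt0.
have P20 : 0 < (P%:R * h) ^+ 2 by rewrite exprn_gt0.
have HD2 : `|D / (P%:R * h) ^+ 2| <= 16 * M / s ^+ 2.
  rewrite normrM normfV (ger0_norm (ltW P20)) ler_pdivrMr //.
  apply: le_trans HD _; rewrite mulrAC ler_pdivlMr ?exprn_gt0 //.
  have : s ^+ 2 <= 4 * (P%:R * h) ^+ 2 by nra.
  by move: M0; nra.
apply: (norm_div_le h20).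
have -> : q / h ^+ 2 = D / (P%:R * h) ^+ 2 - (D / (P%:R * h) ^+ 2 - q / h ^+ 2) by ring.
apply: le_trans (ler_normB _ _) _; apply: le_trans (lerD HD2 H) _.
rewrite lerD2l; apply: ler_wpM2l; last by apply: om_le => //; exact: ltW.
by apply: mulr_ge0 => //; exact: Ca_ge0.
Qed.

(** The mean of [m] consecutive unit differences is at most [2 M / m], and the unit differences
    deviate from each other by second differences, which are bounded already. *)
Lemma interpolation_first (s : R) x i : h <= s -> `|x - xc| + 6 * s <= r ->
  `|df (E i) (u k) x| <= h * (20 * M / s + Ca * N * (s * om s)).
Proof.
move=> hs xr; have s00' : 0 < s := lt_le_trans h0 hs.
have [p /andP[ps sp]] := dyadic_scale h0 hs.
set m := (2 ^ p)%N in ps sp *.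
have m0 : (0 < m)%N by rewrite expn_gt0.
have m0R : 0 < m%:R :> R by rewrite ltr0n.
have Ph : 0 < m%:R * h by rewrite mulr_gt0.
set Q := 16 * M / s ^+ 2 + Ca * N * om s.
have Q0 : 0 <= Q.
  apply: addr_ge0; first by apply: divr_ge0; rewrite ?sqr_ge0 // mulr_ge0.
  apply: mulr_ge0; last by apply: om_ge0; exact: ltW.
  by apply: mulr_ge0 => //; exact: Ca_ge0.
have := @df_multi R n m (E i) (u k) (df (E i) (u k) x) (m%:R * (h ^+ 2 * Q)) x.
move=> HH; have /HH{HH} : forall a, (a < m)%N -> `|df (E i) (u k) (x + a%:R *: E i) - df (E i) (u k) x| <= m%:R * (h ^+ 2 * Q).
  move=> a am.
  have -> : df (E i) (u k) (x + a%:R *: E i) - df (E i) (u k) x = df (a%:R *: E i) (df (E i) (u k)) x by [].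
  apply: (@le_trans _ _ (a%:R * (h ^+ 2 * Q))); last first.
    by apply: ler_wpM2r; [apply: mulr_ge0; rewrite ?sqr_ge0 | rewrite ler_nat ltnW].
  apply: df_multi0 => b ba; apply: interpolation_second => //.
  have := norm_shift x i b.
  have : b%:R * h <= m%:R * h by rewrite ler_pM2r // ler_nat ltnW // (ltn_trans ba).
  by lra.
move=> H.
have HD : `|df (m%:R *: E i) (u k) x| <= 2 * M.
  by have n1 := norm_shift x i m; apply: df_le_2; apply: uM'; lra.
have : m%:R * `|df (E i) (u k) x| <= 2 * M + m%:R * (m%:R * (h ^+ 2 * Q)).
  rewrite -[m%:R * `|_|](ger0_norm (mulr_ge0 (ltW m0R) (normr_ge0 _))) normrM normr_id -normrM.
  rewrite -[X in `|X|](subKr (df (m%:R *: E i) (u k) x)).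
  by apply: le_trans (ler_normB _ _) _; apply: lerD HD H.
rewrite -ler_pdivlMl // => /le_trans; apply.
rewrite mulrDr mulKf ?gt_eqF //.
have -> : h * (20 * M / s + Ca * N * (s * om s)) = h * (4 * M / s) + h * s * Q.
  by rewrite /Q; field; rewrite gt_eqF.
apply: lerD.
  rewrite ler_pdivrMl // !mulrA ler_pdivlMr //.
  by move: M0; nra.
have -> : m%:R * (h ^+ 2 * Q) = h * (m%:R * h) * Q by ring.
by rewrite ler_wpM2r // ler_pM2l.
Qed.

End Downscale.

Lemma df_ball (a y : 'rV[R]_n) w (b c de : R) : `|a| <= de ->
  (forall z, `|z - xc| <= c + de -> `|w z| <= b) -> `|y - xc| <= c -> `|df a w y| <= 2 * b.
Proof.
move=> ad wb yc; apply: df_le_2; apply: wb.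
  by rewrite (le_trans yc) // lerDl (le_trans _ ad).
by rewrite addrAC (le_trans (ler_normD _ _)) // lerD.
Qed.

Lemma third_bound_le r N N' : N <= N' -> third_bound r N -> third_bound r N'.
Proof.
move=> NN TB k x i j l m m0 xr kr; apply: le_trans (TB k x i j l m m0 xr kr) _.
have mh := mh0 m.
by do 3 (rewrite ler_wpM2r //; try by rewrite ?om_ge0 // ltW).
Qed.

(** Start of the absorption argument: on a fixed grid the seminorm is finite, with a constant that
    degenerates with the mesh. *)
Lemma third_bound_trivial r : r <= s0 -> third_bound r (8 * M / h ^+ 3).
Proof.
move=> rs k x i j l m m0 xr /andP[k1 k2].
have mh := mh0 m; have h' := h0.
have ub y : `|y - xc| <= r -> `|u k y| <= M.
  by move=> yr; apply: uM; [exact: le_trans rs|lra|].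
have hmh' : h <= m%:R * h by rewrite ler_peMl ?ler1n // ltW.
have mh1 : m%:R * h <= 1.
  apply: le_trans s01; apply: le_trans rs; apply: le_trans xr.
  by rewrite addrC ler_wpDr // ler_peMl // ler1n.
have H8 : `|df (E l) (df (m%:R *: E i) (df (m%:R *: E j) (u k))) x| <= 2 * (2 * (2 * M)).
  have nE i1 : `|m%:R *: E i1| <= m%:R * h.
    by rewrite normrZ normr_nat ler_wpM2l // norm_scale_evec // ltW.
  have nl : `|E l| <= m%:R * h by rewrite (le_trans (norm_scale_evec _ (ltW h'))).
  apply: (df_ball nl _ (lexx _)) => z zr; apply: (df_ball (nE i) _ zr) => z' zr'.
  apply: (df_ball (nE j) _ zr') => z'' zr''; apply: ub; apply: le_trans zr'' _.
  by apply: le_trans xr; rewrite -!addrA lerD2l; lra.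
apply: le_trans H8 _.
have P1 : h * h * h <= h * (m%:R * h) * om (m%:R * h).
  apply: ler_pM => //; [by rewrite mulr_ge0 // ltW|exact: ltW|by rewrite ler_pM2l|].
  by apply: le_trans hmh' _; exact: om_ge.
have -> (c : R) : c * h * (m%:R * h) * om (m%:R * h) = c * (h * (m%:R * h) * om (m%:R * h)) by ring.
have -> : 2 * (2 * (2 * M)) = 8 * M / h ^+ 3 * (h * h * h) by field; rewrite gt_eqF.
apply: ler_wpM2l => //; apply: divr_ge0; first exact: mulr_ge0.
by apply: exprn_ge0; exact: ltW.
Qed.

(** * One absorption step: freezing the coefficients, fine and coarse scales *)

Section Step.
Variables (I : eqType) (ds : seq I) (sg : I -> seq ('I_n * bool)) (be : I -> 'rV[R]_n -> R).
Variables (bp bm : 'I_n -> 'rV[R]_n -> R) (Hf : 'rV[R]_n -> R -> R).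
Variables (Bm HC LH c0 ka : R) (S0 : nat).
Local Notation inb x := (`|x - xc| <= s0).
Hypotheses (Bm0 : 0 <= Bm) (HC0 : 0 <= HC) (LH0 : 0 <= LH) (c00 : 0 < c0).
Hypothesis be0 : forall d x, d \in ds -> inb x -> 0 <= be d x.
Hypothesis beB : forall d x, d \in ds -> inb x -> be d x <= Bm.
Hypothesis beH : forall d x y, d \in ds -> inb x -> inb y -> `|be d x - be d y| <= HC * om `|x - y|.
Hypothesis bpB : forall i x, inb x -> `|bp i x| <= Bm.
Hypothesis bpH : forall i x y, inb x -> inb y -> `|bp i x - bp i y| <= HC * om `|x - y|.
Hypothesis bmB : forall i x, inb x -> `|bm i x| <= Bm.
Hypothesis bmH : forall i x y, inb x -> inb y -> `|bm i x - bm i y| <= HC * om `|x - y|.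
Hypothesis coord : forall i, exists d, [/\ d \in ds, sg d = [:: (i, true)]
  & forall x, inb x -> c0 <= be d x].
Hypothesis sgS : forall d, d \in ds -> (size (sg d) <= S0)%N.
Hypothesis S01 : (1 <= S0)%N.
Hypothesis HfL : forall x y z z', inb x -> inb y -> `|z| <= M -> `|z'| <= M ->
  `|Hf x z - Hf y z'| <= LH * (`|x - y| + `|z - z'|).
Local Notation ns := ((size ds)%:R : R).
Hypothesis cfl : tau / h ^+ 2 * (2 * (ns * Bm) + 3 * Bm) <= 1.
Hypothesis ka1 : 1 <= ka.
Hypothesis kaL : 2 * (ns * Bm * (n%:R * S0%:R ^+ 2)) + 2 <= 3 / 2 * c0 * ka.

(** Upwind differences: when [bp] and [bm] are nonnegative, every neighbour of [x] receives a
    nonnegative weight. *)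
Definition drift (w : 'rV[R]_n -> R) x := \sum_i (bp i x * (df (E i) w x / h)
   - bm i x * (df (E i) w (x - E i) / h)).
Hypothesis ueq : forall k x, inb x -> t0 <= k%:R * tau -> k.+1%:R * tau <= t1 ->
  u k.+1 x = u k x + tau * (\sum_(d <- ds) be d x * (sd h (sg d) (u k) x / h ^+ 2)
     + drift (u k) x + Hf x (u k x)).

Definition Z1 := ns * HC * S0%:R ^+ 2 + 2 * n%:R * (HC + Bm) + LH.
Definition Z2 := ns * HC * S0%:R ^+ 2 * C4.

Variables (K e1 s1 : R).
Hypotheses (K2 : 2 <= K) (KS : S0%:R <= K).
Hypotheses (e10 : 0 < e1) (Ke1 : 60 * K * e1 <= 1) (s10 : 0 < s1) (s1e : s1 <= e1)
  (s1C : 64 * Ca * s1 <= e1) (s124 : 24 * s1 <= 1).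
Hypothesis smallK : 2 * ka * (C4 * om 4 * (om K / K)) <= 1 / 32.
Hypothesis smalls : 2 * ka * (4 * K * (2 * Z1 * Ca * om s1 + Z2 * om (6 * K * e1))) <= 1 / 32.
(** [K] is the ratio of the doubling radius to the scale [m h]; [e1] separates fine from coarse
    scales and [s1] is the interpolation length, both relative to the gap between two radii. The
    three summands of [C5] belong to fine scales, coarse scales, and a mesh that is not small
    against the gap. *)
Definition C5 := 8 * ka * K * Z1 * (36 / s1 ^+ 2 + 1) + 80 / (s1 * e1 ^+ 2) + 8 / s1 ^+ 3.

Lemma Z1_ge0 : 0 <= Z1.
Proof. by rewrite /Z1 !addr_ge0 // !mulr_ge0 // addr_ge0. Qed.

Lemma Z2_ge0 : 0 <= Z2.
Proof. by rewrite /Z2 !mulr_ge0 // C4_ge0. Qed.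

Lemma ka0 : 0 <= ka. Proof. exact: le_trans ler01 ka1. Qed.
Lemma K0 : 0 < K. Proof. by move: K2; lra. Qed.

Lemma C5_parts : [/\ 0 <= 8 * ka * K * Z1 * (36 / s1 ^+ 2 + 1), 0 <= 80 / (s1 * e1 ^+ 2) & 0 <= 8 / s1 ^+ 3].
Proof.
have s1' := ltW s10; have e1' := ltW e10.
split; last 2 first.
- by rewrite divr_ge0 // mulr_ge0 // exprn_ge0.
- by rewrite divr_ge0 // exprn_ge0.
rewrite !mulr_ge0 ?ka0 ?Z1_ge0 ?(ltW K0) //.
by rewrite addr_ge0 // divr_ge0 // exprn_ge0.
Qed.

Lemma sd_linear_df (a : 'rV[R]_n) s w y : sd h s (df a w) y = df a (sd h s w) y.
Proof. by rewrite /sd /df !(addrAC y a) ; ring. Qed.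

Definition frozen x0 w y := \sum_(d <- ds) be d x0 * (sd h (sg d) w y / h ^+ 2).

Lemma frozen_df x0 (a : 'rV[R]_n) w y : frozen x0 (df a w) y = df a (frozen x0 w) y.
Proof.
rewrite /frozen [RHS]/df -sumrB; apply: eq_bigr => d _.
by rewrite sd_linear_df /df; ring.
Qed.

(** What freezing at [x0] moves to the right-hand side. The leading coefficients vanish at [x0],
    hence are small on the doubling ball. *)
Definition source x0 k y := \sum_(d <- ds) (be d y - be d x0) * (sd h (sg d) (u k) y / h ^+ 2)
  + drift (u k) y + Hf y (u k y).

Lemma ueq_frozen x0 k y : inb y -> t0 <= k%:R * tau -> k.+1%:R * tau <= t1 ->
  u k.+1 y = u k y + tau * (frozen x0 (u k) y + source x0 k y).
Proof.
move=> yb k1 k2; rewrite ueq // /frozen /source.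
have -> : \sum_(d <- ds) be d y * (sd h (sg d) (u k) y / h ^+ 2) =
   \sum_(d <- ds) be d x0 * (sd h (sg d) (u k) y / h ^+ 2)
   + \sum_(d <- ds) (be d y - be d x0) * (sd h (sg d) (u k) y / h ^+ 2).
  by rewrite -big_split /=; apply: eq_bigr => d _; ring.
by rewrite !addrA.
Qed.

Lemma df_mul (a : 'rV[R]_n) w1 w2 y :
  df a (fun z => w1 z * w2 z) y = df a w1 y * w2 (y + a) + w1 y * df a w2 y.
Proof. by rewrite /df; ring. Qed.

Lemma df_mul_bound (a : 'rV[R]_n) w1 w2 y (b1 b2 b3 b4 : R) :
  `|df a w1 y| <= b1 -> `|w2 (y + a)| <= b2 -> `|w1 y| <= b3 -> `|df a w2 y| <= b4 ->
  `|df a (fun z => w1 z * w2 z) y| <= b1 * b2 + b3 * b4.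
Proof.
move=> H1 H2 H3 H4; rewrite df_mul (le_trans (ler_normD _ _)) // !normrM.
by apply: lerD; apply: ler_pM.
Qed.

Section OneStep.
Variables (r r' N : R).
Hypotheses (r0 : 0 <= r) (rr : r < r') (rs : r' <= s0) (N0 : 0 <= N) (TB : third_bound r' N).
Let d := r' - r.
(** Interpolation length; [Q] and [P] are the resulting bounds for unit second and first difference
    quotients. *)
Let s := s1 * d.
Let Q := 16 * M / s ^+ 2 + Ca * N * om s.
Let P := 20 * M / s + Ca * N * (s * om s).
Hypothesis dh : h < s1 * d.

Lemma d0 : 0 < d. Proof. by rewrite /d subr_gt0. Qed.
Lemma d1 : d <= 1. Proof. by rewrite /d; move: r0 rs s01; lra. Qed.
Lemma s_gt0 : 0 < s. Proof. by rewrite /s mulr_gt0 // d0. Qed.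
Lemma s24 : 24 * s <= d.
Proof. by rewrite /s mulrA ler_piMl // ltW // d0. Qed.
Lemma Q_ge0 : 0 <= Q.
Proof.
apply: addr_ge0; first by apply: divr_ge0; rewrite ?sqr_ge0 // mulr_ge0.
by rewrite !mulr_ge0 ?Ca_ge0 // om_ge0 // ltW // s_gt0.
Qed.
Lemma P_ge0 : 0 <= P.
Proof.
have s0' := ltW s_gt0.
apply: addr_ge0; first by apply: divr_ge0 => //; rewrite mulr_ge0.
by apply: mulr_ge0; [apply: mulr_ge0 => //; exact: Ca_ge0|apply: mulr_ge0 => //; exact: om_ge0].
Qed.

Lemma q_bound k y i j : in_time r' k -> `|y - xc| <= r + d / 2 ->
  `|df (E i) (df (E j) (u k)) y| <= h ^+ 2 * Q.
Proof.
move=> kr yr; apply: (interpolation_second N0 TB kr rs); first exact: ltW.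
by have := s24; move: yr d0; rewrite -/s /d; lra.
Qed.

Lemma p_bound k y i : in_time r' k -> `|y - xc| <= r + d / 2 ->
  `|df (E i) (u k) y| <= h * P.
Proof.
move=> kr yr; apply: (interpolation_first N0 TB kr rs); first exact: ltW.
by have := s24; move: yr d0; rewrite -/s /d; lra.
Qed.

(** Here [m h] is a fixed fraction of the gap, and the interpolated first difference at four points
    is enough. The condition [64 * Ca * s1 <= e1] keeps the share of [N] below [N / 16]. *)
Lemma coarse_scale k x i j l m : (0 < m)%N -> e1 * d <= m%:R * h ->
  `|x - xc| + 3 * (m%:R * h) <= r -> in_time r k ->
  `|df (E l) (df (m%:R *: E i) (df (m%:R *: E j) (u k))) x| <=
    (N / 16 + C5 * (M + 1) * (d ^- 3)) * h * (m%:R * h) * om (m%:R * h).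
Proof.
move=> m0 em xr kr.
have mh := mh0 m; have dd := d0; have dd1 := d1; have s1' := ltW s10.
have kr' : in_time r' k.
  by move: kr rr => /andP[k1 k2] rr'; rewrite /in_time k2 andbT; move: k1; lra.
have pbd y : `|y - xc| <= r -> `|df (E l) (u k) y| <= h * P.
  by move=> yr; apply: p_bound => //; lra.
have H4 : `|df (E l) (df (m%:R *: E i) (df (m%:R *: E j) (u k))) x| <= 4 * (h * P).
  rewrite (dfC (E l)) (dfC (E l)).
  have n1 := norm_shift x i m; have n2 := norm_shift x j m.
  have n3 := norm_shift (x + m%:R *: E i) j m.
  have -> : 4 * (h * P) = 2 * (2 * (h * P)) by ring.
  by apply: df_le_2; apply: df_le_2; apply: pbd; lra.
apply: le_trans H4 _.
have omed : e1 * d <= om (e1 * d).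
  apply: om_ge; first by rewrite mulr_ge0 // ltW.
  by move: Ke1 K2 e10; nra.
have ed0 : 0 < e1 * d by rewrite mulr_gt0.
have -> (c : R) : c * h * (m%:R * h) * om (m%:R * h) = h * (c * ((m%:R * h) * om (m%:R * h))) by ring.
rewrite mulrCA ler_pM2l //.
have X : e1 * d * om (e1 * d) <= m%:R * h * om (m%:R * h).
  by apply: ler_pM => //; [exact: ltW|exact: om_ge0 (ltW ed0)|apply: om_le => //; exact: ltW].
have [C1 C2 C3] := C5_parts.
have d3 : 0 < d ^- 3 by rewrite invr_gt0 exprn_gt0.
have cst0 : 0 <= N / 16 + C5 * (M + 1) * (d ^- 3).
  apply: addr_ge0; first by rewrite divr_ge0.
  apply: mulr_ge0; last exact: ltW.
  by apply: mulr_ge0; [rewrite /C5; lra|move: M0; lra].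
apply: le_trans (ler_wpM2l cst0 X).
rewrite [leRHS]mulrDl [leRHS]addrC /P [leLHS]mulrDr; apply: lerD.
  have -> : 4 * (20 * M / s) = 80 / (s1 * e1 ^+ 2) * M * d ^- 3 * ((e1 * d) * (e1 * d)).
    by rewrite /s; field; rewrite !gt_eqF.
  apply: ler_pM => //.
  - by apply: mulr_ge0; [exact: mulr_ge0|exact: ltW].
  - by apply: mulr_ge0; exact: ltW.
  - rewrite ler_wpM2r ?(ltW d3) // /C5; move: M0 => M0'; nra.
  - by rewrite ler_pM2l.
have -> : 4 * (Ca * N * (s * om s)) = N * (4 * Ca * s1 * (d * om s)) by rewrite /s; ring.
have -> : N / 16 * (e1 * d * om (e1 * d)) = N * (16^-1 * e1 * (d * om (e1 * d))) by field.
rewrite ler_wpM2l //; apply: ler_pM.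
- by rewrite !mulr_ge0 ?Ca_ge0.
- by rewrite mulr_ge0 ?(ltW dd) // om_ge0 // ltW // s_gt0.
- by move: s1C; lra.
- rewrite ler_pM2l // om_le //; first exact: ltW s_gt0.
  by rewrite /s ler_pM2r.
Qed.

Section Fine.
Variables (m : nat) (x0 : 'rV[R]_n) (i j l : 'I_n) (k0 : nat).
Hypotheses (m0 : (0 < m)%N) (em : m%:R * h < e1 * d) (xr : `|x0 - xc| + 3 * (m%:R * h) <= r)
  (kr0 : in_time r k0).
(** A radius [K] times the scale turns the oscillation term of the gradient bound into one with the
    small factor [om K / K]. *)
Let R0 := K * (m%:R * h).
Let mh := m%:R * h.

Lemma mh_gt0 : 0 < mh. Proof. by rewrite /mh mulr_gt0 // ltr0n. Qed.
Lemma R0_gt0 : 0 < R0. Proof. by rewrite /R0 mulr_gt0 ?K0 //; exact: mh_gt0. Qed.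
Lemma mhR0 : 2 * mh <= R0. Proof. by rewrite /R0 ler_pM2r // mh_gt0. Qed.
Lemma R0d : 60 * R0 <= d.
Proof.
rewrite /R0; apply: (@le_trans _ _ (60 * K * (e1 * d))).
  by rewrite -!mulrA ler_pM2l // ler_pM2l ?K0 // ltW.
by rewrite mulrA ler_piMl // ltW // d0.
Qed.
Lemma hmh : h <= mh.
Proof. by rewrite /mh ler_peMl // ?ler1n // ltW. Qed.
Lemma mh_le1 : mh <= 1.
Proof. by have := mhR0; have := R0d; have := d1; have := mh_gt0; lra. Qed.

Lemma near_x0 y (c : R) : `|y - x0| <= c -> `|y - xc| <= r + c - 3 * mh.
Proof.
move=> yc; have -> : y - xc = (y - x0) + (x0 - xc) by rewrite addrA subrK.
by rewrite (le_trans (ler_normD _ _)) //; move: xr; rewrite -/mh; lra.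
Qed.

Lemma inb_near y : `|y - x0| <= 20 * R0 -> inb y.
Proof.
move/near_x0; have := R0d; have := mh_gt0; have := R0_gt0; have := rs; rewrite /d; lra.
Qed.

Lemma shift_near y i1 (c : R) : `|y - x0| <= c -> `|y + m%:R *: E i1 - x0| <= c + mh.
Proof.
move=> yc; rewrite addrAC (le_trans (ler_normD _ _)) // lerD // normrZ normr_nat.
by rewrite /mh ler_wpM2l // norm_scale_evec // ltW.
Qed.

(** Product rule in each term. A difference falling on a coefficient gives [om mh] times a lower
    order quotient; one falling on the second difference quotients gives [om mh] times [N],
    multiplied by [be d y - be d x0], which is at most [HC * om (6 * R0)]. *)
Lemma source_bound k y : in_time r' k -> `|y - x0| <= 5 * R0 ->
  `|df (m%:R *: E j) (source x0 k) y| <= om mh * (Z1 * (Q + P + 1) + Z2 * om (6 * R0) * N).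
Proof.
move=> kr yR.
have mh_ := mh_gt0; have R0_ := R0_gt0; have mR := mhR0; have Rd := R0d; have dd := d0.
have Q0 := Q_ge0; have P0 := P_ge0; have h' := h0.
have om0 : 0 <= om mh by apply: om_ge0; exact: ltW.
set a := m%:R *: E j.
have yaR : `|y + a - x0| <= 6 * R0 by apply: le_trans (shift_near j yR) _; lra.
have iy : inb y by apply: inb_near; lra.
have iya : inb (y + a) by apply: inb_near; lra.
have na : `|y + a - y| <= mh.
  by rewrite addrAC subrr add0r /a normrZ normr_nat /mh ler_wpM2l // norm_scale_evec // ltW.
have om_a : om `|y + a - y| <= om mh by apply: om_le.
have omy : om `|y - x0| <= om (6 * R0) by apply: om_le => //; lra.
have ix0 : inb x0 by apply: inb_near; rewrite subrr normr0; lra.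
have qb z i1 j1 : `|z - x0| <= 10 * R0 -> `|df (E i1) (df (E j1) (u k)) z| <= h ^+ 2 * Q.
  by move=> /near_x0 zr; apply: q_bound => //; lra.
have pb z i1 : `|z - x0| <= 10 * R0 -> `|df (E i1) (u k) z| <= h * P.
  by move=> /near_x0 zr; apply: p_bound => //; lra.
have h20 : 0 < h ^+ 2 by rewrite exprn_gt0.
have sdQ dd0 z : dd0 \in ds -> `|z - x0| <= 6 * R0 ->
    `|sd h (sg dd0) (u k) z / h ^+ 2| <= S0%:R ^+ 2 * Q.
  move=> di zR; rewrite normrM normfV (gtr0_norm h20) ler_pdivrMr //.
  have sz : (size (sg dd0))%:R <= S0%:R :> R by rewrite ler_nat sgS.
  apply: (@le_trans _ _ ((size (sg dd0))%:R ^+ 2 * (h ^+ 2 * Q))).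
    apply: sd_bound => [|w i1 j1 wz]; first exact: ltW.
    apply: qb; have -> : w - x0 = (w - z) + (z - x0) by rewrite addrA subrK.
    rewrite (le_trans (ler_normD _ _)) //.
    have hs : h * (size (sg dd0))%:R <= R0.
      rewrite /R0 mulrC; apply: ler_pM => //; [exact: ltW|exact: le_trans sz KS|exact: hmh].
    by lra.
  rewrite -(mulrA _ Q) (mulrC Q); apply: ler_wpM2r; first by rewrite mulr_ge0 // ltW.
  by rewrite lerXn2r ?nnegrE.
have sdH dd0 : dd0 \in ds -> `|df a (fun z => sd h (sg dd0) (u k) z / h ^+ 2) y| <=
     S0%:R ^+ 2 * (C4 * N * om mh).
  move=> di; have -> : df a (fun z => sd h (sg dd0) (u k) z / h ^+ 2) y = sd h (sg dd0) (df a (u k)) y / h ^+ 2.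
    by rewrite sd_linear_df; symmetry; exact: mulrBl.
  rewrite normrM normfV (gtr0_norm h20) ler_pdivrMr //.
  have sz : (size (sg dd0))%:R <= S0%:R :> R by rewrite ler_nat sgS.
  apply: (@le_trans _ _ ((size (sg dd0))%:R ^+ 2 * (h ^+ 2 * (C4 * N * om mh)))).
    apply: sd_bound => [|w i1 j1 wy]; first exact: ltW.
    have -> : df (E i1) (df (E j1) (df a (u k))) = df a (df (E i1) (df (E j1) (u k))).
      by rewrite (dfC (E j1)) (dfC (E i1)).
    apply: (second_holder N0 TB kr) => //.
    have : `|w - x0| <= 8 * R0.
      have -> : w - x0 = (w - y) + (y - x0) by rewrite addrA subrK.
      rewrite (le_trans (ler_normD _ _)) //.
      have hs : h * (size (sg dd0))%:R <= R0.
        rewrite /R0 mulrC; apply: ler_pM => //; [exact: ltW|exact: le_trans sz KS|exact: hmh].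
      by lra.
    by move/near_x0; rewrite -/mh; move: Rd dd; rewrite /d; lra.
  rewrite -(mulrA _ (C4 * _ * _)) (mulrC (C4 * _ * _)); apply: ler_wpM2r.
    by rewrite !mulr_ge0 ?C4_ge0 // ltW.
  by rewrite lerXn2r ?nnegrE.
have part1 : `|df a (fun z => \sum_(d1 <- ds) (be d1 z - be d1 x0) * (sd h (sg d1) (u k) z / h ^+ 2)) y|
    <= om mh * (ns * HC * S0%:R ^+ 2 * Q + Z2 * om (6 * R0) * N).
  have -> : df a (fun z => \sum_(d1 <- ds) (be d1 z - be d1 x0) * (sd h (sg d1) (u k) z / h ^+ 2)) y =
     \sum_(d1 <- ds) df a (fun z => (be d1 z - be d1 x0) * (sd h (sg d1) (u k) z / h ^+ 2)) y.
    by rewrite /df -sumrB.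
  apply: le_trans (ler_norm_sum _ _ _) _.
  apply: (@le_trans _ _ (\sum_(d1 <- ds) (HC * om mh * (S0%:R ^+ 2 * Q)
      + HC * om (6 * R0) * (S0%:R ^+ 2 * (C4 * N * om mh))))).
    rewrite big_seq [leRHS]big_seq; apply: ler_sum => d1 di; apply: df_mul_bound.
    - rewrite /df opprB addrA subrK (le_trans (beH di iya iy)) //; exact: ler_wpM2l.
    - exact: sdQ.
    - by rewrite (le_trans (beH di iy ix0)) //; exact: ler_wpM2l.
    - exact: sdH.
  by rewrite big_const_seq count_predT iter_addr_0 -mulr_natl /Z2 le_eqVlt; apply/orP; left; apply/eqP; ring.
have mhom : mh <= om mh by apply: om_ge; [exact: ltW|exact: mh_le1].
have dfm z i1 : `|z - x0| <= 7 * R0 -> `|df a (df (E i1) (u k)) z / h| <= om mh * Q.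
  move=> zR; rewrite normrM normfV (gtr0_norm h') ler_pdivrMr //.
  apply: (@le_trans _ _ (m%:R * (h ^+ 2 * Q))).
    rewrite dfC -dfC; apply: df_multi0 => b bm'; apply: qb.
    rewrite addrAC (le_trans (ler_normD _ _)) // normrZ normr_nat.
    have : b%:R * `|E j| <= mh.
      by rewrite /mh; apply: ler_pM => //; [rewrite ler_nat ltnW|rewrite norm_scale_evec // ltW].
    by lra.
  have -> : m%:R * (h ^+ 2 * Q) = mh * Q * h by rewrite /mh; ring.
  by rewrite ler_pM2r // ler_wpM2r.
have part2 : `|df a (drift (u k)) y| <= om mh * (2 * n%:R * (HC + Bm) * (Q + P)).
  have -> : df a (drift (u k)) y = \sum_i1 (df a (fun z => bp i1 z * (df (E i1) (u k) z / h)) y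
       - df a (fun z => bm i1 z * (df (E i1) (u k) (z - E i1) / h)) y).
    by rewrite /drift /df -sumrB /=; apply: eq_bigr => i1 _ /=; ring.
  apply: le_trans (ler_norm_sum _ _ _) _.
  apply: (@le_trans _ _ (\sum_(i1 < n) (2 * (om mh * (HC + Bm) * (Q + P))))); last first.
    by rewrite sumr_const card_ord -[X in _ <= X]mulr1 -mulr_natl le_eqVlt; apply/orP; left; apply/eqP; ring.
  apply: ler_sum => i1 _; apply: le_trans (ler_normB _ _) _.
  have B1 : HC * om mh * P + Bm * (om mh * Q) <= om mh * (HC + Bm) * (Q + P).
    have : 0 <= om mh * HC * Q + om mh * Bm * P by rewrite addr_ge0 // !mulr_ge0.
    by lra.
  have pbh z : `|z - x0| <= 10 * R0 -> `|df (E i1) (u k) z / h| <= P.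
    by move=> zR; rewrite normrM normfV (gtr0_norm h') ler_pdivrMr // mulrC pb.
  have sE z c : `|z - x0| <= c -> `|z - E i1 - x0| <= c + mh.
    move=> zc; rewrite addrAC (le_trans (ler_normB _ _)) // lerD //.
    by rewrite (le_trans (norm_scale_evec _ (ltW h'))) // hmh.
  have Hp : `|df a (fun z => bp i1 z * (df (E i1) (u k) z / h)) y| <= om mh * (HC + Bm) * (Q + P).
    apply: le_trans B1; apply: df_mul_bound.
    - by rewrite /df (le_trans (bpH i1 iya iy)) //; exact: ler_wpM2l.
    - by apply: pbh; lra.
    - exact: bpB.
    - have -> : df a (fun z => df (E i1) (u k) z / h) y = df a (df (E i1) (u k)) y / h.
        by symmetry; exact: mulrBl.
      by apply: dfm; lra.
  have Hm : `|df a (fun z => bm i1 z * (df (E i1) (u k) (z - E i1) / h)) y| <= om mh * (HC + Bm) * (Q + P).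
    apply: le_trans B1; apply: df_mul_bound.
    - by rewrite /df (le_trans (bmH i1 iya iy)) //; exact: ler_wpM2l.
    - by apply: pbh; have := sE _ _ yaR; lra.
    - exact: bmB.
    - have -> : df a (fun z => df (E i1) (u k) (z - E i1) / h) y = df a (df (E i1) (u k)) (y - E i1) / h.
        transitivity ((df (E i1) (u k) (y + a - E i1) - df (E i1) (u k) (y - E i1)) / h).
          by symmetry; exact: mulrBl.
        by rewrite (addrAC y a).
      by apply: dfm; have := sE _ _ yR; lra.
  by lra.
have part3 : `|df a (fun z => Hf z (u k z)) y| <= om mh * (LH * (1 + P)).
  have uMM z : `|z - x0| <= 10 * R0 -> `|u k z| <= M.
    by move/near_x0 => zr; apply: (uM' kr rs); move: zr Rd; rewrite /d; lra.
  rewrite /df (le_trans (HfL iya iy _ _)) //; [by apply: uMM; lra|by apply: uMM; lra|].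
  rewrite [leRHS]mulrCA ler_wpM2l //.
  have du : `|u k (y + a) - u k y| <= mh * P.
    have -> : mh * P = m%:R * (h * P) by rewrite /mh mulrA.
    apply: (@df_multi0 R n m (E j) (u k) (h * P) y) => b bm'; apply: pb.
    rewrite addrAC (le_trans (ler_normD _ _)) // normrZ normr_nat.
    have : b%:R * `|E j| <= mh.
      by rewrite /mh; apply: ler_pM => //; [rewrite ler_nat ltnW|rewrite norm_scale_evec // ltW].
    by lra.
  apply: le_trans (lerD na du) _.
  by rewrite -[X in X + _]mulr1 -mulrDr ler_wpM2r // addr_ge0.
have -> : df a (source x0 k) y =
   df a (fun z => \sum_(d1 <- ds) (be d1 z - be d1 x0) * (sd h (sg d1) (u k) z / h ^+ 2)) y
   + df a (drift (u k)) y + df a (fun z => Hf z (u k z)) y by rewrite /source /df; ring.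
apply: le_trans (ler_normD _ _) _; apply: le_trans (lerD (ler_normD _ _) (lexx _)) _.
apply: le_trans (lerD (lerD part1 part2) part3) _.
rewrite -!mulrDr ler_wpM2l // /Z1.
have : 0 <= ns * HC * S0%:R ^+ 2 * (P + 1) + 2 * n%:R * (HC + Bm) + LH * Q.
  apply: addr_ge0; [apply: addr_ge0|]; repeat apply: mulr_ge0 => //; exact: addr_ge0.
by lra.
Qed.

(** Separates in [Q] and [P] the part proportional to [N], with the small factor [om s1], from the
    part proportional to [M]. Since [d <= 1], all inverse powers of [d] are raised to [d ^- 3]. *)
Lemma lower_order_bound : Z1 * (Q + P + 1) + Z2 * om (6 * R0) * N <=
  N * (2 * Z1 * Ca * om s1 + Z2 * om (6 * K * e1)) + Z1 * (36 / s1 ^+ 2 + 1) * ((M + 1) * d ^- 3).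
Proof.
have dd := d0; have dd1 := d1; have M0' := M0; have z1 := Z1_ge0; have s1' := s10.
have d3 : 1 <= d ^- 3 by rewrite invf_ge1 ?exprn_gt0 // exprn_ile1 // ltW.
have s1_1 : s1 <= 1 by move: s124 s1'; lra.
have s_le : s <= s1 by rewrite /s ler_piMr // ltW.
have s0' := ltW s_gt0.
have oms : om s <= om s1 by apply: om_le.
have om00 : 0 <= om s1 by apply: om_ge0; exact: ltW.
have CN : 0 <= Ca * N by rewrite mulr_ge0 // Ca_ge0.
have q1 : Ca * N * om s <= Ca * N * om s1 by rewrite ler_wpM2l.
have p1 : Ca * N * (s * om s) <= Ca * N * om s1.
  rewrite ler_wpM2l // (le_trans _ oms) // ler_piMl //; first by apply: om_ge0.
  exact: le_trans s_le s1_1.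
have q2 : 16 * M / s ^+ 2 <= 16 / s1 ^+ 2 * (M * d ^- 3).
  have -> : 16 * M / s ^+ 2 = 16 / s1 ^+ 2 * (M * d ^- 3) * d by rewrite /s; field; rewrite !gt_eqF.
  by rewrite ler_piMr // !mulr_ge0 ?invr_ge0 ?exprn_ge0 // ltW.
have p2 : 20 * M / s <= 20 / s1 ^+ 2 * (M * d ^- 3).
  have -> : 20 * M / s = 20 / s1 ^+ 2 * (M * d ^- 3) * (s1 * d ^+ 2) by rewrite /s; field; rewrite !gt_eqF.
  rewrite ler_piMr //; first by rewrite !mulr_ge0 ?invr_ge0 ?exprn_ge0 // ltW.
  by rewrite mulr_ile1 ?exprn_ile1 ?exprn_ge0 // ltW.
have md : M * d ^- 3 <= (M + 1) * d ^- 3.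
  by rewrite ler_wpM2r //; [exact: le_trans d3|rewrite lerDl].
have m1 : 1 <= (M + 1) * d ^- 3 by rewrite mulr_ege1 // lerDr.
have s36 : 0 <= 36 / s1 ^+ 2 by rewrite divr_ge0 // exprn_ge0 // ltW.
have QP : Q + P + 1 <= N * (2 * Ca * om s1) + (36 / s1 ^+ 2 + 1) * ((M + 1) * d ^- 3).
  have e36 : 36 / s1 ^+ 2 = 16 / s1 ^+ 2 + 20 / s1 ^+ 2 by rewrite -mulrDl -natrD.
  have a1 := ler_wpM2l s36 md; move: a1; rewrite e36 /Q /P.
  move: q1 p1 q2 p2 m1; lra.
have om6 : om (6 * R0) <= om (6 * K * e1).
  apply: om_le; first by rewrite mulr_ge0 // ltW // R0_gt0.
  rewrite /R0 -mulrA ler_pM2l // ler_pM2l ?K0 // (le_trans (ltW em)) // ler_piMr //; exact: ltW.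
have z2 : Z2 * om (6 * R0) * N <= Z2 * om (6 * K * e1) * N.
  by rewrite ler_wpM2r // ler_wpM2l // Z2_ge0.
apply: le_trans (lerD (ler_wpM2l z1 QP) z2) _.
by rewrite le_eqVlt; apply/orP; left; apply/eqP; ring.
Qed.

Lemma fine_scale : `|df (E l) (df (m%:R *: E i) (df (m%:R *: E j) (u k0))) x0| <=
    (N / 16 + C5 * (M + 1) * (d ^- 3)) * h * (m%:R * h) * om (m%:R * h).
Proof.
have [dl [dlin sgdl cdl]] := coord l.
have mh_ := mh_gt0; have R0_ := R0_gt0; have mR := mhR0; have Rd := R0d; have dd := d0.
have dd1 := d1; have Q0 := Q_ge0; have P0 := P_ge0; have h' := h0; have tau' := tau0.
have K_ := K0; have rr' := rr; have rs' := rs; have t00' := t00; have r0' := r0; have c00' := c00.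
have om0 : 0 <= om mh by apply: om_ge0; exact: ltW.
have ix0 : inb x0 by apply: inb_near; rewrite subrr normr0; lra.
pose v k := df (m%:R *: E i) (df (m%:R *: E j) (u k)).
pose G k := df (m%:R *: E i) (df (m%:R *: E j) (source x0 k)).
pose Fb := om mh * (Z1 * (Q + P + 1) + Z2 * om (6 * R0) * N).
pose Mo := mh ^+ 2 * (C4 * N * om (4 * R0)).
have Mo0 : 0 <= Mo.
  apply: mulr_ge0; first exact: sqr_ge0.
  by apply: mulr_ge0; [apply: mulr_ge0 => //; exact: C4_ge0|apply: om_ge0; lra].
have Fb0 : 0 <= Fb.
  apply: mulr_ge0 => //; apply: addr_ge0.
    by apply: mulr_ge0; [exact: Z1_ge0|lra].
  apply: mulr_ge0 => //; apply: mulr_ge0; [exact: Z2_ge0|apply: om_ge0; lra].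
have [k01 k02] := andP kr0.
have tau_d : tau <= d / 24.
  have hh : h ^+ 2 <= h by rewrite expr2 ler_piMl // ltW.
  have := s24; rewrite /s; move: dh tauh; lra.
have R02 : R0 ^+ 2 <= d / 60.
  have R01 : R0 <= 1 by lra.
  have : R0 ^+ 2 <= R0 by rewrite expr2 ler_piMl // ltW.
  by lra.
have time k : (k <= k0)%N -> k0%:R * tau - R0 ^+ 2 - tau <= k%:R * tau -> in_time r' k.
  move=> kk kt; apply/andP; split; first by move: k01; rewrite /d in dd tau_d R02 *; lra.
  by apply: le_trans k02; rewrite ler_pM2r // ler_nat.
(* The coordinate direction [l] is taken out of the list: it is the direction along which the
   variables are doubled, with weight [cc]. *)
have cc0 : 0 < be dl x0 by apply: lt_le_trans c00 _; exact: cdl.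
have remP dd0 : dd0 \in rem dl ds -> dd0 \in ds by exact: mem_rem.
have sz_rem : (size (rem dl ds))%:R <= ns by rewrite ler_nat size_rem // leq_pred.
have szK s' : s' \in ds -> h * (size (sg s'))%:R <= R0.
  move=> si; rewrite /R0 mulrC; apply: ler_pM => //; [exact: ltW| |exact: hmh].
  by apply: le_trans KS; rewrite ler_nat sgS.
have w0 dd0 : dd0 \in rem dl ds -> 0 <= be dd0 x0 by move/remP => di; exact: be0.
have sum_le (F : I -> R) (c : R) : 0 <= c -> (forall dd0, dd0 \in ds -> F dd0 <= c) ->
   \sum_(dd0 <- rem dl ds) F dd0 <= ns * c.
  move=> c_ge Fc; apply: (@le_trans _ _ (\sum_(dd0 <- rem dl ds) c)).
    by rewrite big_seq [leRHS]big_seq; apply: ler_sum => dd0 /remP; exact: Fc.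
  by rewrite big_const_seq count_predT iter_addr_0 -[c *+ _]mulr_natl ler_wpM2r.
have cfl' : tau / h ^+ 2 * (2 * \sum_(dd0 <- rem dl ds) be dd0 x0 + 3 * be dl x0) <= 1.
  apply: le_trans cfl; rewrite ler_wpM2l //; first by rewrite divr_ge0 ?sqr_ge0 // ltW.
  have := sum_le (fun dd0 => be dd0 x0) Bm Bm0; have := beB dlin ix0.
  by move=> b1 b2; have := b2 (fun dd0 di => beB di ix0); lra.
have qnv s' : s' \in ds -> qn (vec R (sg s')) <= n%:R * S0%:R ^+ 2.
  move=> si; apply: (@le_trans _ _ (\sum_(i1 < n) S0%:R ^+ 2)).
    apply: ler_sum => i1 _; rewrite -[leLHS]real_normK ?num_real //.
    rewrite lerXn2r ?nnegrE // (le_trans (coord_le_norm _ _)) // (le_trans (norm_vec _ _)) //.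
    by rewrite ler_nat sgS.
  by rewrite sumr_const card_ord mulr_natl.
have wL : \sum_(dd0 <- rem dl ds) be dd0 x0 * qn (vec R (sg dd0)) <= ns * Bm * (n%:R * S0%:R ^+ 2).
  rewrite -mulrA; apply: sum_le => [|dd0 di]; first by rewrite !mulr_ge0.
  by apply: ler_pM; rewrite ?be0 ?qn_ge0 ?beB ?qnv.
have kaL' : 2 * (ns * Bm * (n%:R * S0%:R ^+ 2)) + 2 <= 3 / 2 * be dl x0 * ka.
  apply: le_trans kaL _; rewrite ler_wpM2r ?ka0 // ler_pM2l //; exact: cdl.
have room : R0 ^+ 2 <= k0%:R * tau.
  by move: k01; rewrite /d in R02 *; lra.
have hR : 2 * h <= R0 by have := hmh; lra.
have sE z c i1 : `|z - x0| <= c -> `|z + m%:R *: E i1 - x0| <= c + mh by exact: shift_near.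
have veq k y : (k < k0)%N -> k0%:R * tau - R0 ^+ 2 - tau <= k%:R * tau -> `|y - x0| <= 4 * R0 ->
  v k.+1 y = v k y + tau * (\sum_(dd0 <- rem dl ds) be dd0 x0 * sd h (sg dd0) (v k) y / h ^+ 2
     + be dl x0 * (v k (y + E l) + v k (y - E l) - 2 * v k y) / h ^+ 2 + G k y).
  move=> kk kt yR; have kr := time k (ltnW kk) kt; have [kr1 kr2] := andP kr.
  have T1 : t0 <= k%:R * tau by lra.
  have T2 : k.+1%:R * tau <= t1 by apply: le_trans k02; rewrite ler_pM2r // ler_nat.
  have U z : `|z - x0| <= 6 * R0 -> u k.+1 z = u k z + tau * (frozen x0 (u k) z + source x0 k z).
    by move=> zR; apply: ueq_frozen => //; apply: inb_near; lra.
  have -> : v k.+1 y = v k y + tau * (frozen x0 (v k) y + G k y).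
    rewrite /v frozen_df /G.
    have -> : frozen x0 (df (m%:R *: E j) (u k)) = df (m%:R *: E j) (frozen x0 (u k)).
      by apply/funext => z; exact: frozen_df.
    have y1 := sE _ _ i yR; have y2 := sE _ _ j yR; have y3 := sE _ _ j y1.
    have b0 : 4 * R0 <= 6 * R0 by rewrite ler_pM2r // ler_nat.
    have b2 : 4 * R0 + mh + mh <= 6 * R0 by lra.
    have b1 : 4 * R0 + mh <= 6 * R0 by apply: le_trans b2; rewrite lerDl ltW.
    have y0' := le_trans yR b0; have {}y1 := le_trans y1 b1.
    have {}y2 := le_trans y2 b1; have {}y3 := le_trans y3 b2.
    rewrite {1 2 3}/df !U //.
    by rewrite /df; ring.
  congr (_ + tau * (_ + _)); rewrite /frozen (big_rem dl) //= addrC; congr (_ + _).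
    by apply: eq_bigr => dd0 _; rewrite mulrA.
  by rewrite sgdl /sd /vec big_seq1 /stepv /= mulrA.
(* One of the two differences exploits the Hölder continuity of the source, the other is estimated
   trivially, hence the factor 2. *)
have Gb k y : (k < k0)%N -> k0%:R * tau - R0 ^+ 2 - tau <= k%:R * tau -> `|y - x0| <= 4 * R0 ->
   `|G k y| <= 2 * Fb.
  move=> kk kt yR; have kr := time k (ltnW kk) kt.
  have y1 := sE _ _ i yR.
  by apply: df_le_2; apply: source_bound => //; lra.
have vosc k y (s' : nat) : (k <= k0)%N -> k0%:R * tau - R0 ^+ 2 - tau <= k%:R * tau ->
   `|y - x0| <= 2 * R0 -> (1 <= s')%N -> s'%:R * h <= 2 * R0 ->
   `|v k (y + s'%:R *: E l) - v k (y + (1 - s'%:R) *: E l)| <= Mo.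
  move=> kk kt yR s1' sR; have kr := time k kk kt.
  set y' := y + (1 - s'%:R) *: E l.
  have s1R : 1 <= s'%:R :> R by rewrite ler1n.
  have y'R : `|y' - x0| <= 4 * R0.
    rewrite /y' addrAC (le_trans (ler_normD _ _)) // normrZ ler0_norm ?subr_le0 //.
    have : - (1 - s'%:R) * `|E l| <= s'%:R * h.
      apply: ler_pM => //; [by rewrite oppr_ge0 subr_le0|lra|rewrite norm_scale_evec //; exact: ltW].
    by lra.
  (* The two points are [2 s' - 1] unit steps apart. The difference over this distance is exchanged
     with those at scale [m], and the latter are split into unit steps so that [second_holder]
     applies. *)
  pose M1 := (s' + s'.-1)%N.
  have M1E : M1%:R = 2 * s'%:R - 1 :> R.
    rewrite /M1 natrD -[in RHS](prednK s1') -[X in X%:R + _](prednK s1') -natr1; ring.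
  have M10 : (0 < M1)%N by rewrite /M1 addn_gt0 s1'.
  have M1h : M1%:R * h <= 4 * R0 by rewrite M1E; nra.
  have -> : y + s'%:R *: E l = y' + M1%:R *: E l.
    by rewrite /y' -addrA -scalerDl M1E; congr (_ + _ *: _); ring.
  have -> : v k (y' + M1%:R *: E l) - v k y' = df (m%:R *: E i) (df (m%:R *: E j) (df (M1%:R *: E l) (u k))) y'.
    by rewrite -/(df _ _ _) /v (dfC (M1%:R *: E l)) (dfC (M1%:R *: E l)).
  have omM1 : om (M1%:R * h) <= om (4 * R0) by apply: om_le => //; exact: mh0.
  have -> : Mo = m%:R * (m%:R * (h ^+ 2 * (C4 * N * om (4 * R0)))) by rewrite /Mo /mh; ring.
  have shn (z : 'rV[R]_n) (b : nat) i1 (c : R) : (b < m)%N -> `|z - x0| <= c -> `|z + b%:R *: E i1 - x0| <= c + mh.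
    move=> bm' zc; rewrite addrAC (le_trans (ler_normD _ _)) // lerD // normrZ normr_nat.
    by rewrite /mh; apply: ler_pM => //; [rewrite ler_nat ltnW|rewrite norm_scale_evec // ltW].
  apply: df_multi0 => b bm1; rewrite dfC; apply: df_multi0 => b' bm2.
  rewrite (dfC (E i) (M1%:R *: E l)) (dfC (E j) (M1%:R *: E l)).
  have z1 := shn _ _ i _ bm1 y'R; have z2 := shn _ _ j _ bm2 z1.
  apply: le_trans (second_holder N0 TB kr _ _ _ M10 _) _.
    by have := near_x0 z2; rewrite /d in Rd *; lra.
  rewrite ler_wpM2l ?sqr_ge0 // ler_wpM2l //; apply: mulr_ge0 => //; exact: C4_ge0.
have GB := @discrete_gradient_bound R n I (rem dl ds) sg (fun dd0 => be dd0 x0) (be dl x0) h tau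
  (ns * Bm * (n%:R * S0%:R ^+ 2)) R0 ka l h0 tau0 cc0 R0_ hR w0 cfl' wL ka1 kaL'
  (fun dd0 di => szK dd0 (remP dd0 di)) v G k0 x0 Mo (2 * Fb) Mo0 (mulr_ge0 (ler0n _ _) Fb0) room veq vosc Gb.
apply: le_trans GB _.
have Fb_le : Fb <= om mh * (N * (2 * Z1 * Ca * om s1 + Z2 * om (6 * K * e1))
    + Z1 * (36 / s1 ^+ 2 + 1) * ((M + 1) * d ^- 3)).
  by rewrite /Fb ler_wpM2l //; exact: lower_order_bound.
have om4R : om (4 * R0) = om 4 * om K * om mh.
  by rewrite /R0 omM // ?(ltW R0_) // omM ?(ltW K_) ?(ltW mh_) // mulrA.
have -> : 2 * ka * h * (Mo / R0 + 2 * (2 * Fb) * R0) = h * mh *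
   (2 * ka * (C4 * om 4 * (om K / K)) * N * om mh + 2 * ka * (4 * K) * Fb).
  by rewrite /Mo om4R /R0 -/mh; field; rewrite !gt_eqF.
rewrite -/mh.
have -> (c : R) : c * h * mh * om mh = h * mh * (c * om mh) by ring.
rewrite ler_wpM2l ?mulr_ge0 ?(ltW h') ?(ltW mh_) //.
have kK : 0 <= 2 * ka * (4 * K) by rewrite !mulr_ge0 ?ka0 // ltW.
apply: le_trans (lerD (lexx _) (ler_wpM2l kK Fb_le)) _.
have [C1 C2 C3] := C5_parts.
have Nom : 0 <= N * om mh by rewrite mulr_ge0.
have X1 := ler_wpM2l Nom smallK; have X2 := ler_wpM2l Nom smalls.
have d3 : 0 <= d ^- 3 by rewrite invr_ge0 exprn_ge0 // ltW.
have Mom : 0 <= om mh * ((M + 1) * d ^- 3).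
  by rewrite !mulr_ge0 // addr_ge0.
have C5ge : 8 * ka * K * Z1 * (36 / s1 ^+ 2 + 1) <= C5 by rewrite /C5; lra.
have X3 := ler_wpM2l Mom C5ge.
have -> : (N / 16 + C5 * (M + 1) * d ^- 3) * om mh =
  N * om mh * (1 / 32) + N * om mh * (1 / 32) + om mh * ((M + 1) * d ^- 3) * C5 by field; rewrite gt_eqF.
apply: le_trans (lerD (lerD X1 X2) X3).
by rewrite le_eqVlt; apply/orP; left; apply/eqP; field; rewrite !gt_eqF.
Qed.

End Fine.
End OneStep.

(** Besides fine and coarse scales there is a third regime: when the mesh is at least [s1] times the
    gap, the trivial bound already has the required size. *)
Lemma third_bound_step r r' N : 0 <= r -> r < r' -> r' <= s0 -> 0 <= N -> third_bound r' N ->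
  third_bound r (N / 16 + C5 * (M + 1) * ((r' - r) ^- 3)).
Proof.
move=> r0 rr rs N0 TB k x i j l m m0 xr kr.
have [C1 C2 C3] := C5_parts.
have d_gt0 : 0 < r' - r by rewrite subr_gt0.
case: (ltP h (s1 * (r' - r))) => [dh|dh].
  case: (ltP (m%:R * h) (e1 * (r' - r))) => em; first by apply: (@fine_scale r r' N) => //.
  by apply: (@coarse_scale r r' N) => //.
have M0' := M0; have h' := h0.
apply: (third_bound_le _ (third_bound_trivial (le_trans (ltW rr) rs))) => //.
have d3 : 0 < (r' - r) ^- 3 by rewrite invr_gt0 exprn_gt0.
have C5M : 8 / s1 ^+ 3 * M <= C5 * (M + 1) by rewrite /C5; nra.
have hd : (s1 * (r' - r)) ^+ 3 <= h ^+ 3.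
  by rewrite lerXn2r ?nnegrE ?mulr_ge0 ?(ltW s10) ?(ltW d_gt0) ?(ltW h').
apply: (@le_trans _ _ (8 / s1 ^+ 3 * M * (r' - r) ^- 3)); last first.
  apply: (@le_trans _ _ (C5 * (M + 1) * (r' - r) ^- 3)); first by rewrite ler_wpM2r // ltW.
  by rewrite lerDr divr_ge0.
have -> : 8 / s1 ^+ 3 * M * (r' - r) ^- 3 = 8 * M / (s1 * (r' - r)) ^+ 3.
  by field; rewrite !gt_eqF.
apply: ler_wpM2l; first exact: mulr_ge0.
by rewrite lef_pV2 // posrE exprn_gt0 // mulr_gt0.
Qed.

(** Absorption along the radii [r_ i]: each step divides the old constant by 16, while the inverse
    cube of the gap grows only by 8, so the contributions form a convergent geometric series. The
    number of steps depends on the mesh and brings the initial constant below 1; the final bound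
    does not depend on it. *)
Theorem discrete_schauder : third_bound (s0 / 2) (1 + 128 * (C5 * (M + 1) * s0 ^- 3)).
Proof.
pose r_ (i : nat) := s0 * (1 - 2 ^- i.+1).
pose D := 64 * (C5 * (M + 1) * s0 ^- 3).
have [C1 C2 C3] := C5_parts.
have s0' := s00; have M0' := M0; have h' := h0.
have C50 : 0 <= C5 by rewrite /C5; lra.
have D0 : 0 <= D.
  by rewrite /D !mulr_ge0 ?invr_ge0 ?exprn_ge0 // ?addr_ge0 // ltW.
have p0 (i : nat) : 0 < 2 ^- i.+1 :> R by rewrite invr_gt0 exprn_gt0.
have r_ge (i : nat) : 0 <= r_ i.
  apply: mulr_ge0; first exact: ltW.
  by rewrite subr_ge0 invf_le1 ?exprn_gt0 // exprn_ege1 // ler1n.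
have r_lt (i : nat) : r_ i < r_ i.+1.
  rewrite /r_ ltr_pM2l // ltrD2l ltrN2 (exprS _ i.+1) invfM.
  by have := p0 i; lra.
have r_le (i : nat) : r_ i <= s0.
  by rewrite /r_ ler_piMr // ?(ltW s0') // gerBl ltW.
have r_diff (i : nat) : (r_ i.+1 - r_ i) ^- 3 = 64 * 8 ^+ i * s0 ^- 3.
  have -> : r_ i.+1 - r_ i = s0 * 2 ^- i.+2.
    by rewrite /r_ !exprS; field; rewrite expf_neq0.
  rewrite !exprS (_ : 8 = 2 ^+ 3 :> R); last by ring.
  rewrite -exprM mulnC exprM; field.
  by rewrite gt_eqF //= expf_neq0.
have iter_step jj : forall (ii : nat) N, 0 <= N -> third_bound (r_ (ii + jj)%N) N ->
   third_bound (r_ ii) (N / 16 ^+ jj + 2 * D * 8 ^+ ii).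
  elim: jj => [|jj IH] ii N N0 TB.
    rewrite addn0 in TB; apply: third_bound_le TB; rewrite expr0 divr1.
    by rewrite lerDl; apply: mulr_ge0; [exact: mulr_ge0|exact: exprn_ge0].
  have N' : 0 <= N / 16 ^+ jj + 2 * D * 8 ^+ ii.+1.
    apply: addr_ge0; first by apply: divr_ge0 => //; exact: exprn_ge0.
    by apply: mulr_ge0; [exact: mulr_ge0|exact: exprn_ge0].
  rewrite addnS -addSn in TB.
  have := third_bound_step (r_ge ii) (r_lt ii) (r_le _) N' (IH _ _ N0 TB).
  rewrite r_diff; congr third_bound.
  rewrite /D !exprS; field.
  by rewrite gt_eqF //= expf_neq0.
have N0 : 0 <= 8 * M / h ^+ 3.
  by apply: divr_ge0; [exact: mulr_ge0|apply: exprn_ge0; exact: ltW].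
pose jj := Num.bound (8 * M / h ^+ 3).
have Njj : 8 * M / h ^+ 3 / 16 ^+ jj <= 1.
  rewrite ler_pdivrMr ?exprn_gt0 // mul1r (le_trans (ltW (archi_boundP N0))) //.
  by rewrite -natrX ler_nat ltnW // ltn_expl.
have E0 : r_ 0 = s0 / 2 by rewrite /r_ expr1; field.
have := iter_step jj 0 _ N0 (third_bound_trivial (r_le _)).
rewrite E0 expr0; apply: third_bound_le.
by rewrite lerD // /D; lra.
Qed.

End Step.
End Schauder.

(** * Power moduli and the choice of constants before the mesh *)

Section UniformSchauder.
Variable R : realType.

Lemma small_powR (ga de : R) : 0 < ga -> 0 < de ->
  exists2 x, 0 < x & forall y, 0 <= y -> y <= x -> y `^ ga <= de.
Proof.
move=> ga0 de0; exists (de `^ ga^-1); first exact: powR_gt0.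
move=> y y0 yx; have := ge0_ler_powR (ltW ga0) _ _ yx.
rewrite !nnegrE powR_ge0 -powRrM mulVf ?gt_eqF // powRr1 ?(ltW de0) //; exact.
Qed.

Lemma small_factor (A : R) : 0 <= A -> exists2 de, 0 < de & forall y, y <= de -> A * y <= 1 / 64.
Proof.
move=> A0; exists (64 * (A + 1))^-1 => [|y yd].
  by rewrite invr_gt0 mulr_gt0 // ltr_wpDl.
apply: le_trans (ler_wpM2l A0 yd) _; rewrite ler_pdivrMr; first by lra.
by rewrite mulr_gt0 // ltr_wpDl.
Qed.

Variables (al : R).
Hypotheses (al0 : 0 < al) (al1 : al < 1).
Local Notation om := (fun x : R => x `^ al).

Lemma pow_mul (x y : R) : 0 <= x -> 0 <= y -> om (x * y) = om x * om y.
Proof. exact: powRM. Qed.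

Lemma pow_le (x y : R) : 0 <= x -> x <= y -> om x <= om y.
Proof.
move=> x0 xy; apply: (ge0_ler_powR (ltW al0)) => //; rewrite nnegrE //.
exact: le_trans xy.
Qed.

Lemma pow_ge (x : R) : 0 <= x -> x <= 1 -> x <= om x.
Proof.
rewrite le_eqVlt => /predU1P[<- _|x0 x1]; first exact: powR_ge0.
by apply: ger1_powR; rewrite ?x0 ?x1 // ltW.
Qed.

Lemma pow_1 : om 1 = 1. Proof. by rewrite /= powR1. Qed.

Lemma pow_2_gt1 : 1 < om 2.
Proof.
have := gt0_ltr_powR al0; move=> /(_ 1 2); rewrite !nnegrE powR1; apply => //.
by rewrite ltr1n.
Qed.

Lemma pow_2_le2 : om 2 <= 2.
Proof. by apply: ler1_powR; rewrite ?ler1n // ltW. Qed.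

Lemma pow_sublinear (de : R) : 0 < de -> exists2 K0, 0 < K0 & forall K, K0 <= K -> om K / K <= de.
Proof.
move=> de0; have [|x x0 xP] := @small_powR (1 - al) de _ de0; first by rewrite subr_gt0.
exists x^-1 => [|K xK]; first by rewrite invr_gt0.
have K0 : 0 < K by apply: lt_le_trans xK; rewrite invr_gt0.
have -> : om K / K = (K^-1) `^ (1 - al).
  rewrite -(powR_inv1 (ltW K0)) -powRrM mulN1r opprB.
  by rewrite powRD // (gt_eqF K0) implybT.
by apply: xP; rewrite ?invr_ge0 ?(ltW K0) // -[leRHS]invrK lef_pV2 ?posrE // invr_gt0.
Qed.

Variable n : nat.

(** Collects the hypotheses of the estimate, so that a constant can be produced before the mesh, the
    centre, the directions and the solution are given. *)
Record scheme_on (I : eqType) (h tau s0 t0 t1 M : R) (xc : 'rV[R]_n) (u : nat -> 'rV[R]_n -> R)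
    (ds : seq I) (sg : I -> seq ('I_n * bool)) (be : I -> 'rV[R]_n -> R)
    (bp bm : 'I_n -> 'rV[R]_n -> R) (Hf : 'rV[R]_n -> R -> R) (Bm HC LH c0 : R) (S0 : nat) : Prop :=
  SchemeOn {
  so_h0 : 0 < h; so_h1 : h <= 1; so_tau0 : 0 < tau; so_tauh : tau <= h ^+ 2; so_t00 : 0 <= t0;
  so_uM : forall k x, `|x - xc| <= s0 -> t0 <= k%:R * tau -> k%:R * tau <= t1 -> `|u k x| <= M;
  so_be0 : forall d x, d \in ds -> `|x - xc| <= s0 -> 0 <= be d x;
  so_beB : forall d x, d \in ds -> `|x - xc| <= s0 -> be d x <= Bm;
  so_beH : forall d x y, d \in ds -> `|x - xc| <= s0 -> `|y - xc| <= s0 ->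
     `|be d x - be d y| <= HC * om `|x - y|;
  so_bpB : forall i x, `|x - xc| <= s0 -> `|bp i x| <= Bm;
  so_bpH : forall i x y, `|x - xc| <= s0 -> `|y - xc| <= s0 -> `|bp i x - bp i y| <= HC * om `|x - y|;
  so_bmB : forall i x, `|x - xc| <= s0 -> `|bm i x| <= Bm;
  so_bmH : forall i x y, `|x - xc| <= s0 -> `|y - xc| <= s0 -> `|bm i x - bm i y| <= HC * om `|x - y|;
  so_coord : forall i, exists d, [/\ d \in ds, sg d = [:: (i, true)]
     & forall x, `|x - xc| <= s0 -> c0 <= be d x];
  so_sgS : forall d, d \in ds -> (size (sg d) <= S0)%N;
  so_HfL : forall x y z z', `|x - xc| <= s0 -> `|y - xc| <= s0 -> `|z| <= M -> `|z'| <= M ->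
     `|Hf x z - Hf y z'| <= LH * (`|x - y| + `|z - z'|);
  so_cfl : tau / h ^+ 2 * (2 * ((size ds)%:R * Bm) + 3 * Bm) <= 1;
  so_ueq : forall k x, `|x - xc| <= s0 -> t0 <= k%:R * tau -> k.+1%:R * tau <= t1 ->
     u k.+1 x = u k x + tau * (\sum_(d <- ds) be d x * (sd h (sg d) (u k) x / h ^+ 2)
        + drift h bp bm (u k) x + Hf x (u k x))
  }.

(** The parameters are fixed in the order [ka], [K], [e1], [s1]. A large [K] makes [om K / K] small
    because [al < 1]; then [e1] makes the freezing error small for this [K], and [s1] the lower
    order terms for this [e1]. *)
Lemma schauder_uniform (ns S0 : nat) (Bm HC LH c0 M s0 : R) :
  0 <= Bm -> 0 <= HC -> 0 <= LH -> 0 < c0 -> 0 <= M -> 0 < s0 -> s0 <= 1 -> (1 <= S0)%N ->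
  exists2 N, 0 <= N & forall (I : eqType) h tau t0 t1 xc u (ds : seq I) sg be bp bm Hf,
    size ds = ns -> scheme_on h tau s0 t0 t1 M xc u ds sg be bp bm Hf Bm HC LH c0 S0 ->
    third_bound om h tau s0 t0 t1 xc u (s0 / 2) N.
Proof.
move=> Bm0 HC0 LH0 c00 M0 s00 s01 S01.
pose ka := 1 + (2 * (ns%:R * Bm * (n%:R * S0%:R ^+ 2)) + 2) / (3 / 2 * c0).
have c0' : 0 < 3 / 2 * c0 by rewrite mulr_gt0.
have L0 : 0 <= 2 * (ns%:R * Bm * (n%:R * S0%:R ^+ 2)) + 2.
  by apply: addr_ge0 => //; repeat apply: mulr_ge0 => //.
have ka1 : 1 <= ka by rewrite /ka lerDl divr_ge0 // ltW.
have ka0 : 0 <= ka by exact: le_trans ka1.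
have kaL : 2 * (ns%:R * Bm * (n%:R * S0%:R ^+ 2)) + 2 <= 3 / 2 * c0 * ka.
  have -> : 3 / 2 * c0 * ka = 3 / 2 * c0 + (2 * (ns%:R * Bm * (n%:R * S0%:R ^+ 2)) + 2).
    by rewrite /ka; field; rewrite gt_eqF.
  by rewrite lerDr ltW.
have Ca0 := Ca_ge0 pow_2_gt1; have C40 := C4_ge0 pow_2_gt1.
set Ca_ := Ca om in Ca0; set C4_ := C4 om in C40.
pose z1 := ns%:R * HC * S0%:R ^+ 2 + 2 * n%:R * (HC + Bm) + LH.
pose z2 := ns%:R * HC * S0%:R ^+ 2 * C4_.
have z10 : 0 <= z1.
  by apply: addr_ge0 => //; apply: addr_ge0; repeat apply: mulr_ge0 => //; apply: addr_ge0.
have z20 : 0 <= z2 by repeat apply: mulr_ge0 => //.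
have [|de1 de10 de1P] := @small_factor (2 * ka * (C4_ * om 4)).
  by repeat apply: mulr_ge0 => //; exact: powR_ge0.
have [K0 K00 K0P] := pow_sublinear de10.
pose K := Num.max (Num.max 2 S0%:R) K0.
have K2 : 2 <= K by rewrite /K !le_max lexx.
have KS : S0%:R <= K by rewrite /K !le_max lexx orbT.
have KK : K0 <= K by rewrite /K !le_max lexx orbT.
have Kp : 0 < K by exact: lt_le_trans K2.
have smallK : 2 * ka * (C4_ * om 4 * (om K / K)) <= 1 / 32.
  by rewrite mulrA; apply: le_trans (de1P _ (K0P _ KK)) _; lra.
have [|de2 de20 de2P] := @small_factor (2 * ka * (4 * K) * z2).
  by repeat apply: mulr_ge0 => //; exact: ltW.
have [x2 x20 x2P] := small_powR al0 de20.
have [|de3 de30 de3P] := @small_factor (2 * ka * (4 * K) * (2 * z1 * Ca_)).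
  by repeat apply: mulr_ge0 => //; exact: ltW.
have [x3 x30 x3P] := small_powR al0 de30.
pose e1 := Num.min (60 * K)^-1 (x2 / (6 * K)).
have e10 : 0 < e1 by rewrite /e1 lt_min invr_gt0 divr_gt0 ?mulr_gt0.
have Ke1 : 60 * K * e1 <= 1.
  rewrite mulrC -ler_pdivlMr ?mulr_gt0 // mul1r /e1 ge_min lexx //.
have Ke2 : 6 * K * e1 <= x2.
  by rewrite mulrC -ler_pdivlMr ?mulr_gt0 // /e1 ge_min lexx orbT.
clearbody e1.
pose s1 := Num.min (Num.min (e1 / (64 * Ca_ + 1)) (24^-1)) (Num.min x3 e1).
have Cp : 0 < 64 * Ca_ + 1 by rewrite ltr_wpDl // mulr_ge0.
have s10 : 0 < s1 by rewrite /s1 !lt_min x30 e10 invr_gt0 ltr0n !andbT divr_gt0.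
have s1e : s1 <= e1 by rewrite /s1 !ge_min lexx !orbT.
have s124 : 24 * s1 <= 1.
  by rewrite mulrC -ler_pdivlMr // mul1r /s1 !ge_min lexx !orbT.
have s1x : s1 <= x3 by rewrite /s1 !ge_min lexx !orbT.
have s1C : 64 * Ca_ * s1 <= e1.
  have : s1 * (64 * Ca_ + 1) <= e1 by rewrite -ler_pdivlMr // /s1 !ge_min lexx.
  by rewrite mulrDr mulr1 mulrC; move: s10; lra.
have smalls : 2 * ka * (4 * K * (2 * z1 * Ca_ * om s1 + z2 * om (6 * K * e1))) <= 1 / 32.
  have H1 := de3P _ (x3P _ (ltW s10) s1x).
  have H2 : 2 * ka * (4 * K) * z2 * om (6 * K * e1) <= 1 / 64.
    by apply: de2P; apply: x2P => //; rewrite !mulr_ge0 // ltW.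
  by move: H1 H2; rewrite /=; lra.
pose c5 := 8 * ka * K * z1 * (36 / s1 ^+ 2 + 1) + 80 / (s1 * e1 ^+ 2) + 8 / s1 ^+ 3.
have c50 : 0 <= c5.
  have sp (k : nat) : 0 <= s1 ^+ k by rewrite exprn_ge0 // ltW.
  apply: addr_ge0; last by rewrite divr_ge0.
  apply: addr_ge0; last by rewrite divr_ge0 // mulr_ge0 ?exprn_ge0 // ltW.
  repeat apply: mulr_ge0 => //; first exact: ltW.
  by rewrite addr_ge0 // divr_ge0.
exists (1 + 128 * (c5 * (M + 1) * s0 ^- 3)).
  apply: addr_ge0 => //; repeat apply: mulr_ge0 => //; first exact: addr_ge0.
  by rewrite invr_ge0 exprn_ge0 // ltW.
move=> I h tau t0 t1 xc u ds sg be bp bm Hf ens H.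
case: H => h0 h1 tau0 tauh t00 uM be0 beB beH bpB bpH bmB bmH coord sgS HfL cfl ueq.
subst ns.
exact: (@discrete_schauder R n om pow_mul pow_le pow_ge pow_1 pow_2_gt1 pow_2_le2 h tau s0 t0 t1 M xc u
  h0 h1 tau0 tauh s00 s01 t00 M0 uM I ds sg be bp bm Hf Bm HC LH c0 ka S0 Bm0 HC0 LH0 c00
  be0 beB beH bpB bpH bmB bmH coord sgS HfL cfl ka1 kaL ueq K e1 s1 K2 KS e10 Ke1 s10 s1e s1C s124 smallK smalls).
Qed.

End UniformSchauder.

(** Completion of the square in the first variable: the Schur complement [B] is again a positive
    form, in one variable less. *)
Lemma positive_form_sum_of_squares (R : realType) (n : nat) (A : 'I_n -> 'I_n -> R) :
  (forall i j, A i j = A j i) ->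
  (forall v : 'I_n -> R, (exists i, v i != 0) -> 0 < \sum_i \sum_j A i j * v i * v j) ->
  exists bs : seq ('I_n -> R), forall i j, A i j = \sum_(b <- bs) b i * b j.
Proof.
elim: n A => [|n IH] A sym pd; first by exists [::] => -[].
have p0 : 0 < A ord0 ord0.
  have := pd (fun i => (i == ord0)%:R); rewrite !big_ord_recl /= !big1 => [|i _|i _].
  - by rewrite !mulr1 !addr0; apply; exists ord0; rewrite eqxx oner_neq0.
  - by rewrite big1 // => j _; rewrite mulr0 mul0r.
  - by rewrite mulr0.
set p := A ord0 ord0 in p0.
pose B i j := A (lift ord0 i) (lift ord0 j) - A ord0 (lift ord0 i) * A ord0 (lift ord0 j) / p.
have [||bs bsE] := IH B.
- by move=> i j; rewrite /B sym [X in _ - X / _]mulrC.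
- move=> w [i0 wi0].
  pose S := \sum_j A ord0 (lift ord0 j) * w j.
  (* The minimiser in the first variable, at which the form equals its Schur complement. *)
  pose t := - S / p.
  pose v (i : 'I_n.+1) := if unlift ord0 i is Some j then w j else t.
  have vl j : v (lift ord0 j) = w j by rewrite /v liftK.
  have v0 : v ord0 = t by rewrite /v unlift_none.
  have := pd v; rewrite big_ord_recl big_ord_recl v0.
  under eq_bigr do rewrite vl.
  under [X in _ + X]eq_bigr do rewrite big_ord_recl v0 vl.
  under [X in _ + X]eq_bigr => i _ do (under eq_bigr do rewrite vl).
  have -> : \sum_(i < n) A ord0 (lift ord0 i) * t * w i = t * S.
    by rewrite mulr_sumr; apply: eq_bigr => i _; ring.
  rewrite big_split /=.
  have -> : \sum_(i < n) A (lift ord0 i) ord0 * w i * t = t * S.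
    by rewrite mulr_sumr; apply: eq_bigr => i _; rewrite sym; ring.
  have -> : \sum_i \sum_j B i j * w i * w j =
    \sum_(i < n) \sum_(j < n) A (lift ord0 i) (lift ord0 j) * w i * w j - S * S / p.
    rewrite {1}/S mulr_suml mulr_suml -sumrB; apply: eq_bigr => i _.
    rewrite mulr_sumr mulr_suml -sumrB; apply: eq_bigr => j _.
    by rewrite /B; field; rewrite gt_eqF.
  move=> H; have {}H := H (ex_intro _ (lift ord0 i0) _).
  have -> (X : R) : X - S * S / p = p * t * t + t * S + (t * S + X).
    by rewrite /t; field; rewrite gt_eqF.
  by apply: H; rewrite vl.
pose ext (b : 'I_n -> R) (i : 'I_n.+1) := if unlift ord0 i is Some j then b j else 0.
exists ((fun i => A ord0 i / Num.sqrt p) :: map ext bs) => i j.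
rewrite big_cons big_map.
have sq : Num.sqrt p != 0 by rewrite gt_eqF // sqrtr_gt0.
have -> : A ord0 i / Num.sqrt p * (A ord0 j / Num.sqrt p) = A ord0 i * A ord0 j / p.
  by rewrite -{3}(sqr_sqrtr (ltW p0)); field.
have ext0 b : ext b ord0 = 0 by rewrite /ext unlift_none.
have extl b k : ext b (lift ord0 k) = b k by rewrite /ext liftK.
case: (unliftP ord0 i) => [i'|] ->; last first.
  rewrite big1 => [|b _]; last by rewrite ext0 mul0r.
  by rewrite -/p addr0 mulrAC divff ?gt_eqF // mul1r.
case: (unliftP ord0 j) => [j'|] ->; last first.
  rewrite big1 => [|b _]; last by rewrite ext0 mulr0.
  by rewrite -/p addr0 mulfK ?gt_eqF // sym.
by under eq_bigr do rewrite !extl; rewrite -bsE /B addrC subrK.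
Qed.

(** * Closure properties of locally Hölder functions and cut-offs *)

Section LocHolder.
Variables (R : realType) (n : nat) (al : R).
Hypotheses (al0 : 0 < al) (al1 : al < 1).
Local Notation V := 'rV[R]_n.
Local Notation lh := (@loc_holder R n al).

Lemma lh_nonneg (f : V -> R) : lh f -> forall x0 r, exists2 C, 0 <= C &
  forall x y, `|x - x0| <= r -> `|y - x0| <= r -> `|f x - f y| <= C * (`|x - y| `^ al).
Proof.
move=> H x0 r; have [C CP] := H x0 r; exists `|C| => // x y xr yr.
by apply: le_trans (CP x y xr yr) _; rewrite ler_wpM2r ?powR_ge0 // ler_norm.
Qed.

Lemma lh_bounded (f : V -> R) : lh f -> forall x0 r, exists2 B, 0 <= B &
  forall x, `|x - x0| <= r -> `|f x| <= B.
Proof.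
move=> H x0 r; case: (leP 0 r) => [r0|r0]; last first.
  exists 0 => // x xr; have := le_lt_trans xr r0; by rewrite ltNge normr_ge0.
have [C C0 CP] := lh_nonneg H x0 r.
exists (`|f x0| + C * r `^ al) => [|x xr].
  by rewrite addr_ge0 // mulr_ge0 // powR_ge0.
have -> : f x = f x0 + (f x - f x0) by rewrite addrC subrK.
apply: le_trans (ler_normD _ _) _; rewrite lerD2l.
apply: le_trans (CP x x0 xr _) _; first by rewrite subrr normr0.
by rewrite ler_wpM2l // pow_le.
Qed.

(** On a ball, distances are at most [D], and [t <= t ^ al] for [t <= 1] is applied to the ratio of
    the distance to [D]. *)
Lemma lh_lipschitz (f : V -> R) (L : R) : 0 <= L -> (forall x y, `|f x - f y| <= L * `|x - y|) -> lh f.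
Proof.
move=> L0 H x0 r; pose D := Num.max 1 (2 * r).
have D0 : 0 < D by rewrite lt_max ltr01.
exists (L * D) => x y xr yr; apply: le_trans (H x y) _.
rewrite -mulrA ler_wpM2l //.
have xyD : `|x - y| <= D.
  rewrite le_max; apply/orP; right; have -> : x - y = (x - x0) - (y - x0) by rewrite opprB addrA subrK.
  by apply: le_trans (ler_normB _ _) _; lra.
have e : `|x - y| = D * (`|x - y| / D) by rewrite mulrCA divff ?gt_eqF // mulr1.
rewrite [leLHS]e ler_pM2l //.
have q0 : 0 <= `|x - y| / D by rewrite divr_ge0 // ltW.
apply: le_trans (pow_ge al1 q0 _) _; first by rewrite ler_pdivrMr // mul1r.
apply: pow_le => //; rewrite ler_pdivrMr // ler_peMr //.
by rewrite /D le_max lexx.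
Qed.

Lemma lh_cst (c : R) : lh (fun=> c).
Proof. by apply: (@lh_lipschitz _ 0) => // x y; rewrite subrr normr0 mul0r. Qed.

Lemma lh_add (f g : V -> R) : lh f -> lh g -> lh (fun x => f x + g x).
Proof.
move=> Hf Hg x0 r; have [C CP] := Hf x0 r; have [C' CP'] := Hg x0 r.
exists (C + C') => x y xr yr; rewrite opprD addrACA (le_trans (ler_normD _ _)) // mulrDl.
by rewrite lerD ?CP ?CP'.
Qed.

Lemma lh_mul (f g : V -> R) : lh f -> lh g -> lh (fun x => f x * g x).
Proof.
move=> Hf Hg x0 r; have [C C0 CP] := lh_nonneg Hf x0 r; have [C' C'0 CP'] := lh_nonneg Hg x0 r.
have [B B0 BP] := lh_bounded Hf x0 r; have [B' B'0 BP'] := lh_bounded Hg x0 r.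
exists (B * C' + B' * C) => x y xr yr.
have -> : f x * g x - f y * g y = f x * (g x - g y) + g y * (f x - f y) by ring.
rewrite (le_trans (ler_normD _ _)) // mulrDl !normrM -!mulrA.
by apply: lerD; apply: ler_pM; rewrite ?BP ?BP' ?CP ?CP'.
Qed.

Lemma lh_contract (f g : V -> R) : lh f -> (forall x y, `|g x - g y| <= `|f x - f y|) -> lh g.
Proof.
move=> Hf H x0 r; have [C CP] := Hf x0 r; exists C => x y xr yr.
exact: le_trans (H x y) (CP x y xr yr).
Qed.

Lemma lh_norm (f : V -> R) : lh f -> lh (fun x => `|f x|).
Proof. by move=> Hf; apply: lh_contract Hf _ => x y; exact: ler_dist_dist. Qed.

Lemma lh_opp (f : V -> R) : lh f -> lh (fun x => - f x).
Proof. by move=> Hf; apply: lh_contract Hf _ => x y; rewrite -opprD normrN. Qed.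

Lemma lh_sub (f g : V -> R) : lh f -> lh g -> lh (fun x => f x - g x).
Proof. by move=> Hf Hg; apply: lh_add => //; exact: lh_opp. Qed.

Lemma lh_scale (c : R) (f : V -> R) : lh f -> lh (fun x => c * f x).
Proof. by move=> Hf; apply: lh_mul => //; exact: lh_cst. Qed.

Lemma lh_sum (I : Type) (r : seq I) (P : pred I) (F : I -> V -> R) :
  (forall i, lh (F i)) -> lh (fun x => \sum_(i <- r | P i) F i x).
Proof.
move=> H; elim: r => [|i r IH].
  by have -> : (fun x => \sum_(i <- [::] | P i) F i x) = fun=> 0; [apply/funext => x; rewrite big_nil|exact: lh_cst].
case Pi : (P i).
  have -> : (fun x => \sum_(j <- i :: r | P j) F j x) = fun x => F i x + \sum_(j <- r | P j) F j x.
    by apply/funext => x; rewrite big_cons Pi.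
  exact: lh_add.
have -> : (fun x => \sum_(j <- i :: r | P j) F j x) = fun x => \sum_(j <- r | P j) F j x => //.
by apply/funext => x; rewrite big_cons Pi.
Qed.

Lemma lh_continuous (f : V -> R) : lh f -> continuous f.
Proof.
move=> Hf x; apply/(@cvgrPdist_le _ _ _ (nbhs x)) => e e0.
have [C C0 CP] := lh_nonneg Hf x 1.
have [|d d0 dP] := @small_powR R al (e / (C + 1)) al0; first by rewrite divr_gt0 // ltr_wpDl.
near=> y.
have xy1 : `|y - x| <= 1.
  rewrite distrC; near: y; exact: cvgr_dist_le.
have xyd : `|x - y| <= d by near: y; exact: cvgr_dist_le.
apply: le_trans (CP x y _ xy1) _; first by rewrite subrr normr0.
apply: le_trans (ler_wpM2l C0 (dP _ (normr_ge0 _) xyd)) _.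
rewrite mulrA ler_pdivrMr ?ltr_wpDl //; nra.
Unshelve. all: by end_near.
Qed.

(* Equal to 1 on the ball of radius [r] and to 0 off the ball of radius [r + s]. *)
Definition cutoff (x0 : V) (r s : R) (x : V) : R := Num.max 0 (Num.min 1 ((r + s - `|x - x0|) / s)).

Lemma cutoff_ge0 x0 r s x : 0 <= cutoff x0 r s x.
Proof. by rewrite /cutoff le_max lexx. Qed.
Lemma cutoff_le1 x0 r s x : cutoff x0 r s x <= 1.
Proof. by rewrite /cutoff ge_max ler01 ge_min lexx. Qed.
Lemma cutoff_in x0 r s x : 0 < s -> `|x - x0| <= r -> cutoff x0 r s x = 1.
Proof.
move=> s0 xr; have H : 1 <= (r + s - `|x - x0|) / s by rewrite ler_pdivlMr //; lra.
by rewrite /cutoff (min_idPl H); apply/max_idPr.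
Qed.
Lemma cutoff_out x0 r s x : 0 < s -> 0 < cutoff x0 r s x -> `|x - x0| < r + s.
Proof. by move=> s0; rewrite /cutoff lt_max ltxx /= lt_min => /andP[_]; rewrite pmulr_lgt0 ?invr_gt0 // subr_gt0. Qed.

Lemma cutoff_lh x0 r s : 0 < s -> lh (cutoff x0 r s).
Proof.
move=> s0; apply: (@lh_lipschitz _ s^-1) => [|x y]; first by rewrite invr_ge0 ltW.
rewrite /cutoff.
have tr (a b : R) : `|Num.max 0 (Num.min 1 a) - Num.max 0 (Num.min 1 b)| <= `|a - b|.
  rewrite !maxEle !minEle.
  have := ler_norm (a - b); have := ler_norm (b - a); rewrite (distrC b a) => n1 n2.
  case: (leP 1 a) => ?; case: (leP 1 b) => ?; rewrite ?ler01;
    case: (leP 0 a) => ?; case: (leP 0 b) => ?; rewrite ler_norml; apply/andP; split; lra.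
apply: le_trans (tr _ _) _.
have -> : (r + s - `|x - x0|) / s - (r + s - `|y - x0|) / s = s^-1 * (`|y - x0| - `|x - x0|) by ring.
rewrite normrM gtr0_norm ?invr_gt0 // ler_wpM2l ?invr_ge0 ?(ltW s0) //.
apply: le_trans (ler_dist_dist _ _) _; by rewrite opprB addrA subrK distrC.
Qed.

End LocHolder.

(** * Uniform consistency of differences of a function of class C2 *)

Section Calculus.
Variables (R : realType) (n : nat).
Local Notation V := 'rV[R]_n.
Local Notation e i := (evec R i).

Lemma coord_add_evec (x : V) (s : R) i k : (x + s *: e i) 0 k = x 0 k + s * (k == i)%:R.
Proof. by rewrite -evecE !mxE. Qed.

(* Moving one coordinate at a time stays inside a ball of the sup norm. *)
Lemma coordinate_path (F : V -> R) (x0 : V) (r : R) (om : R -> R) :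
  (forall s t, 0 <= s -> s <= t -> om s <= om t) ->
  (forall x i s, 0 <= s -> `|x - x0| <= r -> `|x + s *: e i - x0| <= r ->
     `|F (x + s *: e i) - F x| <= om s) ->
  forall x y, `|x - x0| <= r -> `|y - x0| <= r -> `|F x - F y| <= n%:R * om `|x - y|.
Proof.
move=> om_le H x y xr yr.
have r0 : 0 <= r by apply: le_trans xr.
have H2 z i s : `|z - x0| <= r -> `|z + s *: e i - x0| <= r -> `|F (z + s *: e i) - F z| <= om `|s|.
  move=> z1 z2; case: (leP 0 s) => s0; first by rewrite (ger0_norm s0); exact: H.
  rewrite (ltr0_norm s0) distrC.
  have e1 : z = (z + s *: e i) + (- s) *: e i by rewrite scaleNr addrK.
  by rewrite {1}e1; apply: H; rewrite -?e1 // oppr_ge0 ltW.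
pose z (k : nat) : V := \row_i (if (i < k)%N then y 0 i else x 0 i).
have zr k : `|z k - x0| <= r.
  apply: norm_le_coord => // i; rewrite !mxE.
  have := coord_le_norm (x - x0) i; have := coord_le_norm (y - x0) i; rewrite !mxE => h1 h2.
  by case: ifP => _; [exact: le_trans h1 yr|exact: le_trans h2 xr].
have z0 : z 0%N = x by apply/rowP => i; rewrite mxE.
have zn : z n = y by apply/rowP => i; rewrite mxE ltn_ord.
have step k : (k <= n)%N -> `|F (z 0%N) - F (z k)| <= k%:R * om `|x - y|.
  elim: k => [|k IH] kn; first by rewrite subrr normr0 mul0r.
  have -> : F (z 0%N) - F (z k.+1) = (F (z 0%N) - F (z k)) + (F (z k) - F (z k.+1)) by rewrite addrA subrK.
  rewrite (le_trans (ler_normD _ _)) // -natr1 mulrDl mul1r lerD ?IH ?(ltnW kn) //.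
  have ez : z k.+1 = z k + (y 0 (Ordinal kn) - x 0 (Ordinal kn)) *: e (Ordinal kn).
    apply/rowP => i; rewrite coord_add_evec !mxE ltnS leq_eqVlt.
    case: (eqVneq i (Ordinal kn)) => [->|ik]; first by rewrite /= eqxx ltnn mulr1 addrC subrK.
    have -> : (nat_of_ord i == k) = false by apply/negP => /eqP ik'; move/eqP: ik; apply; exact: val_inj.
    by rewrite mulr0 addr0.
  rewrite ez distrC; apply: le_trans (H2 _ _ _ (zr k) _) _; first by rewrite -ez; exact: zr.
  by apply: om_le => //; have := coord_le_norm (x - y) (Ordinal kn); rewrite !mxE distrC.
by have := step n (leqnn _); rewrite z0 zn.
Qed.

Lemma continuous_bounded_ball (g : V -> R) (r : R) : continuous g ->
  exists2 B, 0 <= B & forall x, `|x| <= r -> `|g x| <= B.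
Proof.
move=> gc; pose A : set V := [set x | `|x| <= r].
have [A0|A0] := pselect (A !=set0); last first.
  by exists 0 => // x xr; exfalso; apply: A0; exists x.
have cA : compact A.
  apply: bounded_closed_compact.
    by exists r; split => [|M rM x /= xr]; [exact: num_real|exact: le_trans (ltW rM)].
  have -> : A = (fun v : V => `|v|) @^-1` [set t | t <= r] by [].
  by apply: closed_comp => [v _|]; [exact: norm_continuous|exact: closed_le].
have [|c cA' cmax] := @EVT_max_rV R n (fun x => `|g x|) A A0 cA.
  apply: continuous_subspaceT => x; apply: continuous_comp; [exact: gc|exact: norm_continuous].
by exists `|g c| => // x xr; apply: cmax; rewrite inE.
Qed.

(** Only [x] is confined to the ball while [y] may leave it; therefore a finite cover with doubled
    radii is used, in the manner of the Lebesgue number. *)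
Lemma unif_continuous_ball (g : V -> R) (r eps : R) : continuous g -> 0 < eps ->
  exists2 de, 0 < de & forall x y, `|x| <= r -> `|x - y| <= de -> `|g x - g y| <= eps.
Proof.
move=> gc eps0.
have loc x : exists2 rho, 0 < rho & forall y, `|y - x| < 2 * rho -> `|g x - g y| <= eps / 2.
  have e20 : 0 < eps / 2 by rewrite divr_gt0.
  have := gc x; move/(@cvgrPdist_le _ _ _ (nbhs x))/(_ _ e20)/nbhs_ballP => [q /= q0 qP].
  exists (q / 2); first by rewrite divr_gt0.
  move=> y; rewrite mulrCA divff // mulr1 => yq; apply: qP.
  by rewrite -ball_normE /ball_ /= distrC.
pose rho x := projT1 (cid2 (loc x)).
have rho0 x : 0 < rho x by rewrite /rho; case: cid2.
have rhoP x y : `|y - x| < 2 * rho x -> `|g x - g y| <= eps / 2.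
  by rewrite /rho; case: cid2 => /= q q0 qP; exact: qP.
have : compact [set x : V | `|x| <= r].
  apply: bounded_closed_compact.
    by exists r; split => [|M rM x /= xr]; [exact: num_real|exact: le_trans (ltW rM)].
  have -> : [set x : V | `|x| <= r] = (fun v : V => `|v|) @^-1` [set t | t <= r] by [].
  by apply: closed_comp => [v _|]; [exact: norm_continuous|exact: closed_le].
rewrite compact_cover => /(_ V setT (fun x => ball x (rho x)))[||F _ FP].
- by move=> x _; exact: ball_open.
- by move=> x _; exists x => //; exact: ballxx.
have [de de0 deP] : exists2 de, 0 < de & forall y, y \in (finmap.enum_fset F : seq V) -> de <= rho y.
  elim: (finmap.enum_fset F : seq V) => [|y s [de de0 deP]]; first by exists 1.
  exists (Num.min (rho y) de) => [|z]; first by rewrite lt_min rho0.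
  by rewrite inE ge_min => /orP[/eqP ->|/deP ->]; rewrite ?lexx ?orbT.
exists de => // x y xr xy.
have [z /= zF] := FP x xr; rewrite -ball_normE /= distrC => xz.
have dz : de <= rho z by exact: deP.
have h1 := rhoP z x; have h2 := rhoP z y.
have -> : g x - g y = (g z - g y) - (g z - g x) by ring.
apply: le_trans (ler_normB _ _) _.
have := rho0 z => rz.
have {}h1 : `|g z - g x| <= eps / 2 by apply: h1; lra.
have {}h2 : `|g z - g y| <= eps / 2.
  apply: h2; have -> : y - z = (x - z) - (x - y) by vring.
  by apply: le_lt_trans (ler_normB _ _) _; lra.
by lra.
Qed.

Lemma is_derive_line (h : V -> R) (x v : V) (t : R) : derivable h (x + t *: v) v ->
  is_derive t (1 : R) (fun s => h (x + s *: v)) ('D_v h (x + t *: v)).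
Proof.
move=> dh.
have E : (fun s : R => s^-1 *: (((fun s => h (x + s *: v)) \o shift t) (s *: (1 : R)) - h (x + t *: v))) =
   (fun s : R => s^-1 *: ((h \o shift (x + t *: v)) (s *: v) - h (x + t *: v))).
  apply/funext => s /=; congr (_ *: (h _ - _)).
  by rewrite (_ : s *: (1 : R) = s) ?scalerDl 1?addrCA // /GRing.scale /= mulr1.
by split; rewrite /derivable /derive /= E.
Qed.

Lemma mvt_line (h : V -> R) (i : 'I_n) (x : V) (s : R) : (forall y, derivable h y (e i)) -> 0 <= s ->
  exists2 t, 0 <= t <= s & df (s *: e i) h x = s * pd i h (x + t *: e i).
Proof.
move=> dh s0; pose g := fun t : R => h (x + t *: e i).
have dg t : is_derive t (1 : R) g (pd i h (x + t *: e i)) by exact: is_derive_line.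
have [|t] := @MVT_segment R g (fun t => pd i h (x + t *: e i)) 0 s s0 (fun t _ => dg t).
  by apply: derivable_within_continuous => t _; have [] := dg t.
rewrite in_itv /= => ts; rewrite subr0 mulrC => E; exists t => //.
by rewrite -E /df /g scale0r addr0.
Qed.

Lemma derivable_shift_df (h : V -> R) (a v x : V) : (forall y, derivable h y v) ->
  is_derive x v (df a h) ('D_v h (x + a) - 'D_v h x).
Proof.
move=> dh; apply: is_deriveB; last exact: derivableP.
have E : (fun s : R => s^-1 *: (((fun y => h (y + a)) \o shift x) (s *: v) - h (x + a))) =
   (fun s : R => s^-1 *: ((h \o shift (x + a)) (s *: v) - h (x + a))).
  by apply/funext => s /=; rewrite addrA.
have d2 := dh (x + a).
by split; rewrite /derivable /derive /= E.
Qed.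

Variable W : V -> R.
Hypothesis CW : C2 W.

Lemma C2_first_consistent (r eps : R) : 0 < eps ->
  exists2 de, 0 < de & forall h x i, 0 < h -> h <= de -> `|x| <= r ->
    `|df (h *: e i) W x - h * pd i W x| <= h * eps.
Proof.
case: CW => _ [dW [cW _]] eps0.
have [de de0 deP] : exists2 de, 0 < de & forall i x y, `|x| <= r -> `|x - y| <= de -> `|pd i W x - pd i W y| <= eps.
  suff H (s : seq 'I_n) : exists2 de, 0 < de & forall i x y, i \in s -> `|x| <= r -> `|x - y| <= de -> `|pd i W x - pd i W y| <= eps.
    by have [de de0 deP] := H (enum 'I_n); exists de => // i x y; apply: deP; rewrite mem_enum.
  elim: s => [|j s [de de0 deP]]; first by exists 1.
  have [de' de'0 de'P] := @unif_continuous_ball (pd j W) r eps (cW j) eps0.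
  exists (Num.min de de') => [|i x y]; first by rewrite lt_min de0.
  rewrite inE le_min => /orP[/eqP ->|ii] xr /andP[d1 d2]; [exact: de'P|exact: deP].
exists de => // h x i h0 hde xr.
have [t /andP[t0 th] ->] := @mvt_line W i x h (dW i) (ltW h0).
rewrite -mulrBr normrM gtr0_norm // ler_pM2l // distrC; apply: deP => //.
rewrite opprD addrA subrr add0r normrN (le_trans (norm_scale_evec _ t0)) //.
exact: le_trans hde.
Qed.

(** The mean value theorem in direction [j] for the difference of [W] along [i], then in direction
    [i] for [pd j W]; the intermediate point is within [2 h] of [x]. *)
Lemma C2_second_consistent (r eps : R) : 0 < eps ->
  exists2 de, 0 < de & forall h x i j, 0 < h -> h <= de -> `|x| <= r ->
    `|df (h *: e i) (df (h *: e j) W) x - h ^+ 2 * pd i (pd j W) x| <= h ^+ 2 * eps.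
Proof.
case: CW => _ [dW [_ [ddW cW]]] eps0.
have [de de0 deP] : exists2 de, 0 < de & forall i j x y, `|x| <= r -> `|x - y| <= de ->
   `|pd i (pd j W) x - pd i (pd j W) y| <= eps.
  suff H (s : seq ('I_n * 'I_n)) : exists2 de, 0 < de & forall p x y, p \in s -> `|x| <= r -> `|x - y| <= de ->
     `|pd p.1 (pd p.2 W) x - pd p.1 (pd p.2 W) y| <= eps.
    have [de de0 deP] := H (enum (('I_n * 'I_n)%type : finType)); exists de => // i j x y.
    by apply: (deP (i, j)); rewrite mem_enum.
  elim: s => [|p s [de de0 deP]]; first by exists 1.
  have [de' de'0 de'P] := @unif_continuous_ball (pd p.1 (pd p.2 W)) r eps (cW p.1 p.2) eps0.
  exists (Num.min de de') => [|q x y]; first by rewrite lt_min de0.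
  rewrite inE le_min => /orP[/eqP ->|qs] xr /andP[d1 d2]; [exact: de'P|exact: deP].
exists (de / 2) => [|h x i j h0 hde xr]; first by rewrite divr_gt0.
rewrite dfC.
have dd y : is_derive y (e j) (df (h *: e i) W) (df (h *: e i) (pd j W) y).
  exact: derivable_shift_df.
have dd' y : derivable (df (h *: e i) W) y (e j) by have [] := dd y.
have [t /andP[t0 th] ->] := @mvt_line (df (h *: e i) W) j x h dd' (ltW h0).
have -> : pd j (df (h *: e i) W) (x + t *: e j) = df (h *: e i) (pd j W) (x + t *: e j).
  by have [] := dd (x + t *: e j).
have [s /andP[s0 sh] ->] := @mvt_line (pd j W) i (x + t *: e j) h (ddW i j) (ltW h0).
rewrite mulrA -expr2 -mulrBr normrM gtr0_norm ?exprn_gt0 // ler_pM2l ?exprn_gt0 //.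
rewrite distrC; apply: deP => //.
have -> : x - (x + t *: e j + s *: e i) = - (t *: e j + s *: e i) by rewrite -addrA opprD addrA subrr add0r.
rewrite normrN (le_trans (ler_normD _ _)) //.
by have := norm_scale_evec j t0; have := norm_scale_evec i s0; lra.
Qed.

(** Both mixed derivatives approximate the same mixed difference, whose two orders agree by
    [dfC]. *)
Lemma C2_symmetric i j x : pd i (pd j W) x = pd j (pd i W) x.
Proof.
apply/eqP; rewrite -subr_eq0 -normr_eq0 eq_le normr_ge0 andbT; apply/ler_addgt0Pl => eps eps0.
rewrite addr0; have e20 : 0 < eps / 2 by rewrite divr_gt0.
have [de de0 deP] := @C2_second_consistent `|x| _ e20.
have h1 := deP de x i j de0 (lexx _) (lexx _); have := deP de x j i de0 (lexx _) (lexx _).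
rewrite dfC => h2; have d20 : 0 < de ^+ 2 by rewrite exprn_gt0.
move: (pd i (pd j W) x) (pd j (pd i W) x) (df _ _ x) h1 h2 => p q D h1 h2.
rewrite -(ler_pM2l d20) -[X in X * _](gtr0_norm d20) -normrM mulrBr.
have -> : de ^+ 2 * p - de ^+ 2 * q = (D - de ^+ 2 * q) - (D - de ^+ 2 * p) by ring.
by apply: le_trans (ler_normB _ _) _; lra.
Qed.

Lemma C2_lipschitz (r : R) : exists2 L, 0 <= L & forall x y, `|x| <= r -> `|y| <= r ->
  `|W x - W y| <= L * `|x - y|.
Proof.
case: CW => _ [dW [cW _]].
have [B B0 BP] : exists2 B, 0 <= B & forall i x, `|x| <= r -> `|pd i W x| <= B.
  suff H (s : seq 'I_n) : exists2 B, 0 <= B & forall i x, i \in s -> `|x| <= r -> `|pd i W x| <= B.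
    by have [B B0 BP] := H (enum 'I_n); exists B => // i x; apply: BP; rewrite mem_enum.
  elim: s => [|j s [B B0 BP]]; first by exists 0.
  have [B' B'0 B'P] := @continuous_bounded_ball (pd j W) r (cW j).
  exists (Num.max B B') => [|i x]; first by rewrite le_max B0.
  rewrite inE le_max => /orP[/eqP ->|/BP H] xr; [by rewrite B'P ?orbT|by rewrite H].
exists (n%:R * B) => [|x y xr yr]; first by rewrite mulr_ge0.
rewrite -mulrA.
have := @coordinate_path W 0 r (fun s => B * s).
move=> CP; apply: CP; rewrite ?subr0 //; first by move=> s t s0 st; rewrite ler_wpM2l.
move=> z i s s0; rewrite !subr0 => zr zsr.
have [t /andP[t0 ts] E] := @mvt_line W i z s (dW i) s0.
have -> : W (z + s *: e i) - W z = df (s *: e i) W z by [].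
rewrite E normrM ger0_norm // mulrC ler_wpM2r // BP //.
(* The intermediate point differs from [z] in one coordinate only, and that one lies between the
   coordinates of the endpoints; in the sup norm it therefore stays in the ball. *)
apply: norm_le_coord => [|k]; first exact: le_trans zr.
have := coord_le_norm z k; have := coord_le_norm (z + s *: e i) k.
rewrite !coord_add_evec; case: (k == i); rewrite ?mulr0 ?mulr1 ?addr0.
  move=> h1 h2; have {}h1 := le_trans h1 zsr; have {}h2 := le_trans h2 zr.
  move: h1 h2; rewrite !ler_norml => /andP[p1 p2] /andP[p3 p4]; apply/andP; split; lra.
by move=> h1 _; exact: le_trans h1 zsr.
Qed.

End Calculus.

(** * Nonnegative Hölder decomposition along integer directions *)

Section Decomposition.
Variables (R : realType) (n : nat) (al : R).
Hypotheses (al0 : 0 < al) (al1 : al < 1).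
Local Notation V := 'rV[R]_n.
Local Notation lh := (@loc_holder R n al).
Local Notation dir := (seq ('I_n * bool) * (V -> R))%type.
Variable a : 'I_n -> 'I_n -> V -> R.
Hypothesis alh : forall i j, lh (a i j).
Hypothesis ell : forall (x nu : V), nu != 0 -> 0 < \sum_(i < n) \sum_(j < n) a i j x * nu 0 i * nu 0 j.

Definition sa i j x := (a i j x + a j i x) / 2.

(** [c] is the share of the matrix reserved for the coordinate directions. The functions are locally
    Hölder on the whole space, but the signs and the representation are required only on [U]; this
    is what makes gluing possible. *)
Definition decomp (U : V -> Prop) (c : V -> R) (D : seq dir) : Prop :=
 [/\ lh c /\ (forall d, d \in D -> lh d.2),
     exists2 c0, 0 < c0 & forall x, U x -> c0 <= c x,
     forall d x, d \in D -> U x -> 0 <= d.2 x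
   & forall x i j, U x ->
       c x * (i == j)%:R + \sum_(d <- D) d.2 x * (vec R d.1 0 i * vec R d.1 0 j) = sa i j x].

Lemma sum_delta (F : 'I_n -> R) k : \sum_i F i * (k == i)%:R = F k.
Proof.
rewrite (bigD1 k) //= eqxx mulr1 big1 ?addr0 // => i ik.
by rewrite eq_sym (negbTE ik) mulr0.
Qed.

Lemma form_sa (x : V) (v : 'I_n -> R) :
  \sum_i \sum_j sa i j x * v i * v j = \sum_i \sum_j a i j x * v i * v j.
Proof.
have -> : \sum_i \sum_j sa i j x * v i * v j =
  (\sum_i \sum_j a i j x * v i * v j + \sum_i \sum_j a j i x * v i * v j) / 2.
  rewrite mulrDl !mulr_suml -big_split; apply: eq_bigr => i _.
  rewrite !mulr_suml -big_split; by apply: eq_bigr => j _; rewrite /sa /=; field.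
rewrite [X in (_ + X) / 2]exchange_big /=.
have -> : \sum_(j < n) \sum_(i < n) a j i x * v i * v j = \sum_i \sum_j a i j x * v i * v j.
  by apply: eq_bigr => i _; apply: eq_bigr => j _; ring.
by field.
Qed.

(** The minimum of the form over the unit sphere of the sup norm; [n.+1] compares the two norms and
    stays positive in dimension 0. If the sphere is empty, every vector is zero. *)
Lemma ellipticity_constant (x0 : V) : exists2 c, 0 < c &
  forall v : 'I_n -> R, c * \sum_i v i ^+ 2 <= \sum_i \sum_j sa i j x0 * v i * v j.
Proof.
pose f (v : V) : R := \sum_i \sum_j a i j x0 * v 0 i * v 0 j.
have fc : continuous f.
  have co i : lh (fun v : V => v 0 i).
    apply: (@lh_lipschitz _ _ _ _ _ _ 1) => // x y; rewrite mul1r.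
    by have := coord_le_norm (x - y) i; rewrite !mxE.
  apply: (lh_continuous (al := al)) => //; apply: lh_sum => // i; apply: lh_sum => // j.
  by apply: lh_mul => //; apply: lh_mul => //; exact: lh_cst.
have fs (t : R) v : f (t *: v) = t ^+ 2 * f v.
  rewrite /f mulr_sumr; apply: eq_bigr => i _; rewrite mulr_sumr; apply: eq_bigr => j _.
  by rewrite !mxE; ring.
pose A : set V := [set v | `|v| = 1].
have [A0|A0] := pselect (A !=set0); last first.
  exists 1 => // v; rewrite form_sa.
  have v0 i : v i = 0.
    apply/eqP/negP => vi; apply: A0; pose w : V := \row_k v k.
    have w0 : `|w| != 0.
      by rewrite normr_eq0; apply/eqP => /rowP/(_ i); rewrite !mxE => /eqP; exact: vi.
    exists (`|w|^-1 *: w); rewrite /A /= normrZ normfV normr_id mulVf //.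
  rewrite big1 => [|i _]; last by rewrite v0 expr0n.
  by rewrite big1 ?mulr0 // => i _; rewrite big1 // => j _; rewrite v0 mulr0 mul0r.
have cA : compact A.
  apply: bounded_closed_compact.
    by exists 1; split => // x x1 v; rewrite /A /= => ->; exact: ltW.
  have -> : A = (fun v : V => `|v|) @^-1` [set 1] by [].
  by apply: closed_comp => [v _|]; [exact: norm_continuous|exact: closed_eq].
have [|v vA vmin] := @EVT_min_rV R n f A A0 cA; first by apply: continuous_subspaceT.
have v1 : `|v| = 1 by move: vA; rewrite inE.
have fv0 : 0 < f v by apply: ell; rewrite -normr_eq0 v1 oner_neq0.
exists (f v / n.+1%:R) => [|w]; first by rewrite divr_gt0.
rewrite form_sa; pose w' : V := \row_k w k.
have -> : \sum_i \sum_j a i j x0 * w i * w j = f w'.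
  by apply: eq_bigr => i _; apply: eq_bigr => j _; rewrite !mxE.
have sw : \sum_i w i ^+ 2 <= n.+1%:R * `|w'| ^+ 2.
  apply: (@le_trans _ _ (\sum_(i < n) `|w'| ^+ 2)).
    apply: ler_sum => i _; rewrite -real_normK ?num_real // lerXn2r ?nnegrE //.
    by have := coord_le_norm w' i; rewrite mxE.
  by rewrite sumr_const card_ord -[_ *+ n]mulr_natl ler_wpM2r ?exprn_ge0 // ler_nat.
have [w0|w0] := eqVneq w' 0.
  have -> : f w' = 0 by rewrite w0 -(scale0r v) fs expr0n mul0r.
  rewrite pmulr_rle0 ?divr_gt0 // (le_trans sw) // w0 normr0 expr0n mulr0 //.
have nw : 0 < `|w'| by rewrite normr_gt0.
have : f v <= f (`|w'|^-1 *: w').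
  by apply: vmin; rewrite inE /A /= normrZ normfV normr_id mulVf // gt_eqF.
rewrite fs exprVn mulrC ler_pdivlMr ?exprn_gt0 //; apply: le_trans.
rewrite -mulrA ler_pM2l // mulrC ler_pdivrMr // mulrC //.
Qed.

Definition zsteps (z : 'I_n -> int) : seq ('I_n * bool) :=
  flatten [seq nseq `|z i|%N (i, 0 <= z i) | i <- enum 'I_n].

Lemma vec_cat s1 s2 : vec R (s1 ++ s2) = vec R s1 + vec R s2 :> V.
Proof. by rewrite /vec big_cat. Qed.

Lemma vec_zsteps z i : vec R (zsteps z) 0 i = (z i)%:~R.
Proof.
have -> : vec R (zsteps z) = \sum_(j < n) (z j)%:~R *: evec R j.
  rewrite -big_enum /zsteps /=; elim: (enum 'I_n) => [|j s IH].
    by rewrite /vec !big_nil.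
  rewrite /= vec_cat IH big_cons; congr (_ + _).
  have vn (k : nat) p : vec R (nseq k p) = k%:R *: stepv R p :> V.
    elim: k => [|k IHk]; first by rewrite /vec big_nil scale0r.
    by rewrite /= vec_cons IHk -natr1 scalerDl scale1r addrC.
  rewrite vn; case: (z j) => k; rewrite /stepv /=; first by rewrite pmulrn.
  by rewrite NegzE scalerN mulrNz scaleNr pmulrn.
rewrite summxE; under eq_bigr do rewrite mxE evecE.
exact: sum_delta.
Qed.

(** [D b] is rounded down to an integer vector, and the weight [D ^- 2] restores the size. The error
    is of order [1 / D]. *)
Lemma approx_square (b : 'I_n -> R) (e : R) : 0 < e -> exists s (w : R), 0 <= w /\
  forall i j, `|w * (vec R s 0 i * vec R s 0 j) - b i * b j| <= e.
Proof.
move=> e0; pose B := \sum_i `|b i|.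
have B0 : 0 <= B by apply: sumr_ge0.
have bB i : `|b i| <= B by rewrite /B (bigD1 i) //= lerDl sumr_ge0.
pose D := (Num.bound ((2 * B + 1) / e)).+1.
have D0 : 0 < D%:R :> R by rewrite ltr0n.
have De : (2 * B + 1) / D%:R <= e.
  rewrite ler_pdivrMr // -ler_pdivrMl // mulrC (le_trans (ltW (archi_boundP _))) //.
    by rewrite divr_ge0 ?(ltW e0) // addr_ge0 // mulr_ge0.
  by rewrite ler_nat.
exists (zsteps (fun i => Num.floor (D%:R * b i))), (D%:R ^- 2); split.
  by rewrite invr_ge0 exprn_ge0.
move=> i j; rewrite !vec_zsteps.
have fl k : `|(Num.floor (D%:R * b k))%:~R / D%:R - b k| <= D%:R^-1.
  have /andP[f1 f2] := mem_rg1_floor (D%:R * b k).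
  have -> : (Num.floor (D%:R * b k))%:~R / D%:R - b k = ((Num.floor (D%:R * b k))%:~R - D%:R * b k) / D%:R.
    by field; rewrite gt_eqF.
  rewrite normrM normfV (gtr0_norm D0) ler_pdivrMr // mulVf ?gt_eqF // ler_norml.
  by apply/andP; split; move: f1 f2; lra.
have fi := fl i; have fj := fl j.
set zi := (Num.floor (D%:R * b i))%:~R in fi *; set zj := (Num.floor (D%:R * b j))%:~R in fj *.
have -> : D%:R ^- 2 * (zi * zj) - b i * b j =
   (zi / D%:R - b i) * (zj / D%:R - b j) + b i * (zj / D%:R - b j) + b j * (zi / D%:R - b i).
  by field; rewrite gt_eqF.
have Di : D%:R^-1 <= 1 :> R by rewrite invf_le1 // ler1n.
apply: le_trans (ler_normD _ _) _; apply: le_trans (lerD (ler_normD _ _) (lexx _)) _; rewrite !normrM.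
apply: le_trans De; rewrite [leRHS]mulrC mulrDr mulr1 addrC (mulrCA _ 2) mulrDl mul1r.
have Dp : 0 <= D%:R^-1 :> R by rewrite invr_ge0 ltW.
have h1 : `|zi / D%:R - b i| * `|zj / D%:R - b j| <= D%:R^-1.
  by rewrite -[leRHS]mulr1; apply: ler_pM => //; exact: le_trans Di.
have h2 : `|b i| * `|zj / D%:R - b j| <= D%:R^-1 * B by rewrite mulrC; apply: ler_pM.
have h3 : `|b j| * `|zi / D%:R - b i| <= D%:R^-1 * B by rewrite mulrC; apply: ler_pM.
by move: h1 h2 h3; lra.
Qed.

Lemma approx_squares (bs : seq ('I_n -> R)) (e : R) : 0 < e ->
  exists L : seq (seq ('I_n * bool) * R), (forall p, p \in L -> 0 <= p.2) /\
  forall i j, `|\sum_(p <- L) p.2 * (vec R p.1 0 i * vec R p.1 0 j) - \sum_(b <- bs) b i * b j| <= e.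
Proof.
elim: bs e => [|b bs IH] e e0.
  by exists [::]; split => // i j; rewrite !big_nil subrr normr0 ltW.
have e2 : 0 < e / 2 by rewrite divr_gt0.
have [L [L0 LP]] := IH _ e2; have [s [w [w0 wP]]] := approx_square b e2.
exists ((s, w) :: L); split => [p|i j].
  by rewrite inE => /orP[/eqP ->|/L0].
rewrite !big_cons /= opprD addrACA (le_trans (ler_normD _ _)) //.
by have := wP i j; have := LP i j; lra.
Qed.

Lemma vec1 (i k : 'I_n) : vec R [:: (i, true)] 0 k = (k == i)%:R.
Proof. by rewrite /vec big_seq1 stepvE mul1r. Qed.

Lemma vec2 (i j : 'I_n) (b : bool) (k : 'I_n) : vec R [:: (i, true); (j, b)] 0 k =
  (k == i)%:R + (if b then 1 else -1) * (k == j)%:R.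
Proof. by rewrite vec_cons mxE /vec big_seq1 !stepvE mul1r. Qed.

(** With [2 c] times the identity set aside, the matrix at [x0] is approximated by integer squares
    with constant weights. The variable remainder [E] is small near [x0]; one copy of [c] dominates
    it, so that its off-diagonal entries can be carried by the directions [e_i + e_j] and
    [e_i - e_j]. The other copy of [c] is left for the coordinate directions. *)
Lemma local_decomp (x0 : V) : exists2 rho, 0 < rho &
  exists c D, decomp (fun x => `|x - x0| < 2 * rho) c D.
Proof.
have [c1 c10 c1P] := ellipticity_constant x0.
pose c := c1 / 4.
have c0 : 0 < c by rewrite divr_gt0.
have [||bs bsP] := @positive_form_sum_of_squares R n (fun i j => sa i j x0 - 2 * c * (i == j)%:R).
- by move=> i j; rewrite /sa (eq_sym j) (addrC (a j i x0)).
- move=> v [i0 vi0].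
  have -> : \sum_i \sum_j (sa i j x0 - 2 * c * (i == j)%:R) * v i * v j =
     \sum_i \sum_j sa i j x0 * v i * v j - 2 * c * \sum_i v i ^+ 2.
    rewrite mulr_sumr -sumrB; apply: eq_bigr => i _.
    rewrite -[X in _ - X](sum_delta (fun j => 2 * c * (v i * v j)) i) -sumrB.
      by apply: eq_bigr => j _; ring.
  have s0 : 0 < \sum_i v i ^+ 2.
    rewrite (bigD1 i0) //= ltr_wpDr //; first by apply: sumr_ge0 => i _; exact: sqr_ge0.
    by rewrite exprn_even_gt0.
  by have := c1P v; rewrite /c; nra.
(* The bound [n e <= c] is the diagonal dominance that makes [w1] nonnegative. *)
pose e := c / n.+1%:R.
have e0 : 0 < e by rewrite divr_gt0.
have ne : n%:R * e <= c.
  by rewrite /e mulrCA ler_piMr ?(ltW c0) // ler_pdivrMr // mul1r ler_nat.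
have [|L [L0 LP]] := @approx_squares bs (e / 2); first by rewrite divr_gt0.
pose S i j := \sum_(p <- L) p.2 * (vec R p.1 0 i * vec R p.1 0 j).
pose E i j x := sa i j x - 2 * c * (i == j)%:R - S i j.
have Esym i j x : E i j x = E j i x.
  rewrite /E /S /sa eq_sym (addrC (a i j x)); congr (_ - _).
  by apply: eq_bigr => p _; rewrite [X in _ * X]mulrC.
have Elh i j : lh (E i j).
  apply: lh_sub => //; last exact: lh_cst.
  apply: lh_sub => //; last exact: lh_cst.
  by rewrite /sa; apply: lh_mul => //; [apply: lh_add|exact: lh_cst].
have E0 i j : `|E i j x0| <= e / 2.
  have := LP i j; rewrite -bsP -/(S i j) distrC; apply: le_trans.
  by rewrite /E.
have : \forall x \near x0, forall i j, `|E i j x0 - E i j x| <= e / 2.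
  pose g x := \sum_i \sum_j `|E i j x0 - E i j x|.
  have glh : lh g.
    apply: lh_sum => // i; apply: lh_sum => // j; apply: lh_norm.
    by apply: lh_sub => //; exact: lh_cst.
  have g0 : g x0 = 0 by rewrite /g big1 // => i _; rewrite big1 // => j _; rewrite subrr normr0.
  have e20 : 0 < e / 2 by rewrite divr_gt0.
  have gc : continuous g := lh_continuous al0 glh.
  have := gc x0.
  move/(@cvgrPdist_le _ _ _ (nbhs x0))/(_ _ e20); rewrite g0.
  apply: filterS => x; rewrite sub0r normrN => gx i j; apply: le_trans gx.
  apply: le_trans (ler_norm _); rewrite /g.
  apply: (@le_trans _ _ (\sum_j `|E i j x0 - E i j x|)).
    by rewrite (bigD1 j) //= lerDl sumr_ge0.
  by rewrite [leRHS](bigD1 i) //= lerDl sumr_ge0 // => k _; rewrite sumr_ge0.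
move/nbhs_ballP => [r /= r0 rP].
exists (r / 2) => /=; first by rewrite divr_gt0.
pose e_ i j x := if i == j then 0 else E i j x.
have e_lh i j : lh (e_ i j) by rewrite /e_; case: eqP => _; [exact: lh_cst|exact: Elh].
pose w1 i x := c + E i i x - \sum_j `|e_ i j x|.
exists (fun=> c).
(* The positive and negative parts of an entry are [(|e| + e) / 2] and [(|e| - e) / 2]; they are
   halved once more because each pair of indices occurs in both orders. *)
exists ([seq (p.1, (fun _ : V => p.2)) | p <- L]
  ++ [seq ([:: (i, true)], w1 i) | i <- enum 'I_n]
  ++ [seq ([:: (i, true); (j, true)], fun x => (`|e_ i j x| + e_ i j x) / 4) | i <- enum 'I_n, j <- enum 'I_n]
  ++ [seq ([:: (i, true); (j, false)], fun x => (`|e_ i j x| - e_ i j x) / 4) | i <- enum 'I_n, j <- enum 'I_n]).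
have Eb i j x : `|x - x0| < 2 * (r / 2) -> `|E i j x| <= e.
  rewrite mulrCA divff // mulr1 => xr.
  have := rP x; rewrite -ball_normE /ball_ /= distrC => /(_ xr)/(_ i j); have := E0 i j.
  move=> h1 h2; rewrite -[X in `|X|](subKr (E i j x0)); apply: le_trans (ler_normB _ _) _.
  by lra.
have eb i j x : `|x - x0| < 2 * (r / 2) -> `|e_ i j x| <= e.
  by rewrite /e_; case: eqP => [_ _|_]; [rewrite normr0 ltW|exact: Eb].
split.
- split; first exact: lh_cst.
  move=> d; rewrite !mem_cat => /or4P[/mapP[p _ ->]|/mapP[i _ ->]|/allpairsP[[i j] [_ _ ->]]|/allpairsP[[i j] [_ _ ->]]] /=.
  + exact: lh_cst.
  + rewrite /w1; apply: lh_sub; first by apply: lh_add; [exact: lh_cst|exact: Elh].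
    by apply: lh_sum => // j; apply: lh_norm.
  + by apply: lh_mul => //; [apply: lh_add => //; apply: lh_norm|exact: lh_cst].
  + by apply: lh_mul => //; [apply: lh_sub => //; apply: lh_norm|exact: lh_cst].
- by exists c.
- move=> d x; rewrite !mem_cat => /or4P[/mapP[p pL ->]|/mapP[i _ ->]|/allpairsP[[i j] [_ _ ->]]|/allpairsP[[i j] [_ _ ->]]] /= xr.
  + exact: L0.
  + rewrite /w1.
    have h1 : \sum_j `|e_ i j x| <= n%:R * e - e.
      rewrite (bigD1 i) //= /e_ eqxx normr0 add0r.
      apply: (@le_trans _ _ (\sum_(j < n | j != i) e)).
        by apply: ler_sum => j ji; rewrite eq_sym (negbTE ji) Eb.
      rewrite [X in _ <= X](_ : _ = \sum_(j < n) e - e); last first.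
        by rewrite sumr_const card_ord mulr_natl.
      by rewrite [in leRHS](bigD1 i) //= addrAC subrr add0r.
    have := Eb i i x xr; rewrite ler_norml => /andP[h2 h3].
    by lra.
  + by rewrite divr_ge0 // -lerBlDr sub0r -normrN ler_norm.
  + by rewrite divr_ge0 // subr_ge0 ler_norm.
- move=> x k l xr; rewrite !big_cat !big_map /= !big_allpairs_dep /= !big_enum /=.
  have -> : \sum_(i < n) w1 i x * (vec R [:: (i, true)] 0 k * vec R [:: (i, true)] 0 l)
     = w1 k x * (k == l)%:R.
    under eq_bigr => i _ do rewrite !vec1 [X in _ * X]mulrC mulrA.
    by rewrite (sum_delta (fun i => w1 i x * (l == i)%:R) k) eq_sym.
  have -> : \sum_(i < n) \sum_(j <- enum 'I_n) (`|e_ i j x| + e_ i j x) / 4 *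
       (vec R [:: (i, true); (j, true)] 0 k * vec R [:: (i, true); (j, true)] 0 l)
     + \sum_(i < n) \sum_(j <- enum 'I_n) (`|e_ i j x| - e_ i j x) / 4 *
       (vec R [:: (i, true); (j, false)] 0 k * vec R [:: (i, true); (j, false)] 0 l)
     = \sum_(i < n) (\sum_(j < n) `|e_ i j x|) / 2 * (l == i)%:R * (k == i)%:R
      + \sum_(i < n) \sum_(j < n) `|e_ i j x| / 2 * (l == j)%:R * (k == j)%:R
      + \sum_(i < n) (\sum_(j < n) e_ i j x / 2 * (l == j)%:R) * (k == i)%:R
      + \sum_(i < n) (\sum_(j < n) e_ i j x / 2 * (k == j)%:R) * (l == i)%:R.
    rewrite -!big_split /=; apply: eq_bigr => i _; rewrite !big_enum /=.
    rewrite !mulr_suml -!big_split /=; apply: eq_bigr => j _.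
    by rewrite !vec2; field.
  rewrite (sum_delta (fun i => (\sum_(j < n) `|e_ i j x|) / 2 * (l == i)%:R)).
  rewrite (sum_delta (fun i => \sum_(j < n) e_ i j x / 2 * (l == j)%:R)) sum_delta.
  rewrite (sum_delta (fun i => \sum_(j < n) e_ i j x / 2 * (k == j)%:R)) sum_delta.
  have -> : \sum_(i < n) \sum_(j < n) `|e_ i j x| / 2 * (l == j)%:R * (k == j)%:R =
     (\sum_(j < n) `|e_ k j x|) / 2 * (l == k)%:R.
    rewrite exchange_big /= mulr_suml mulr_suml.
    under eq_bigr => j _ do rewrite -mulr_suml.
    rewrite (sum_delta (fun j => \sum_(i < n) `|e_ i j x| / 2 * (l == j)%:R)).
    apply: eq_bigr => i _; congr (`|_| / _ * _).
    by rewrite /e_ eq_sym Esym.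
  have es : e_ l k x = e_ k l x by rewrite /e_ eq_sym Esym.
  rewrite es -/(S k l) /w1.
  have : E k l x = sa k l x - 2 * c * (k == l)%:R - S k l by [].
  set T := \sum_j `|e_ k j x|; case: (eqVneq k l) => [<-|kl].
    have -> : e_ k k x = 0 by rewrite /e_ eqxx.
    move: (E k k x) (sa k k x) (S k k) T; rewrite /= => E' s' S' T' ->.
    by rewrite !mulr1; field.
  have -> : e_ k l x = E k l x by rewrite /e_ (negbTE kl).
  move: (E k l x) (E k k x) (sa k l x) (S k l) T; rewrite /= => E' E'' s' S' T' ->.
  by rewrite !mulr0; field.
Qed.

Definition scaled (eta : V -> R) (D : seq dir) : seq dir :=
  [seq (d.1, fun x => eta x * d.2 x) | d <- D].
Definition glue (eta : V -> R) (c1 c2 : V -> R) x := eta x * c1 x + (1 - eta x) * c2 x.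
Definition glued (eta : V -> R) (D1 D2 : seq dir) := scaled eta D1 ++ scaled (fun x => 1 - eta x) D2.

Lemma sum_glued eta D1 D2 x (F : seq ('I_n * bool) -> R) :
  \sum_(d <- glued eta D1 D2) d.2 x * F d.1 =
  eta x * (\sum_(d <- D1) d.2 x * F d.1) + (1 - eta x) * \sum_(d <- D2) d.2 x * F d.1.
Proof.
rewrite big_cat !big_map /= !mulr_sumr; congr (_ + _); apply: eq_bigr => d _; ring.
Qed.

(** The conditions are convex, so a convex combination of two decompositions is one as well, and
    where [eta] is 0 or 1 only one of them has to be valid. *)
Lemma decomp_glue eta (U1 U2 U : V -> Prop) c1 c2 D1 D2 : lh eta ->
  (forall x, 0 <= eta x) -> (forall x, eta x <= 1) ->
  decomp U1 c1 D1 -> decomp U2 c2 D2 ->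
  (forall x, U x -> 0 < eta x -> U1 x) -> (forall x, U x -> eta x < 1 -> U2 x) ->
  decomp U (glue eta c1 c2) (glued eta D1 D2).
Proof.
move=> lhe e0 e1 [[lc1 lD1] [k1 k10 k1P] n1 E1] [[lc2 lD2] [k2 k20 k2P] n2 E2] H1 H2.
have lhe' : lh (fun x => 1 - eta x) by apply: lh_sub => //; exact: lh_cst.
split.
- split; first by apply: lh_add; apply: lh_mul.
  by move=> d; rewrite mem_cat => /orP[/mapP[d' d'D ->]|/mapP[d' d'D ->]] /=; apply: lh_mul => //;
     [exact: lD1|exact: lD2].
- exists (Num.min k1 k2) => [|x Ux]; first by rewrite lt_min k10.
  set k := Num.min k1 k2.
  have kk1 : k <= k1 by rewrite /k ge_min lexx.
  have kk2 : k <= k2 by rewrite /k ge_min lexx orbT.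
  have h1 : eta x * k <= eta x * c1 x.
    have := e0 x; rewrite le_eqVlt => /predU1P[<-|ex]; first by rewrite !mul0r.
    by rewrite ler_wpM2l // (le_trans kk1) // k1P //; exact: H1.
  have h2 : (1 - eta x) * k <= (1 - eta x) * c2 x.
    have := e1 x; rewrite le_eqVlt => /predU1P[->|ex]; first by rewrite subrr !mul0r.
    by rewrite ler_wpM2l ?subr_ge0 // (le_trans kk2) // k2P //; exact: H2.
  have -> : k = eta x * k + (1 - eta x) * k by ring.
  exact: lerD.
- move=> d x; rewrite mem_cat => /orP[/mapP[d' d'D ->]|/mapP[d' d'D ->]] Ux /=.
    have := e0 x; rewrite le_eqVlt => /predU1P[<-|ex]; first by rewrite mul0r.
    by rewrite mulr_ge0 // n1 //; exact: H1.
  have := e1 x; rewrite le_eqVlt => /predU1P[->|ex]; first by rewrite subrr mul0r.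
  by rewrite mulr_ge0 ?subr_ge0 // n2 //; exact: H2.
- move=> x i j Ux; rewrite (sum_glued _ _ _ _ (fun s => vec R s 0 i * vec R s 0 j)) /glue.
  have -> (p q r s t w : R) : (t * p + (1 - t) * q) * w + (t * r + (1 - t) * s) =
     t * (p * w + r) + (1 - t) * (q * w + s) by ring.
  have h1 : eta x * (c1 x * (i == j)%:R + \sum_(d <- D1) d.2 x * (vec R d.1 0 i * vec R d.1 0 j)) = eta x * sa i j x.
    have := e0 x; rewrite le_eqVlt => /predU1P[<-|ex]; first by rewrite !mul0r.
    by rewrite E1 //; exact: H1.
  have h2 : (1 - eta x) * (c2 x * (i == j)%:R + \sum_(d <- D2) d.2 x * (vec R d.1 0 i * vec R d.1 0 j)) = (1 - eta x) * sa i j x.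
    have := e1 x; rewrite le_eqVlt => /predU1P[->|ex]; first by rewrite subrr !mul0r.
    by rewrite E2 //; exact: H2.
  by rewrite h1 h2; ring.
Qed.

Lemma decomp_sub (U U' : V -> Prop) c D : (forall x, U' x -> U x) -> decomp U c D -> decomp U' c D.
Proof.
move=> UU [l [k k0 kP] nn E]; split => //; first by exists k => // x /UU; exact: kP.
- by move=> d x dD /UU; exact: nn.
- by move=> x i j /UU; exact: E.
Qed.

(** Finitely many local decompositions are glued one after another. Their validity on the doubled
    balls leaves room for the transition layers of the cut-offs. *)
Lemma ball_decomp (r : R) : exists c D, decomp (fun x => `|x| <= r) c D.
Proof.
pose rho x := projT1 (cid2 (local_decomp x)).
have rho0 x : 0 < rho x by rewrite /rho; case: cid2.
have rhoP x : exists c D, decomp (fun y => `|y - x| < 2 * rho x) c D by rewrite /rho; case: cid2.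
have : compact [set x : V | `|x| <= r].
  apply: bounded_closed_compact.
    by exists r; split => [|M rM x /= xr]; [exact: num_real|exact: le_trans (ltW rM)].
  have -> : [set x : V | `|x| <= r] = (fun v : V => `|v|) @^-1` [set t | t <= r] by [].
  by apply: closed_comp => [v _|]; [exact: norm_continuous|exact: closed_le].
rewrite compact_cover => /(_ V setT (fun x => ball x (rho x)))[||F _ FP].
- by move=> x _; exact: ball_open.
- by move=> x _; exists x => //; exact: ballxx.
suff [c [D cD]] : exists c D, decomp (fun x => exists2 y, y \in (finmap.enum_fset F : seq V) & `|x - y| <= rho y) c D.
  exists c, D; apply: decomp_sub cD => x xr.
  have [y /= yF] := FP x xr; rewrite -ball_normE /= distrC => xy.
  by exists y => //; exact: ltW.
elim: (finmap.enum_fset F : seq V) => [|y s [c2 [D2 cD2]]].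
  exists (fun=> 1), [::]; split => //.
  - by split => //; exact: lh_cst.
  - by exists 1 => // x [].
  - by move=> x i j [].
have [c1 [D1 cD1]] := rhoP y.
exists (glue (cutoff y (rho y) (rho y)) c1 c2), (glued (cutoff y (rho y) (rho y)) D1 D2).
apply: (decomp_glue _ _ _ cD1 cD2).
- exact: cutoff_lh.
- exact: cutoff_ge0.
- exact: cutoff_le1.
- by move=> x _ /(cutoff_out (rho0 y)); rewrite mulr2n mulrDl mul1r.
- move=> x [z]; rewrite inE => /orP[/eqP ->|zs] xz; last by exists z.
  by rewrite cutoff_in // ltxx.
Qed.

(* The m-th decomposition is valid on the ball of radius m + 1 and its coefficients
   no longer change on the ball of radius m at later stages. *)
Lemma exhausting_decomp : exists (c : nat -> V -> R) (D : nat -> seq dir),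
  (forall m, decomp (fun x => `|x| <= m.+1%:R) (c m) (D m)) /\
  (forall (m k : nat) x (F : seq ('I_n * bool) -> R), (m <= k)%N -> `|x| <= m%:R ->
     c k x = c m x /\ \sum_(d <- D k) d.2 x * F d.1 = \sum_(d <- D m) d.2 x * F d.1).
Proof.
have H (m : nat) : {p : (V -> R) * seq dir | decomp (fun x => `|x| <= m.+1%:R) p.1 p.2}.
  by apply: cid; have [c [D cD]] := ball_decomp m.+1%:R; exists (c, D).
pose th (m : nat) : V -> R := cutoff 0 m%:R 1.
pose P := fix P (m : nat) : (V -> R) * seq dir := match m with
  | 0%N => sval (H 0%N)
  | k.+1 => (glue (th k) (P k).1 (sval (H k.+1)).1, glued (th k) (P k).2 (sval (H k.+1)).2) end.
exists (fun m => (P m).1), (fun m => (P m).2); split.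
  elim=> [|m IH]; first exact: (svalP (H 0%N)).
  apply: (decomp_glue _ _ _ IH (svalP (H m.+1))).
  - exact: cutoff_lh.
  - exact: cutoff_ge0.
  - exact: cutoff_le1.
  - by move=> x _ /(cutoff_out ltr01); rewrite subr0 natr1 => /ltW.
  - by [].
move=> m k x F; elim: k => [|k IH]; first by rewrite leqn0 => /eqP ->.
rewrite leq_eqVlt => /predU1P[-> //|mk] xm.
have [IH1 IH2] := IH mk xm.
have t1 : th k x = 1.
  by apply: cutoff_in => //; rewrite subr0 (le_trans xm) // ler_nat.
split; first by rewrite /= /glue t1 subrr mul0r mul1r addr0.
by rewrite /= sum_glued t1 subrr mul0r mul1r addr0.
Qed.

End Decomposition.

(** * The monotone difference operator and its consistency *)

Section DiscreteOperator.
Variables (R : realType) (n : nat).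
Local Notation V := 'rV[R]_n.
Local Notation dir := (seq ('I_n * bool) * (V -> R))%type.
Implicit Types (h : R) (ds : seq dir) (x y : V) (w v : V -> R).
Variables bp bm : 'I_n -> V -> R.

Definition Lh h ds w x := \sum_(d <- ds) d.2 x * (sd h d.1 w x / h ^+ 2) + drift h bp bm w x.

Lemma Lh_comb h ds u v (B K : R) x :
  Lh h ds (fun y => u y + B * v y + K) x = Lh h ds u x + B * Lh h ds v x.
Proof.
rewrite /Lh mulrDr addrACA; congr (_ + _).
  rewrite mulr_sumr -big_split /=; apply: eq_bigr => d _; rewrite /sd; ring.
rewrite /drift mulr_sumr -big_split /=; apply: eq_bigr => i _; rewrite /df; ring.
Qed.

Lemma Lh_cst h ds (K : R) x : Lh h ds (fun=> K) x = 0.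
Proof.
rewrite /Lh /drift !big1 ?addr0 // => i _; rewrite /sd /df; ring.
Qed.

Lemma Lh_eq_op h ds1 ds2 w x :
  (forall F : seq ('I_n * bool) -> R, \sum_(d <- ds1) d.2 x * F d.1 = \sum_(d <- ds2) d.2 x * F d.1) ->
  Lh h ds1 w x = Lh h ds2 w x.
Proof. by move=> H; rewrite /Lh (H (fun s => sd h s w x / h ^+ 2)). Qed.

(** The neighbours carry nonnegative weights, hence contribute with the right sign; [Lam] dominates
    the total weight of the centre. *)
Lemma Lh_mono h ds w v x (Lam : R) : 0 < h -> h <= 1 ->
  (forall d, d \in ds -> 0 <= d.2 x) -> (forall d, d \in ds -> h * (size d.1)%:R <= 1) ->
  (forall i, 0 <= bp i x) -> (forall i, 0 <= bm i x) ->
  (forall y, `|y - x| <= 1 -> w y <= v y) ->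
  \sum_(d <- ds) 2 * d.2 x / h ^+ 2 + \sum_i (bp i x + bm i x) / h <= Lam ->
  Lh h ds w x - Lh h ds v x <= Lam * (v x - w x).
Proof.
move=> h0 h1 d0 dh bp0 bm0 wv L.
have vw0 : 0 <= v x - w x by rewrite subr_ge0; apply: wv; rewrite subrr normr0.
have h20 : 0 < h ^+ 2 by rewrite exprn_gt0.
apply: le_trans (ler_wpM2r vw0 L).
rewrite mulrDl /Lh opprD addrACA; apply: lerD.
  rewrite mulr_suml -sumrB big_seq [leRHS]big_seq; apply: ler_sum => d dd.
  have n1 : `|h *: vec R d.1| <= 1 by apply: le_trans (norm_hvec _ (ltW h0)) (dh d dd).
  have w1 : w (x + h *: vec R d.1) <= v (x + h *: vec R d.1) by apply: wv; rewrite addrC addKr.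
  have w2 : w (x - h *: vec R d.1) <= v (x - h *: vec R d.1).
    by apply: wv; rewrite addrC addKr normrN.
  have -> : d.2 x * (sd h d.1 w x / h ^+ 2) - d.2 x * (sd h d.1 v x / h ^+ 2) =
     d.2 x / h ^+ 2 * (sd h d.1 w x - sd h d.1 v x) by ring.
  have -> : 2 * d.2 x / h ^+ 2 * (v x - w x) = d.2 x / h ^+ 2 * (2 * (v x - w x)) by ring.
  apply: ler_wpM2l; first by rewrite divr_ge0 ?d0 // ltW.
  rewrite /sd; lra.
rewrite mulr_suml -sumrB; apply: ler_sum => i _.
have n1 : `|h *: evec R i| <= 1 by apply: le_trans (norm_scale_evec _ (ltW h0)) h1.
have w1 : w (x + h *: evec R i) <= v (x + h *: evec R i) by apply: wv; rewrite addrC addKr.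
have w2 : w (x - h *: evec R i) <= v (x - h *: evec R i).
  by apply: wv; rewrite addrC addKr normrN.
rewrite /df subrK.
set X := (X in X <= _).
have -> : X = bp i x / h * ((w (x + h *: evec R i) - w x) - (v (x + h *: evec R i) - v x)) +
   bm i x / h * ((w (x - h *: evec R i) - w x) - (v (x - h *: evec R i) - v x)) by rewrite /X; ring.
have -> : (bp i x + bm i x) / h * (v x - w x) = bp i x / h * (v x - w x) + bm i x / h * (v x - w x) by ring.
by apply: lerD; apply: ler_wpM2l; rewrite ?divr_ge0 ?bp0 ?bm0 ?(ltW h0) //; lra.
Qed.

(** Order is preserved by one explicit step because the centre keeps a nonnegative weight even after
    the Lipschitz loss [LH] of the reaction. *)
Lemma step_mono h tau ds w v x (Lam LH : R) (Hx : R -> R) : 0 < h -> h <= 1 ->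
  (forall d, d \in ds -> 0 <= d.2 x) -> (forall d, d \in ds -> h * (size d.1)%:R <= 1) ->
  (forall i, 0 <= bp i x) -> (forall i, 0 <= bm i x) ->
  (forall y, `|y - x| <= 1 -> w y <= v y) ->
  \sum_(d <- ds) 2 * d.2 x / h ^+ 2 + \sum_i (bp i x + bm i x) / h <= Lam ->
  0 <= tau -> tau * (Lam + LH) <= 1 -> Hx (w x) - Hx (v x) <= LH * (v x - w x) ->
  w x + tau * (Lh h ds w x + Hx (w x)) <= v x + tau * (Lh h ds v x + Hx (v x)).
Proof.
move=> h0 h1 d0 dh bp0 bm0 wv L tau0 cfl HL.
have H := Lh_mono h0 h1 d0 dh bp0 bm0 wv L.
have vw0 : 0 <= v x - w x by rewrite subr_ge0; apply: wv; rewrite subrr normr0.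
have H2 := ler_wpM2l tau0 (lerD H HL).
have H3 := ler_wpM2r vw0 cfl.
move: H2 H3; lra.
Qed.

(** [P] and [Q] stand for a gradient and a Hessian. With both equal to zero the statement becomes a
    bound on [Lh] by difference quotients, and it serves in both ways. *)
Lemma Lh_approx h ds w x (P : 'I_n -> R) (Q : 'I_n -> 'I_n -> R) (e Bm : R) (S0 : nat) :
  0 < h -> 0 <= e -> (1 <= S0)%N -> 0 <= Bm ->
  (forall y i j, `|y - x| <= 3 * (h * S0%:R) ->
     `|df (h *: evec R i) (df (h *: evec R j) w) y - h ^+ 2 * Q i j| <= h ^+ 2 * e) ->
  (forall y i, `|y - x| <= h -> `|df (h *: evec R i) w y - h * P i| <= h * e) ->
  (forall d, d \in ds -> (size d.1 <= S0)%N) -> (forall d, d \in ds -> `|d.2 x| <= Bm) ->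
  (forall i, `|bp i x| <= Bm) -> (forall i, `|bm i x| <= Bm) ->
  `|Lh h ds w x - (\sum_(d <- ds) d.2 x * (\sum_i \sum_j vec R d.1 0 i * vec R d.1 0 j * Q i j)
      + \sum_i (bp i x - bm i x) * P i)| <= ((size ds)%:R * (Bm * S0%:R ^+ 2) + n%:R * (2 * Bm)) * e.
Proof.
move=> h0 e0 S01 Bm0 HQ HP dS dB bpB bmB.
have h20 : 0 < h ^+ 2 by rewrite exprn_gt0.
rewrite /Lh opprD addrACA mulrDl; apply: le_trans (ler_normD _ _) (lerD _ _).
  rewrite -sumrB; apply: le_trans (ler_norm_sum _ _ _) _.
  have -> : (size ds)%:R * (Bm * S0%:R ^+ 2) * e = \sum_(d <- ds) (Bm * S0%:R ^+ 2 * e).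
    by rewrite big_const_seq count_predT iter_addr_0 -mulr_natl; ring.
  rewrite big_seq [leRHS]big_seq; apply: ler_sum => d dd.
  rewrite -mulrBr normrM -mulrA; apply: ler_pM => //; first exact: dB.
  have ss : (size d.1)%:R <= S0%:R :> R by rewrite ler_nat dS.
  have := @sd_approx R n h d.1 w Q e x (ltW h0).
  set q := \sum_i _; set s2 := sd _ _ _ _ => H.
  have {}H : `|s2 - h ^+ 2 * q| <= S0%:R ^+ 2 * (h ^+ 2 * e).
    apply: le_trans (H _) _.
      move=> y i j yx; apply: HQ; apply: le_trans yx _; rewrite ler_pM2l //.
      by rewrite ler_pM2l.
    apply: ler_wpM2r; first by apply: mulr_ge0 => //; exact: ltW.
    by rewrite ler_pXn2r ?nnegrE.
  have -> : s2 / h ^+ 2 - q = (s2 - h ^+ 2 * q) / h ^+ 2 by field; rewrite gt_eqF.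
  rewrite normrM normfV (gtr0_norm h20) ler_pdivrMr //; apply: le_trans H _.
  by rewrite le_eqVlt; apply/orP; left; apply/eqP; ring.
rewrite /drift -sumrB; apply: le_trans (ler_norm_sum _ _ _) _.
have -> : n%:R * (2 * Bm) * e = \sum_(i < n) (Bm * e + Bm * e).
  by rewrite sumr_const card_ord -mulr_natl; ring.
apply: ler_sum => i _.
have q1 : `|df (h *: evec R i) w x / h - P i| <= e.
  have -> : df (h *: evec R i) w x / h - P i = (df (h *: evec R i) w x - h * P i) / h.
    by field; rewrite gt_eqF.
  rewrite normrM normfV (gtr0_norm h0) ler_pdivrMr // [e * h]mulrC; apply: HP.
  by rewrite subrr normr0 ltW.
have q2 : `|df (h *: evec R i) w (x - h *: evec R i) / h - P i| <= e.
  set D := df _ _ _; have -> : D / h - P i = (D - h * P i) / h by field; rewrite gt_eqF.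
  rewrite normrM normfV (gtr0_norm h0) ler_pdivrMr // [e * h]mulrC; apply: HP.
  by rewrite addrC addKr normrN; apply: norm_scale_evec; exact: ltW.
move: q1 q2; set D1 := df _ _ _ / h; set D2 := df _ _ _ / h => q1 q2.
have -> : bp i x * D1 - bm i x * D2 - (bp i x - bm i x) * P i = bp i x * (D1 - P i) - bm i x * (D2 - P i) by ring.
by apply: le_trans (ler_normB _ _) (lerD _ _); rewrite normrM; apply: ler_pM.
Qed.

Variable al : R.
Hypotheses (al0 : 0 < al) (al1 : al < 1).
Local Notation lh := (@loc_holder R n al).

Lemma directions_bounded ds x0 (r : R) : (forall d, d \in ds -> lh d.2) ->
  exists B S0, [/\ 0 <= B, (1 <= S0)%N & forall d, d \in ds -> (size d.1 <= S0)%N /\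
    forall x y, `|x - x0| <= r -> `|y - x0| <= r -> `|d.2 x| <= B /\ `|d.2 x - d.2 y| <= B * `|x - y| `^ al].
Proof.
elim: ds => [|d ds IH] H; first by exists 0, 1%N.
have [|B [S0 [B0 S01 BS]]] := IH; first by move=> d' d'ds; apply: H; rewrite inE d'ds orbT.
have dl : lh d.2 by apply: H; rewrite inE eqxx.
have [C C0 CP] := lh_nonneg dl x0 r; have [B' B'0 B'P] := lh_bounded al0 dl x0 r.
pose BB := Num.max B (Num.max C B').
have b1 : B <= BB by rewrite /BB !le_max lexx.
have b2 : C <= BB by rewrite /BB !le_max lexx !orbT.
have b3 : B' <= BB by rewrite /BB !le_max lexx !orbT.
exists BB, (maxn S0 (size d.1)); split; first exact: le_trans b1.
  by rewrite leq_max S01.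
move=> d'; rewrite inE => /orP[/eqP ->|d'ds].
  split; first by rewrite leq_max leqnn orbT.
  move=> x y xr yr; split; first exact: le_trans (B'P x xr) b3.
  by apply: le_trans (CP x y xr yr) _; rewrite ler_wpM2r ?powR_ge0.
have [s1 s2] := BS d' d'ds; split; first by rewrite leq_max s1.
move=> x y xr yr; have [c1 c2] := s2 x y xr yr; split; first exact: le_trans c1 b1.
by apply: le_trans c2 _; rewrite ler_wpM2r ?powR_ge0.
Qed.

Lemma family_bounded (b : 'I_n -> V -> R) x0 (r : R) : (forall i, lh (b i)) ->
  exists2 B, 0 <= B & forall i x y, `|x - x0| <= r -> `|y - x0| <= r ->
    `|b i x| <= B /\ `|b i x - b i y| <= B * `|x - y| `^ al.
Proof.
move=> bl; have [|B [S0 [B0 _ BP]]] := @directions_bounded [seq ([::], b i) | i <- enum 'I_n] x0 r.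
  by move=> d /mapP[i _ ->]; exact: bl.
exists B => // i x y xr yr.
have [|_] := BP ([::], b i); first by apply: map_f; rewrite mem_enum.
by move=> /(_ x y xr yr).
Qed.

End DiscreteOperator.

(** * Directions of the scheme on growing balls *)

Section ExhaustingScheme.
Variables (R : realType) (n : nat) (al : R).
Hypotheses (al0 : 0 < al) (al1 : al < 1).
Local Notation V := 'rV[R]_n.
Local Notation dir := (seq ('I_n * bool) * (V -> R))%type.
Local Notation lh := (@loc_holder R n al).
Variable a : 'I_n -> 'I_n -> V -> R.
Hypothesis alh : forall i j, lh (a i j).
Hypothesis ell : forall (x nu : V), nu != 0 -> 0 < \sum_(i < n) \sum_(j < n) a i j x * nu 0 i * nu 0 j.

(** The reserved part [c m] becomes the weight of every coordinate direction, which supplies the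
    direction needed for the doubling of variables. *)
Lemma exhausting_directions : exists ds : nat -> seq dir,
  [/\ forall m d, d \in ds m -> lh d.2,
      forall m d x, d \in ds m -> `|x| <= m.+1%:R -> 0 <= d.2 x,
      forall m, exists2 c0, 0 < c0 & forall i, exists d, [/\ d \in ds m, d.1 = [:: (i, true)]
        & forall x, `|x| <= m.+1%:R -> c0 <= d.2 x],
      forall m x i j, `|x| <= m.+1%:R ->
        \sum_(d <- ds m) d.2 x * (vec R d.1 0 i * vec R d.1 0 j) = sa a i j x
    & forall (m k : nat) x (F : seq ('I_n * bool) -> R), (m <= k)%N -> `|x| <= m%:R ->
        \sum_(d <- ds k) d.2 x * F d.1 = \sum_(d <- ds m) d.2 x * F d.1].
Proof.
have [c [D [H1 H2]]] := exhausting_decomp al0 al1 alh ell.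
pose ds m : seq dir := [seq ([:: (i, true)], c m) | i <- enum 'I_n] ++ D m.
have S m x (F : seq ('I_n * bool) -> R) : \sum_(d <- ds m) d.2 x * F d.1 =
   \sum_i c m x * F [:: (i, true)] + \sum_(d <- D m) d.2 x * F d.1.
  by rewrite /ds big_cat big_map big_enum.
have inds m d : d \in ds m -> d.2 = c m \/ d \in D m.
  by rewrite /ds mem_cat => /orP[/mapP[i _ ->]|]; [left|right].
exists ds; split.
- by move=> m d; have [[l1 l2] _ _ _] := H1 m => /inds[->|/l2].
- move=> m d x; have [_ [c0 c00 c0P] p _] := H1 m => /inds[-> xm|/p]; last exact.
  by apply: le_trans (ltW c00) (c0P x xm).
- move=> m; have [_ [c0 c00 c0P] _ _] := H1 m; exists c0 => // i.
  exists ([:: (i, true)], c m); split => //.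
  by rewrite /ds mem_cat map_f // mem_enum.
- move=> m x i j xm; have [_ _ _ E] := H1 m.
  rewrite (S m x (fun s => vec R s 0 i * vec R s 0 j)) -E //; congr (_ + _).
  under eq_bigr do rewrite !vec1 mulrA.
  by rewrite (sum_delta (fun k => c m x * (i == k)%:R)) eq_sym.
- move=> m k x F mk xm; rewrite !S; have [-> ->] := H2 m k x F mk xm.
  congr (_ + _); apply: eq_bigr => i _; by [].
Qed.

(* The decomposition only sees the symmetric part of [a]. *)
Lemma directions_quadratic (ds : seq dir) x (Q : 'I_n -> 'I_n -> R) :
  (forall i j, \sum_(d <- ds) d.2 x * (vec R d.1 0 i * vec R d.1 0 j) = sa a i j x) ->
  (forall i j, Q i j = Q j i) ->
  \sum_(d <- ds) d.2 x * (\sum_i \sum_j vec R d.1 0 i * vec R d.1 0 j * Q i j) =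
  \sum_i \sum_j a i j x * Q i j.
Proof.
move=> E Qs.
transitivity (\sum_i \sum_j sa a i j x * Q i j).
  under eq_bigr do rewrite mulr_sumr.
  rewrite exchange_big; apply: eq_bigr => i _ /=.
  under eq_bigr do rewrite mulr_sumr.
  rewrite exchange_big; apply: eq_bigr => j _ /=.
  rewrite -E mulr_suml; apply: eq_bigr => d _; ring.
have -> : \sum_i \sum_j sa a i j x * Q i j =
   (\sum_i \sum_j a i j x * Q i j + \sum_i \sum_j a j i x * Q i j) / 2.
  rewrite -big_split mulr_suml; apply: eq_bigr => i _ /=.
  rewrite -big_split mulr_suml; apply: eq_bigr => j _ /=; rewrite /sa; ring.
have -> : \sum_i \sum_j a j i x * Q i j = \sum_i \sum_j a i j x * Q i j.
  rewrite exchange_big; apply: eq_bigr => i _; apply: eq_bigr => j _ /=; by rewrite Qs.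
by field.
Qed.

End ExhaustingScheme.

(** * Limits along an ultrafilter *)

Section Ultralimit.
Variables (R : realType) (F : set_system nat).
Hypotheses (FU : UltraFilter F) (Foo : \oo `<=` F).

Definition ulim (u : nat -> R) : R := lim (u @ F).

(** Compactness of a segment provides a cluster point, and for an ultrafilter a cluster point is a
    limit. *)
Lemma ulim_cvg (u : nat -> R) (B : R) (N : nat) : (forall m, (N <= m)%N -> `|u m| <= B) -> u @ F --> ulim u.
Proof.
move=> uB.
have FP : ProperFilter F by exact: ultra_proper.
suff [l ul] : exists l : R, u @ F --> l.
  by have -> : ulim u = l by apply/cvg_lim.
have [|l [_ ul]] := @segment_compact R (- B) B (u @ F) _.
  apply: Foo; exists N => // m /= Nm; rewrite /= in_itv /= -ler_norml; exact: uB.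
exists l => A Al.
have [//|FA] := in_ultra_setVsetC (u @^-1` A) FU.
have [y [nA yA]] := ul (~` A) A FA Al; by case: (nA yA).
Qed.

Lemma ulim_le (u : nat -> R) (l e : R) : u @ F --> l ->
  (forall d, 0 < d -> exists N : nat, forall m, (N <= m)%N -> u m <= e + d) -> l <= e.
Proof.
move=> ul H; apply/ler_addgt0Pr => d d0; have [N NP] := H d d0.
have FP : ProperFilter F by exact: ultra_proper.
apply: (@closed_cvg _ _ F _ u [set y | y <= e + d]) ul; first exact: closed_le.
by apply: Foo; exists N => // m /= /NP.
Qed.

Lemma ulim_norm_le (u : nat -> R) (l e : R) : u @ F --> l ->
  (forall d, 0 < d -> exists N : nat, forall m, (N <= m)%N -> `|u m| <= e + d) -> `|l| <= e.
Proof.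
move=> ul; apply: ulim_le; have FP : ProperFilter F by exact: ultra_proper.
exact: cvg_norm.
Qed.

Lemma ulim_taylor (u v w : nat -> R) (lu lv lw s e : R) : u @ F --> lu -> v @ F --> lv -> w @ F --> lw ->
  (forall d, 0 < d -> exists N : nat, forall m, (N <= m)%N -> `|u m - v m - s * w m| <= e + d) ->
  `|lu - lv - s * lw| <= e.
Proof.
have FP : ProperFilter F by exact: ultra_proper.
have FF : Filter F by exact: filter_filter.
by move=> uc vc wc; apply: ulim_norm_le; apply: cvgB; [exact: cvgB|apply: cvgM => //; exact: cvg_cst].
Qed.

Lemma cvg_close (u v : nat -> R) (l : R) : v @ F --> l ->
  (forall d, 0 < d -> exists N : nat, forall m, (N <= m)%N -> `|u m - v m| <= d) -> u @ F --> l.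
Proof.
have FP : ProperFilter F by exact: ultra_proper.
have FF : Filter F by exact: filter_filter.
move=> vl H; apply/cvgrPdist_le => d d0; have d20 : 0 < d / 2 by rewrite divr_gt0.
have [N NP] := H _ d20.
have A1 : F [set m | `|u m - v m| <= d / 2] by apply: Foo; exists N => // m /= /NP.
have /cvgrPdist_le/(_ _ d20) A2 := vl.
apply: filterS (filterI A1 A2) => m /= [h1 h2].
have -> : l - u m = (l - v m) - (u m - v m) by ring.
by apply: le_trans (ler_normB _ _) _; lra.
Qed.

Lemma usum_cvg (I : Type) (r : seq I) (f : I -> nat -> R) (l : I -> R) : (forall i, f i @ F --> l i) ->
  (fun m => \sum_(i <- r) f i m) @ F --> \sum_(i <- r) l i.
Proof.
have FP : ProperFilter F by exact: ultra_proper.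
have FF : Filter F by exact: filter_filter.
move=> H; elim: r => [|i r IH].
  by rewrite big_nil; under eq_fun do rewrite big_nil; exact: cvg_cst.
by rewrite big_cons; under eq_fun do rewrite big_cons; apply: cvgD.
Qed.

End Ultralimit.

(** * Grid nodes and discrete Taylor estimates *)

Section Rounding.
Variables (R : realType) (n : nat).
Local Notation V := 'rV[R]_n.
Implicit Types (h s t : R) (x y : V).

(** Sampling at the rounded point replaces interpolation: it commutes with grid steps, and by
    [rd_shift] any shift along an axis becomes a whole number of them. *)
Definition rd h x : V := \row_i ((Num.floor (x 0 i / h))%:~R * h).

Lemma rdE h x i : rd h x 0 i = (Num.floor (x 0 i / h))%:~R * h.
Proof. by rewrite mxE. Qed.

Lemma floor_lo h t : 0 < h -> (Num.floor (t / h))%:~R * h <= t.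
Proof. by move=> h0; rewrite -ler_pdivlMr //; case/andP: (floor_itv (t / h)). Qed.

Lemma floor_hi h t : 0 < h -> t < (Num.floor (t / h))%:~R * h + h.
Proof.
move=> h0; rewrite -[X in _ + X]mul1r -mulrDl -ltr_pdivrMr //.
by case/andP: (floor_itv (t / h)) => _; rewrite intrD.
Qed.

Lemma rd_near h x : 0 < h -> `|rd h x - x| <= h.
Proof.
move=> h0; apply: norm_le_coord => [|i]; first exact: ltW.
rewrite !mxE ler_norml; have := floor_lo (x 0 i) h0; have := floor_hi (x 0 i) h0.
by move=> ? ?; apply/andP; split; lra.
Qed.

Lemma rd_shift h x i s : 0 < h -> 0 <= s ->
  exists2 d : nat, rd h (x + s *: evec R i) = rd h x + d%:R *: (h *: evec R i) & `|d%:R * h - s| <= h.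
Proof.
move=> h0 s0.
have mono : (Num.floor (x 0 i / h) <= Num.floor ((x 0 i + s) / h))%R.
  by apply: le_floor; rewrite ler_pM2r ?invr_gt0 // lerDl.
pose q := Num.floor ((x 0 i + s) / h) - Num.floor (x 0 i / h).
have qE : `|q|%N%:R = (Num.floor ((x 0 i + s) / h))%:~R - (Num.floor (x 0 i / h))%:~R :> R.
  by rewrite natr_absz ger0_norm ?subr_ge0 // /q intrD intrN.
exists `|q|%N.
  apply/rowP => j; rewrite scalerA coord_add_evec !rdE coord_add_evec.
  case: (eqVneq j i) => [->|ji]; last by rewrite !mulr0 !addr0.
  rewrite !mulr1 qE; ring.
rewrite qE ler_norml.
have := floor_lo (x 0 i) h0; have := floor_hi (x 0 i) h0.
have := floor_lo (x 0 i + s) h0; have := floor_hi (x 0 i + s) h0.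
by move: (_%:~R) (_%:~R) => p1 p2 ? ? ? ?; apply/andP; split; lra.
Qed.

Lemma rd_step h x i : 0 < h -> rd h (x + h *: evec R i) = rd h x + h *: evec R i.
Proof.
move=> h0; apply/rowP => j; rewrite coord_add_evec !rdE coord_add_evec.
case: (eqVneq j i) => [->|ji]; last by rewrite !mulr0 !addr0.
by rewrite !mulr1 mulrDl divff ?gt_eqF // floorDrz ?rpred1 // floor1 intrD mulrDl mul1r.
Qed.

Lemma rd_step_opp h x i : 0 < h -> rd h (x - h *: evec R i) = rd h x - h *: evec R i.
Proof. by move=> h0; rewrite -{2}[x](subrK (h *: evec R i)) rd_step // addrK. Qed.

Lemma rd_vec h (s : seq ('I_n * bool)) x : 0 < h -> rd h (x + h *: vec R s) = rd h x + h *: vec R s.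
Proof.
move=> h0; elim: s x => [|p s IH] x; first by rewrite /vec big_nil scaler0 !addr0.
rewrite vec_cons scalerDr !addrA IH; congr (_ + _); rewrite /stepv; case: p.2; first exact: rd_step.
by rewrite scalerN; exact: rd_step_opp.
Qed.

Lemma rd_vec_opp h (s : seq ('I_n * bool)) x : 0 < h -> rd h (x - h *: vec R s) = rd h x - h *: vec R s.
Proof. by move=> h0; rewrite -{2}[x](subrK (h *: vec R s)) rd_vec // addrK. Qed.

Lemma rd_idem h x : 0 < h -> rd h (rd h x) = rd h x.
Proof. by move=> h0; apply/rowP => i; rewrite !mxE mulfK ?gt_eqF // intrKfloor. Qed.

Lemma df_rd h i (w : V -> R) y : 0 < h -> df (h *: evec R i) (fun x => w (rd h x)) y = df (h *: evec R i) w (rd h y).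
Proof. by move=> h0; rewrite /df rd_step. Qed.

Lemma Lh_rd bp bm h ds (w : V -> R) x : 0 < h -> rd h x = x ->
  Lh bp bm h ds (fun y => w (rd h y)) x = Lh bp bm h ds w x.
Proof.
move=> h0 xE; rewrite /Lh /sd /drift; congr (_ + _).
  by apply: eq_bigr => d _; rewrite rd_vec // rd_vec_opp // xE.
by apply: eq_bigr => i _; rewrite !df_rd // rd_step_opp // xE.
Qed.

Lemma trunc_near h t : 0 < h -> 0 <= t -> `|(Num.trunc (t / h))%:R * h - t| <= h.
Proof.
move=> h0 t0; have /andP[] := truncn_itv (divr_ge0 t0 (ltW h0)).
rewrite ler_pdivlMr // ltr_pdivrMr // -[(Num.trunc (t / h)).+1%:R]natr1 mulrDl mul1r ler_norml => ? ?; apply/andP; split; lra.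
Qed.

Lemma trunc_shift h t s : 0 < h -> 0 <= t -> 0 <= s ->
  exists2 d : nat, Num.trunc ((t + s) / h) = (Num.trunc (t / h) + d)%N & `|d%:R * h - s| <= h.
Proof.
move=> h0 t0 s0; have le : (Num.trunc (t / h) <= Num.trunc ((t + s) / h))%N.
  by apply: le_truncn; rewrite ler_pM2r ?invr_gt0 // lerDl.
exists (Num.trunc ((t + s) / h) - Num.trunc (t / h))%N; first by rewrite subnKC.
have /andP[] := truncn_itv (divr_ge0 t0 (ltW h0)); have /andP[] := truncn_itv (divr_ge0 (addr_ge0 t0 s0) (ltW h0)).
rewrite !ler_pdivlMr // !ltr_pdivrMr // -[(Num.trunc ((t + s) / h)).+1%:R]natr1 -[(Num.trunc (t / h)).+1%:R]natr1 natrB //.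
move: (_%:R) (_%:R) => p q ? ? ? ?; rewrite ler_norml; apply/andP; split; lra.
Qed.

(** [d] grid steps stand for the exact length [s]; the mismatch of at most [h] costs [h |P|]. *)
Lemma grid_taylor (d : nat) (a : V) h s (P e : R) (w : V -> R) x : 0 < h -> 0 <= e ->
  P = df a w x / h -> (forall j, (0 < j)%N -> (j < d)%N -> `|df (j%:R *: a) (df a w) x| <= h * e) ->
  `|d%:R * h - s| <= h -> `|df (d%:R *: a) w x - s * P| <= d%:R * h * e + h * `|P|.
Proof.
move=> h0 e0 PE H ds; have hP : df a w x = h * P by rewrite PE; field; rewrite gt_eqF.
have := @df_multi R n d a w (h * P) (h * e) x.
have -> : df (d%:R *: a) w x - s * P = (df (d%:R *: a) w x - d%:R * (h * P)) + (d%:R * h - s) * P by ring.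
move=> H'; apply: le_trans (ler_normD _ _) _; apply: lerD; last by rewrite normrM ler_wpM2r.
rewrite -mulrA; apply: H' => -[|j] jd; last by rewrite -hP; exact: H.
by rewrite scale0r addr0 hP subrr normr0 mulr_ge0 // ltW.
Qed.

(** Interpolation for a difference of two functions: closeness of the values at two points [d] steps
    apart, with little variation of the unit quotients in between, makes the unit quotients
    close. *)
Lemma quotient_compare (d : nat) (a : V) h (eta e : R) (w w' : V -> R) x : (0 < d)%N -> 0 < h -> 0 <= e ->
  (forall j, (0 < j)%N -> (j < d)%N -> `|df (j%:R *: a) (df a w) x| <= h * e) ->
  (forall j, (0 < j)%N -> (j < d)%N -> `|df (j%:R *: a) (df a w') x| <= h * e) ->
  `|w x - w' x| <= eta -> `|w (x + d%:R *: a) - w' (x + d%:R *: a)| <= eta ->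
  `|df a w x - df a w' x| <= h * (2 * eta / (d%:R * h) + 2 * e).
Proof.
move=> d0 h0 e0 H1 H2 e1 e2; have d0' : 0 < d%:R :> R by rewrite ltr0n.
have dh : 0 < d%:R * h by exact: mulr_gt0.
have := @grid_taylor d a h (d%:R * h) _ e w x h0 e0 erefl H1.
have := @grid_taylor d a h (d%:R * h) _ e w' x h0 e0 erefl H2.
have M (v : V -> R) : (forall j, (0 < j)%N -> (j < d)%N -> `|df (j%:R *: a) (df a v) x| <= h * e) ->
   `|df (d%:R *: a) v x - d%:R * df a v x| <= d%:R * (h * e).
  move=> H; apply: df_multi => -[|j] jd; last exact: H.
  by rewrite scale0r addr0 subrr normr0 mulr_ge0 // ltW.
move=> _ _; have {H1} M1 := M w H1; have {H2} M2 := M w' H2.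
rewrite -(ler_pM2l d0').
have -> : d%:R * `|df a w x - df a w' x| = `|d%:R * (df a w x - df a w' x)| by rewrite normrM gtr0_norm.
have -> : d%:R * (h * (2 * eta / (d%:R * h) + 2 * e)) = eta + eta + (d%:R * (h * e) + d%:R * (h * e)).
  by field; rewrite !gt_eqF.
have -> : d%:R * (df a w x - df a w' x) = ((w (x + d%:R *: a) - w' (x + d%:R *: a)) - (w x - w' x)) -
   ((df (d%:R *: a) w x - d%:R * df a w x) - (df (d%:R *: a) w' x - d%:R * df a w' x)).
  have dE (u : V -> R) : df (d%:R *: a) u x = u (x + d%:R *: a) - u x by [].
  by rewrite !dE; ring.
apply: le_trans (ler_normB _ _) (lerD _ _); apply: le_trans (ler_normB _ _) (lerD _ _) => //.
Qed.

Lemma quotient_close (i : 'I_n) h s (th : R) (w w' : V -> R) x : 0 < h -> h <= s -> 0 < th ->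
  (forall j, (0 < j)%N -> j%:R * h <= 2 * s ->
     `|df (j%:R *: (h *: evec R i)) (df (h *: evec R i) w) x| <= h * (th / 4)) ->
  (forall j, (0 < j)%N -> j%:R * h <= 2 * s ->
     `|df (j%:R *: (h *: evec R i)) (df (h *: evec R i) w') x| <= h * (th / 4)) ->
  (forall y, `|y - x| <= 2 * s -> `|w y - w' y| <= th * s / 4) ->
  `|df (h *: evec R i) w x - df (h *: evec R i) w' x| <= h * th.
Proof.
move=> h0 hs th0 H1 H2 H3; have s0 : 0 < s by exact: lt_le_trans hs.
pose d := (Num.trunc (s / h)).+1.
have /andP[] := truncn_itv (divr_ge0 (ltW s0) (ltW h0)); rewrite -/d ler_pdivlMr // ltr_pdivrMr // => d1 d2.
have d3 : d%:R * h <= 2 * s by rewrite /d -[_.+1%:R]natr1 mulrDl mul1r; lra.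
have jd j : (j < d)%N -> j%:R * h <= 2 * s.
  by move=> jd; apply: le_trans d3; rewrite ler_wpM2r ?(ltW h0) // ler_nat ltnW.
have eta0 : 0 <= th * s / 4 by rewrite divr_ge0 // mulr_ge0 // ltW.
have := @quotient_compare d (h *: evec R i) h (th * s / 4) (th / 4) w w' x (ltn0Sn _) h0.
move=> H; apply: le_trans (H _ _ _ _ _) _.
- by rewrite divr_ge0 // ltW.
- by move=> j j0 /jd; exact: H1.
- by move=> j j0 /jd; exact: H2.
- by apply: H3; rewrite subrr normr0; lra.
- apply: H3; rewrite addrC addKr normrZ ger0_norm //; apply: le_trans d3.
  by rewrite ler_wpM2l // norm_scale_evec // ltW.
rewrite ler_wpM2l ?(ltW h0) //.
have : 2 * (th * s / 4) / (d%:R * h) <= th / 2.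
  rewrite ler_pdivrMr; last exact: lt_trans d2.
  have := ler_wpM2l (ltW th0) (ltW d2); lra.
by lra.
Qed.

End Rounding.

(** * Differentiability from uniform forward difference estimates *)

Section UniformDifferences.
Variables (R : realType) (Z : normedModType R) (F g : Z -> R) (v : Z) (D : set Z).
Hypothesis Dopen : open D.
Hypothesis Fc : forall p, D p -> {for p, continuous F}.
Hypothesis H : forall p, D p -> exists2 rho, 0 < rho & forall e, 0 < e -> exists2 de, 0 < de &
  forall q, `|q - p| <= rho -> forall s, 0 < s -> s <= de -> `|F (q + s *: v) - F q - s * g q| <= e * s.

Lemma forward_quotient (q : Z) (e s : R) : 0 < s -> `|F (q + s *: v) - F q - s * g q| <= e * s ->
  `|(F (q + s *: v) - F q) / s - g q| <= e.
Proof.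
move=> s0 h; have -> : (F (q + s *: v) - F q) / s - g q = (F (q + s *: v) - F q - s * g q) / s.
  by field; rewrite gt_eqF.
by rewrite normrM normfV (gtr0_norm s0) ler_pdivrMr.
Qed.

Lemma small_shift (p : Z) (r : R) : 0 < r -> exists2 de, 0 < de & forall s, `|s| <= de -> `|s *: v| < r.
Proof.
move=> r0; have v1 : 0 < `|v| + 1 by rewrite ltr_wpDl.
exists (r / (2 * (`|v| + 1))); first by rewrite divr_gt0 // mulr_gt0.
move=> s; rewrite ler_pdivlMr ?mulr_gt0 // normrZ => sr.
by have := mulr_ge0 (normr_ge0 s) (normr_ge0 v); have := normr_ge0 s; lra.
Qed.

(** [g] is a locally uniform limit of forward quotients of [F], which are continuous. *)
Lemma uniform_difference_continuous p : D p -> {for p, continuous g}.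
Proof.
move=> Dp; apply/(@cvgrPdist_le _ _ _ (nbhs p)) => eps eps0.
have [rho rho0 rhoP] := H Dp.
have e30 : 0 < eps / 3 by rewrite divr_gt0.
have [de de0 deP] := rhoP _ e30.
have /nbhs_ballP[r /= r0 rP] : nbhs p D by exact: open_nbhs_nbhs.
have [d1 d10 d1P] := small_shift p r0.
pose s := Num.min de d1; have s0 : 0 < s by rewrite lt_min de0.
have sde : s <= de by rewrite ge_min lexx.
have Dps : D (p + s *: v).
  apply: rP; rewrite -ball_normE /= opprD addNKr normrN; apply: d1P.
  by rewrite gtr0_norm // ge_min lexx orbT.
have Qc : {for p, continuous (fun q => (F (q + s *: v) - F q) / s)}.
  apply: cvgMl; apply: cvgB; last exact: Fc.
  apply: (@continuous_comp _ _ _ (fun q => q + s *: v) F); last exact: Fc.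
  by apply: cvgD; [exact: cvg_id|exact: cvg_cst].
have := Qc => /(@cvgrPdist_le _ _ _ (nbhs p))/(_ _ e30)/nbhs_ballP[r1 /= r10 r1P].
apply/nbhs_ballP; exists (Num.min r1 rho) => [|q]; first by rewrite /= lt_min r10.
rewrite -ball_normE /= lt_min => /andP[q1 q2].
have h1 := r1P q; rewrite -ball_normE /= in h1; have {}h1 := h1 q1.
have h2 := forward_quotient s0 (deP q _ s s0 sde); rewrite distrC in h2; have {}h2 := h2 (ltW q2).
have h3 := forward_quotient s0 (deP p _ s s0 sde); rewrite subrr normr0 in h3; have {}h3 := h3 (ltW rho0).
move: h1 h2 h3; set A := _ / s; set B := _ / s => h1 h2 h3.
have -> : g p - g q = (A - B) - (A - g p) + (B - g q) by ring.
apply: le_trans (ler_normD _ _) _; apply: le_trans (lerD (ler_normB _ _) (lexx _)) _; lra.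
Qed.

(** For negative increments the forward estimate is used at the base point [p + s *: v], and
    continuity of [g] brings its value back to [p]. *)
Lemma uniform_difference_derive p : D p -> is_derive p v F (g p).
Proof.
move=> Dp; have gc := uniform_difference_continuous Dp.
suff : (fun s : R => s^-1 *: ((F \o shift p) (s *: v) - F p)) @ 0^' --> g p.
  by move=> lim; split; [exact: cvgP lim|exact: cvg_lim lim].
apply/cvgrPdist_le => eps eps0.
have [rho rho0 rhoP] := H Dp.
have e20 : 0 < eps / 2 by rewrite divr_gt0.
have [de de0 deP] := rhoP _ e20.
have := gc => /(@cvgrPdist_le _ _ _ (nbhs p))/(_ _ e20)/nbhs_ballP[r1 /= r10 r1P].
have m0 : 0 < Num.min r1 rho by rewrite lt_min r10.
have [d1 d10 d1P] := small_shift p m0.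
apply/nbhs_ballP; exists (Num.min de d1) => [|s]; first by rewrite /= lt_min de0.
rewrite -ball_normE /= sub0r normrN lt_min => /andP[s1 s2] sn0.
have := d1P s (ltW s2); rewrite lt_min => /andP[t1 t2].
rewrite /GRing.scale /= [s *: v + p]addrC mulrC distrC.
case: (ltgtP s 0) sn0 => // [sneg|spos] _.
  have := deP (p + s *: v) _ (- s); rewrite addrAC subrr add0r scaleNr addrK => /(_ (ltW t2)).
  rewrite oppr_gt0 => /(_ sneg); rewrite ltr0_norm // in s1 => /(_ (ltW s1)) h1.
  have h2 := r1P (p + s *: v); rewrite -ball_normE /= opprD addNKr normrN in h2; have {}h2 := h2 t1.
  move: h1 h2; move: (F _) (F p) (g p) (g _) => A B C E h1 h2.
  have -> : (A - B) / s - C = (B - A - - s * E) / (- s) - (C - E) by field; rewrite lt_eqF.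
  apply: le_trans (ler_normB _ _) _.
  have : `|(B - A - - s * E) / - s| <= eps / 2.
    have ns : 0 < - s by rewrite oppr_gt0.
    by rewrite normrM normfV (gtr0_norm ns) ler_pdivrMr.
  by lra.
rewrite gtr0_norm // in s1.
have := deP p _ s spos (ltW s1); rewrite subrr normr0 => /(_ (ltW rho0)) h1.
by apply: le_trans (forward_quotient spos h1) _; lra.
Qed.

End UniformDifferences.

(** * Descent time of the Euler scheme *)

Section Clock.
Variables (R : realType) (G : R -> R).
Hypothesis Glip : loc_lip0 G.

(** [G] is controlled on nonnegative arguments only; keeping it constant below [c] yields a
    continuous function on the line, as integration and the extreme value theorem require. *)
Lemma clip_continuous (c : R) : 0 <= c -> continuous (fun u => G (Num.max u c)).
Proof.
move=> c0 u; apply/(@cvgrPdist_le _ _ _ (nbhs u)) => eps eps0.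
have [C CP] := Glip (Num.max (u + 1) c).
have C1 : 0 < `|C| + 1 by rewrite ltr_wpDl.
have : 0 < Num.min 1 (eps / (`|C| + 1)) by rewrite lt_min ltr01 divr_gt0.
set de := Num.min _ _ => de0; apply/nbhs_ballP; exists de => // v; rewrite -ball_normE /= => uv.
have [d1 d2] : de <= 1 /\ de <= eps / (`|C| + 1) by rewrite /de !ge_min !lexx orbT.
move: uv; rewrite ltr_norml => /andP[uv1 uv2].
have mm x y : x <= y -> Num.max x c <= Num.max y c by move=> xy; rewrite ge_max !le_max xy lexx orbT.
have g0 x : 0 <= Num.max x c by rewrite le_max c0 orbT.
apply: le_trans (CP _ _ _ _) _.
- by rewrite g0 mm // lerDl.
- by rewrite g0 mm //; lra.
apply: le_trans (ler_wpM2r _ (ler_norm C)) _ => //.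
have M1 : `|Num.max u c - Num.max v c| <= de.
  apply: le_trans (_ : `|u - v| <= _); last by rewrite ler_norml; lra.
  by rewrite /Num.max; case: ltP => ?; case: ltP => ?; rewrite ler_norml; have := ler_norm (u - v); have := ler_norm (- (u - v)); rewrite normrN; lra.
apply: le_trans (ler_wpM2l _ M1) _ => //.
have : (`|C| + 1) * de <= eps by rewrite mulrC -ler_pdivlMr.
by lra.
Qed.

Variables (A c : R).
Hypotheses (A0 : 0 <= A) (Aneg : forall u, A <= u -> G u < 0).
Hypothesis Aint : (\int[lebesgue_measure]_(u in `[A, +oo[) ((- G u)^-1)%:E < +oo)%E.
Hypotheses (c0 : 0 <= c) (cneg : forall u, c <= u -> G u < 0).

Let g (d u : R) := (- G (Num.max u d))^-1.

Lemma g_measurable d : 0 <= d -> (forall u, d <= u -> G u < 0) ->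
  forall D : set R, measurable_fun D (fun u => (g d u)%:E).
Proof.
move=> d0 dneg D; apply: measurable_funTS; apply/measurable_EFinP.
apply: continuous_measurable_fun => u.
have H : G (Num.max u d) < 0 by apply: dneg; rewrite le_max lexx orbT.
apply: cvgV; first by rewrite oppr_eq0 lt_eqF.
by apply: cvgN; exact: (clip_continuous d0).
Qed.

Lemma g_ge0 d u : (forall u, d <= u -> G u < 0) -> 0 <= g d u.
Proof. by move=> dn; rewrite invr_ge0 oppr_ge0 ltW // dn // le_max lexx orbT. Qed.

(** For [y >= c], the time in which the flow of [y' = G(y)] comes down from infinity to [y]. *)
Let J (y : R) := (\int[lebesgue_measure]_(u in `[y, +oo[) (g c u)%:E)%E.

Lemma J_split (y' y : R) : y' <= y -> (J y' = \int[lebesgue_measure]_(u in `[y', y[) (g c u)%:E + J y)%E.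
Proof.
move=> yy; rewrite /J (@itv_bndbnd_setU _ _ (BLeft y') (BLeft y) +oo%O) ?bnd_simp //.
rewrite ge0_integral_setU //=; first exact: g_measurable.
  by move=> x _; rewrite lee_fin g_ge0.
by apply/disj_setPS => x /= []; rewrite !in_itv /= andbT => /andP[_ x1] x2; move: (lt_le_trans x1 x2); rewrite ltxx.
Qed.

Lemma J_fin : (J c < +oo)%E.
Proof.
pose B := Num.max A c.
have cB : c <= B by rewrite /B le_max lexx orbT.
have AB : A <= B by rewrite /B le_max lexx.
rewrite (J_split cB).
have -> : J B = (\int[lebesgue_measure]_(u in `[B, +oo[) (g A u)%:E)%E.
  apply: eq_integral => u; rewrite inE /= in_itv /= andbT => Bu; rewrite /g !max_l //; first exact: le_trans Bu.
  exact: le_trans Bu.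
apply: lte_add_pinfty; last first.
  apply: le_lt_trans Aint.
  have -> : (\int[lebesgue_measure]_(u in `[A, +oo[) (- G u)^-1%:E = \int[lebesgue_measure]_(u in `[A, +oo[) (g A u)%:E)%E.
    by apply: eq_integral => u; rewrite inE /= in_itv /= andbT => Bu; rewrite /g max_l.
  apply: ge0_subset_integral => //=; first exact: g_measurable.
    by move=> x _; rewrite lee_fin g_ge0.
  by move=> x /=; rewrite !in_itv /= !andbT; exact: le_trans.
have [|d _ dmax] := @EVT_max R (g c) c B cB.
  apply: continuous_subspaceT => u.
  have H : G (Num.max u c) < 0 by apply: cneg; rewrite le_max lexx orbT.
  apply: cvgV; first by rewrite oppr_eq0 lt_eqF.
  by apply: cvgN; exact: (clip_continuous c0).
apply: (@le_lt_trans _ _ (\int[lebesgue_measure]_(u in `[c, B[) (cst (g c d)%:E u))%E).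
  apply: ge0_le_integral => //=.
  - by move=> x _; rewrite lee_fin g_ge0.
  - exact: g_measurable.
  - move=> x; rewrite in_itv /= => /andP[x1 x2]; rewrite lee_fin; apply: dmax.
    by rewrite in_itv /= x1 ltW.
rewrite integral_cst //= lebesgue_measure_itv /= lte_fin; case: ifP => _; first by rewrite -EFinB -EFinM ltry.
by rewrite mule0 ltry.
Qed.

Lemma integral_clock : exists (j : R -> R) (T : R), [/\ 0 <= T, forall y, c <= y -> 0 <= j y <= T &
  forall y' y ka : R, c <= y' -> y' <= y -> 0 < ka -> (forall u, y' <= u -> u <= y -> - G u <= ka) ->
    (y - y') / ka <= j y' - j y].
Proof.
have J0 y : (0 <= J y)%E by apply: integral_ge0 => u _; rewrite lee_fin g_ge0.
have Jle y' y : y' <= y -> (J y <= J y')%E.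
  move=> yy; rewrite (J_split yy) leeDr //; apply: integral_ge0 => u _; by rewrite lee_fin g_ge0.
have Jf y : c <= y -> J y \is a fin_num.
  by move=> cy; rewrite ge0_fin_numE //; apply: le_lt_trans (Jle _ _ cy) J_fin.
exists (fun y => fine (J y)), (fine (J c)); split; first exact: fine_ge0.
  by move=> y cy; rewrite fine_ge0 //= fine_le ?Jf // Jle.
move=> y' y ka cy' yy ka0 H.
have Jy' := Jf _ cy'; have Jy := Jf _ (le_trans cy' yy).
rewrite lerBrDr -lee_fin EFinD (fineK Jy') (fineK Jy) (J_split yy); apply: leeD2r.
have -> : ((y - y') / ka)%:E = (\int[lebesgue_measure]_(u in `[y', y[) (cst (ka^-1)%:E u))%E.
  rewrite integral_cst //= lebesgue_measure_itv /= lte_fin; move: yy; rewrite le_eqVlt => /predU1P[->|yy].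
    by rewrite ltxx subrr mul0r mule0.
  by rewrite yy -EFinB -EFinM mulrC.
apply: ge0_le_integral => //=.
- by move=> x _; rewrite lee_fin invr_ge0 ltW.
- exact: g_measurable.
- move=> x; rewrite in_itv /= => /andP[x1 x2]; rewrite lee_fin /g max_l ?(le_trans cy') //.
  have := cneg (le_trans cy' x1) => Gn.
  by rewrite lef_pV2 ?posrE ?oppr_gt0 //; apply: H => //; exact: ltW.
Qed.

Lemma negative_gap (B : R) : exists2 de, 0 < de & forall u, c <= u -> u <= B -> G u <= - de.
Proof.
case: (leP c B) => cB; last by exists 1 => // u u1 u2; have := lt_le_trans cB (le_trans u1 u2); rewrite ltxx.
have [|d dI dmax] := @EVT_max R (fun u => G (Num.max u c)) c B cB.
  by apply: continuous_subspaceT; exact: clip_continuous.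
exists (- G (Num.max d c)); first by rewrite oppr_gt0 cneg // le_max lexx orbT.
by move=> u u1 u2; rewrite opprK; have := dmax u; rewrite in_itv /= u1 u2 (max_l u1); exact.
Qed.

(* The explicit Euler scheme for [y' = G(y) / 2], stopped at [c]. *)
Fixpoint euler (tau B : R) (k : nat) : R :=
  if k is k'.+1 then Num.max c (euler tau B k' + tau / 2 * G (euler tau B k')) else B.

Lemma euler_ge tau B k : c <= B -> c <= euler tau B k.
Proof. by case: k => //= k _; rewrite le_max lexx. Qed.

Lemma euler_le tau B k : c <= B -> 0 <= tau -> euler tau B k <= B.
Proof.
move=> cB tau0; elim: k => //= k IH; rewrite ge_max cB /=.
apply: le_trans IH; rewrite gerDl mulr_ge0_le0 ?divr_ge0 // ltW // cneg //; exact: euler_ge.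
Qed.

(** Each step above [c] advances the clock by at least [tau / 4]: the descent is
    [tau / 2 * (- G y)], and by [tau * C <= 2] the speed at most doubles on the way. As the clock
    never exceeds its bound, the scheme rests at [c] after four times that bound, whatever the
    starting height [B]. *)
Lemma euler_decay : exists2 T, 0 <= T & forall (B tau C : R) k, c <= B -> 0 < tau ->
  (forall u v, 0 <= u <= B -> 0 <= v <= B -> `|G u - G v| <= C * `|u - v|) ->
  tau * C <= 2 -> T < k%:R * tau -> euler tau B k = c.
Proof.
have [j [T [T0 jb jP]]] := integral_clock.
exists (4 * T); first by rewrite mulr_ge0.
move=> B tau C k cB tau0 GL tC kT.
suff : euler tau B k = c \/ k%:R * tau / 4 <= j (euler tau B k).
  case=> // H; have := jb _ (euler_ge tau k cB); lra.
elim: k {kT} => [|k]; first by right; rewrite !mul0r; have /andP[] := jb _ cB.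
rewrite /=; set y := euler tau B k; set y' := y + _.
have cy : c <= y by exact: euler_ge.
have yB : y <= B by apply: euler_le => //; exact: ltW.
have Gy := cneg cy.
have y'y : y' <= y by rewrite /y' gerDl mulr_ge0_le0 // ?divr_ge0 ?ltW.
case=> [yc|H]; first by left; rewrite max_l // -yc.
case: (leP y' c) => y'c; first by left.
right; have ka0 : 0 < 2 * (- G y) by rewrite mulr_gt0 // oppr_gt0.
have := jP y' y _ (ltW y'c) y'y ka0; set Z := (y - y') / _.
have -> : Z = tau / 4 by rewrite /Z /y'; field; rewrite lt_eqF.
have H2 u : y' <= u -> u <= y -> - G u <= 2 * (- G y).
  move=> u1 u2; have := GL u y; rewrite ler_norml => /(_ _ _)/andP[||h1 _].
  - by rewrite (le_trans _ (le_trans (ltW y'c) u1)) // (le_trans u2).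
  - by rewrite yB (le_trans c0).
  have : C * `|u - y| <= - G y.
    have h3 : `|u - y| <= tau / 2 * (- G y) by rewrite distrC ger0_norm ?subr_ge0 //; move: u1; rewrite /y'; lra.
    case: (leP C 0) => C0; first by apply: le_trans (_ : 0 <= _); [exact: mulr_le0_ge0|rewrite oppr_ge0 ltW].
    apply: le_trans (ler_wpM2l (ltW C0) h3) _.
    have : tau * C * (- G y) <= 2 * (- G y) by rewrite ler_pM2r // oppr_gt0.
    by lra.
  by lra.
move=> /(_ H2); rewrite -[k.+1%:R]natr1; move: H; lra.
Qed.

End Clock.

Lemma nat_above (R : realType) (x : R) : exists N : nat, x <= N%:R.
Proof.
exists (Num.Def.archi_bound `|x|); apply: le_trans (ler_norm x) _.
by apply/ltW/archi_boundP.
Qed.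

(** * Classical regularity of the limit of the schemes *)

Section SchemeLimit.
Variables (R : realType) (n : nat) (al : R).
Hypotheses (al0 : 0 < al) (al1 : al < 1).
Local Notation V := 'rV[R]_n.
Local Notation dir := (seq ('I_n * bool) * (V -> R))%type.
Variables (a : 'I_n -> 'I_n -> V -> R) (b bp bm : 'I_n -> V -> R) (Hf : V -> R -> R).
Hypotheses (ac : forall i j, continuous (a i j)) (bc : forall i, continuous (b i)).
Hypothesis bpm : forall i x, bp i x - bm i x = b i x.
Hypothesis Hlip : forall r M : R, 0 <= M -> exists2 C, 0 <= C & forall x y z z', `|x| <= r -> `|y| <= r ->
  - M <= z -> - M <= z' -> `|Hf x z - Hf y z'| <= C * (`|x - y| + `|z - z'|).
Variables (hh tt : nat -> R) (UU : nat -> nat -> V -> R).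
Hypotheses (hh0 : forall m, 0 < hh m) (hhm : forall m, hh m <= m.+1%:R^-1).
Hypotheses (tt0 : forall m, 0 < tt m) (tth : forall m, tt m <= hh m).
Hypothesis UU0 : forall m k x, 0 <= UU m k x.

Local Notation E m i := (hh m *: evec R i).
Local Notation X m x := (rd (hh m) x).
Local Notation kk m t := (Num.trunc (t / tt m)).

Hypothesis local_scheme : forall x0 : V, exists (ds : seq dir) (Bm : R) (S0 N : nat), [/\ 0 <= Bm, (1 <= S0)%N,
  forall d, d \in ds -> (size d.1 <= S0)%N & forall x, `|x - x0| <= 1 ->
  [/\ forall d, d \in ds -> `|d.2 x| <= Bm, forall i, `|bp i x| <= Bm, forall i, `|bm i x| <= Bm,
      forall i j, \sum_(d <- ds) d.2 x * (vec R d.1 0 i * vec R d.1 0 j) = sa a i j x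
    & forall m k, (N <= m)%N ->
      UU m k.+1 x = UU m k x + tt m * (Lh bp bm (hh m) ds (UU m k) x + Hf x (UU m k x)) /\
      (k%:R * tt m <= m%:R -> UU m k x <= Bm)]].

Hypothesis local_est : forall (x0 : V) (t0 : R), 0 < t0 -> exists rho K (N : nat), [/\ 0 < rho, 0 <= K &
  forall m, (N <= m)%N -> forall k x, `|x - x0| <= rho -> `|k%:R * tt m - t0| <= rho ->
  [/\ forall i, `|df (E m i) (UU m k) x| <= hh m * K,
      forall i j, `|df (E m i) (df (E m j) (UU m k)) x| <= hh m ^+ 2 * K
    & forall i j l d, (0 < d)%N -> d%:R * hh m <= rho ->
       `|df (d%:R *: E m l) (df (E m i) (df (E m j) (UU m k))) x| <= hh m ^+ 2 * (K * (d%:R * hh m) `^ al)]].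

Variable F : set_system nat.
Hypotheses (FU : UltraFilter F) (Foo : \oo `<=` F).
Let FP : ProperFilter F := @ultra_proper _ _ FU.
Ltac prune7 := clear - al0 al1 ac bc bpm Hlip hh0 hhm tt0 tth UU0 local_scheme local_est FU Foo FP.

Lemma norm_quot_le (c d e : R) : 0 < d -> `|c| <= d * e -> `|c / d| <= e.
Proof. by move=> d0 H; rewrite normrM normfV (gtr0_norm d0) ler_pdivrMr // [e * d]mulrC. Qed.

Lemma mesh_small (e : R) : 0 < e -> exists N : nat, forall m, (N <= m)%N -> hh m <= e.
Proof.
move=> e0; have [N NP] := nat_above e^-1; exists N => m Nm.
apply: le_trans (hhm m) _; rewrite -[e]invrK lef_pV2 ?posrE ?invr_gt0 ?ltr0n //.
by apply: le_trans NP _; rewrite ler_nat leqW.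
Qed.

Definition inc m k x := (UU m k.+1 x - UU m k x) / tt m.

Lemma inc_step m k x : UU m k.+1 x = UU m k x + tt m * inc m k x.
Proof. by rewrite /inc; field; rewrite gt_eqF. Qed.

Lemma node_near m (x x0 : V) (r : R) : `|x - x0| <= r -> `|X m x - x0| <= r + hh m.
Proof.
move=> xr; have -> : X m x - x0 = (x - x0) + (X m x - x) by vring.
by apply: le_trans (ler_normD _ _) (lerD xr (rd_near _ (hh0 m))).
Qed.

Lemma time_near m t t0 (r : R) : 0 <= t -> `|t - t0| <= r -> `|(kk m t)%:R * tt m - t0| <= r + hh m.
Proof.
move=> tp tr; have -> : (kk m t)%:R * tt m - t0 = (t - t0) + ((kk m t)%:R * tt m - t) by ring.
apply: le_trans (ler_normD _ _) (lerD tr _); apply: le_trans (trunc_near (tt0 m) tp) (tth m).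
Qed.

(** One cylinder on which all estimates hold, including the bound on the time quotient [inc]
    obtained from the scheme; the margin [8 * hh m <= rho] absorbs the rounding to nodes. *)
Lemma package (x0 : V) (t0 : R) : 0 < t0 -> exists rho K (N : nat),
  [/\ 0 < rho, rho <= 1, 2 * rho <= t0, 0 <= K & forall m, (N <= m)%N -> 8 * hh m <= rho /\
  forall k x, `|x - x0| <= rho -> `|k%:R * tt m - t0| <= rho ->
  [/\ forall i, `|df (E m i) (UU m k) x| <= hh m * K,
      forall i j, `|df (E m i) (df (E m j) (UU m k)) x| <= hh m ^+ 2 * K,
      forall i j l d, (0 < d)%N -> d%:R * hh m <= rho ->
       `|df (d%:R *: E m l) (df (E m i) (df (E m j) (UU m k))) x| <= hh m ^+ 2 * (K * (d%:R * hh m) `^ al),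
      `|inc m k x| <= K & `|UU m k x| <= K]].
Proof.
move=> t00; have [r1 [K1 [N1 [r10 K10 H1]]]] := local_est x0 t00.
have [ds [Bm [S0 [N2 [Bm0 S01 dsS H2]]]]] := local_scheme x0.
have [C C0 CP] := @Hlip (`|x0| + 1) 0 (lexx _).
pose rho := Num.min (r1 / 2) (Num.min 1 (t0 / 2)).
have rho0 : 0 < rho by rewrite !lt_min ltr01 !divr_gt0.
have [rho1 rho2 rho3] : [/\ 2 * rho <= r1, rho <= 1 & 2 * rho <= t0].
  split; last 2 [by rewrite !ge_min lexx !orbT].
  - by rewrite mulrC -ler_pdivlMr // !ge_min lexx.
  - by rewrite mulrC -ler_pdivlMr // !ge_min lexx !orbT.
clearbody rho.
pose LC := (size ds)%:R * (Bm * S0%:R ^+ 2) + n%:R * (2 * Bm).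
have LC0 : 0 <= LC by apply: addr_ge0; apply: mulr_ge0 => //; apply: mulr_ge0 => //; exact: sqr_ge0.
have [N3 N3P] : exists N : nat, forall m, (N <= m)%N -> hh m <= rho / (8 * S0%:R).
  by apply: mesh_small; rewrite divr_gt0 // mulr_gt0 // ltr0n.
have [N4 N4P] := nat_above (t0 + 1).
have [K2 K20 K2P] : exists2 K2, 0 <= K2 & forall x (u : R), `|x - x0| <= 1 -> 0 <= u -> u <= Bm -> `|Hf x u| <= K2.
  exists (`|Hf x0 0| + C * (1 + Bm)); first by rewrite addr_ge0 // mulr_ge0 // addr_ge0.
  move=> x u xx u0 uB; have -> : Hf x u = Hf x0 0 + (Hf x u - Hf x0 0) by ring.
  apply: le_trans (ler_normD _ _) _; rewrite lerD2l; apply: le_trans (CP x x0 u 0 _ _ _ _) _.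
  - have -> : x = (x - x0) + x0 by rewrite subrK.
    by apply: le_trans (ler_normD _ _) _; lra.
  - lra.
  - by rewrite oppr0.
  - by rewrite oppr0.
  by apply: ler_wpM2l => //; apply: lerD => //; rewrite subr0 ger0_norm.
pose K := K1 + Bm + (LC * K1 + K2).
have LK : 0 <= LC * K1 by exact: mulr_ge0.
exists rho, K, (maxn (maxn N1 N2) (maxn N3 N4)); split => //.
  by move: K10 Bm0 LK K20; rewrite /K; prune7; lra.
move=> m; rewrite !geq_max => /andP[/andP[m1 m2] /andP[m3 m4]].
have h0 := hh0 m.
have hS : 8 * (hh m * S0%:R) <= rho.
  have : 0 < 8 * S0%:R :> R by rewrite mulr_gt0 // ltr0n.
  by move=> p; have := N3P m m3; rewrite ler_pdivlMr //; lra.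
have S1 : 1 <= S0%:R :> R by rewrite ler1n.
have hS' : hh m <= hh m * S0%:R by rewrite ler_peMr // ltW.
split; first by lra.
move=> k x xx kt.
have km : k%:R * tt m <= m%:R.
  move: kt; rewrite ler_norml => /andP[_ q]; have : N4%:R <= m%:R :> R by [rewrite ler_nat]; lra.
have [a1 a2 a3 _ a5] := H2 x (le_trans xx rho2).
have [e1 /(_ km) e2] := a5 m k m2.
have near_x y : `|y - x| <= 3 * (hh m * S0%:R) -> `|y - x0| <= r1.
  move=> yx; have -> : y - x0 = (y - x) + (x - x0) by rewrite addrA subrK.
  by apply: le_trans (ler_normD _ _) _; lra.
have kt1 : `|k%:R * tt m - t0| <= r1 by lra.
have xr1 : `|x - x0| <= r1 by lra.
have [b1 b2 b3] := H1 m m1 k x xr1 kt1.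
have KK : K1 <= K by move: K10 Bm0 LK K20; rewrite /K; prune7; lra.
have BK : Bm <= K by move: K10 Bm0 LK K20; rewrite /K; prune7; lra.
split.
- by move=> i; apply: le_trans (b1 i) _; rewrite ler_wpM2l // ltW.
- by move=> i j; apply: le_trans (b2 i j) _; rewrite ler_wpM2l // sqr_ge0.
- move=> i j l d d0 dr; apply: le_trans (b3 i j l d d0 _) _; first by lra.
  by rewrite ler_wpM2l ?sqr_ge0 // ler_wpM2r ?powR_ge0.
- have -> : inc m k x = Lh bp bm (hh m) ds (UU m k) x + Hf x (UU m k x).
    by rewrite /inc e1 addrC addKr mulrC mulKf ?gt_eqF.
  have := @Lh_approx R n bp bm (hh m) ds (UU m k) x (fun=> 0) (fun _ _ => 0) K1 Bm S0 h0 K10 S01 Bm0.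
  rewrite !big1 ?addr0 ?subr0 -/LC; last first.
  + by move=> d _; rewrite big1 ?mulr0 // => i _; rewrite big1 // => j _; rewrite mulr0.
  + by move=> i _; rewrite mulr0.
  move=> HL; apply: le_trans (ler_normD _ _) _.
  have h1 : `|Lh bp bm (hh m) ds (UU m k) x| <= LC * K1.
    apply: HL => //.
    - by move=> y i j /near_x yr; rewrite mulr0 subr0; have [_ q _] := H1 m m1 k y yr kt1.
    - move=> y i yx; rewrite mulr0 subr0; have yr : `|y - x| <= 3 * (hh m * S0%:R) by lra.
      by have [q _ _] := H1 m m1 k y (near_x y yr) kt1.
  have h2 := K2P x (UU m k x) (le_trans xx rho2) (UU0 m k x) e2.
  by move: h1 h2 K10 Bm0; rewrite /K; prune7; lra.
- by rewrite ger0_norm // (le_trans e2).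
Qed.

(** [zlim], [plim] and [qlim] are limits of the sampled scheme and of its difference quotients; only
    later are the last two identified as derivatives of the first. *)
Definition zlim (p : V * R) := ulim F (fun m => UU m (kk m p.2) (X m p.1)).
Definition plim i (p : V * R) := ulim F (fun m => df (E m i) (UU m (kk m p.2)) (X m p.1) / hh m).
Definition qlim i j (p : V * R) :=
  ulim F (fun m => df (E m i) (df (E m j) (UU m (kk m p.2))) (X m p.1) / hh m ^+ 2).

Lemma limits_cvg (p : V * R) : 0 < p.2 -> [/\ (fun m => UU m (kk m p.2) (X m p.1)) @ F --> zlim p,
  forall i, (fun m => df (E m i) (UU m (kk m p.2)) (X m p.1) / hh m) @ F --> plim i p &
  forall i j, (fun m => df (E m i) (df (E m j) (UU m (kk m p.2))) (X m p.1) / hh m ^+ 2) @ F --> qlim i j p].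
Proof.
move=> p0; have [rho [K [N [r0 r1 r2 K0 H]]]] := package p.1 p0.
have H' m : (N <= m)%N -> `|X m p.1 - p.1| <= rho /\ `|(kk m p.2)%:R * tt m - p.2| <= rho.
  move=> /H[h8 _]; have h0 := hh0 m; split.
    by have := @node_near m p.1 p.1 0; rewrite subrr normr0 => /(_ (lexx _)); lra.
  by have := @time_near m p.2 p.2 0 (ltW p0); rewrite subrr normr0 => /(_ (lexx _)); lra.
split.
- apply: (ulim_cvg FU Foo (B := K) (N := N)) => m Nm; have [q1 q2] := H' m Nm.
  by have [_ /(_ _ _ q1 q2)[]] := H m Nm.
- move=> i; apply: (ulim_cvg FU Foo (B := K) (N := N)) => m Nm; have [q1 q2] := H' m Nm.
  have [_ /(_ _ _ q1 q2)[q _ _ _ _]] := H m Nm.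
  exact: norm_quot_le.
- move=> i j; apply: (ulim_cvg FU Foo (B := K) (N := N)) => m Nm; have [q1 q2] := H' m Nm.
  have [_ /(_ _ _ q1 q2)[_ q _ _ _]] := H m Nm.
  have h20 : 0 < hh m ^+ 2 by rewrite exprn_gt0.
  exact: norm_quot_le.
Qed.

Lemma qlim_sym i j p : qlim i j p = qlim j i p.
Proof. by rewrite /qlim; congr (ulim F _); apply/funext => m; rewrite dfC. Qed.

Lemma near_pair (p p0 : V * R) (r : R) : `|p - p0| <= r -> `|p.1 - p0.1| <= r /\ `|p.2 - p0.2| <= r.
Proof. by rewrite prod_normE ge_max => /andP[]. Qed.

Lemma df_scale (c : V) (w : V -> R) (k : R) x : df c (fun y => w y / k) x = df c w x / k.
Proof. by rewrite /df mulrBl. Qed.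

Lemma move_norm (x x0 v : V) (r s : R) : `|x - x0| <= r -> `|v| <= s -> `|x + v - x0| <= r + s.
Proof. by move=> xr vs; rewrite addrAC; apply: le_trans (ler_normD _ _) (lerD xr vs). Qed.

Lemma norm_steps m (i : 'I_n) (d : nat) : `|d%:R *: E m i| <= d%:R * hh m.
Proof. by rewrite normrZ ger0_norm // ler_wpM2l // norm_scale_evec // ltW. Qed.

Lemma shift_space (p : V * R) (s : R) (i : 'I_n) : p + s *: ((evec R i, 0) : V * R) = (p.1 + s *: evec R i, p.2).
Proof. by case: p => x t; congr pair; rewrite /= scaler0 addr0. Qed.

Lemma shift_time (p : V * R) (s : R) : p + s *: ((0, 1) : V * R) = (p.1, p.2 + s).
Proof. by case: p => x t; congr pair; rewrite /= ?scaler0 ?addr0 // /GRing.scale /= mulr1. Qed.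

(** The quadratic error comes from the bound on second differences, and the terms due to the mesh
    vanish in the limit. *)
Lemma space_first (p0 : V * R) : 0 < p0.2 -> exists2 rho, 0 < rho & exists2 K, 0 <= K & forall p, `|p - p0| <= rho ->
  forall i s, 0 < s -> s <= rho -> `|zlim (p + s *: (evec R i, 0)) - zlim p - s * plim i p| <= K * s * s.
Proof.
move=> t00; have [rho [K [N [r0 r1 r2 K0 H]]]] := package p0.1 t00.
exists (rho / 4); first by rewrite divr_gt0.
exists K => // p /near_pair[px pt] i s s0 sr.
have pt0 : 0 < p.2 by move: pt; rewrite ler_norml => /andP[+ _]; move: r0 r2; prune7; lra.
have [zc pc _] := limits_cvg pt0.
rewrite shift_space.
have [zc' _ _] := @limits_cvg (p.1 + s *: evec R i, p.2) pt0.
apply: (ulim_taylor FU Foo zc' zc (pc i)) => d d0.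
have [N1 N1P] : exists N : nat, forall m, (N <= m)%N -> hh m <= d / (4 * (K + 1)).
  by apply: mesh_small; rewrite divr_gt0 // mulr_gt0 // ltr_wpDl.
exists (maxn N N1) => m; rewrite geq_max => /andP[Nm N1m].
have [h8 Hm] := H m Nm; have h0 := hh0 m.
have hd : hh m * (4 * (K + 1)) <= d by rewrite -ler_pdivlMr ?mulr_gt0 ?N1P // ltr_wpDl.
have [dd ddE dds] := rd_shift p.1 i h0 (ltW s0).
rewrite /= ddE; set k := kk m p.2; set x := X m p.1.
have xx : `|x - p0.1| <= rho / 4 + hh m by exact: node_near.
have kt : `|k%:R * tt m - p0.2| <= rho by apply: le_trans (time_near m (ltW pt0) pt) _; move: h8 r0; prune7; lra.
have ddh : dd%:R * hh m <= s + hh m by move: dds; rewrite ler_norml => /andP[_]; prune7; lra.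
have G (j : nat) : (j <= dd)%N -> `|x + j%:R *: E m i - p0.1| <= rho.
  move=> jd; apply: le_trans (move_norm xx (norm_steps m i j)) _.
  have : j%:R * hh m <= dd%:R * hh m by rewrite ler_wpM2r ?(ltW h0) // ler_nat.
  by move: ddh sr h8 r0; prune7; lra.
have GT := @grid_taylor R n dd (E m i) (hh m) s _ ((s + hh m) * K) (UU m k) x h0 _ erefl.
have {}GT := GT _ _ dds.
apply: le_trans (GT _ _) _.
- by rewrite mulr_ge0 // addr_ge0 // ltW.
- move=> j j0 jd; have := @df_multi0 R n j (E m i) (df (E m i) (UU m k)) (hh m ^+ 2 * K) x.
  move=> M; apply: le_trans (M _) _.
    move=> l lj; have [_ q _ _ _] := Hm k _ (G l (ltnW (ltn_trans lj jd))) kt; exact: q.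
  have -> : j%:R * (hh m ^+ 2 * K) = hh m * (j%:R * hh m * K) by ring.
  rewrite ler_wpM2l ?(ltW h0) // ler_wpM2r //; apply: le_trans ddh; rewrite ler_wpM2r ?(ltW h0) // ler_nat ltnW //.
have xr : `|x - p0.1| <= rho by move: xx h8 r0 h0; prune7; lra.
have [q1 _ _ _ _] := Hm k x xr kt.
have qq : `|df (E m i) (UU m k) x / hh m| <= K by exact: norm_quot_le.
have w1 : hh m * `|df (E m i) (UU m k) x / hh m| <= hh m * K by rewrite ler_wpM2l // ltW.
have w2 : dd%:R * hh m * ((s + hh m) * K) <= (s + hh m) * ((s + hh m) * K).
  by rewrite ler_wpM2r // mulr_ge0 // addr_ge0 // ltW.
have w3 : (s + hh m) * ((s + hh m) * K) = K * s * s + hh m * (K * (2 * s + hh m)) by ring.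
have w4 : hh m * (K * (2 * s + hh m)) <= hh m * (K * 1).
  by rewrite ler_wpM2l ?(ltW h0) // ler_wpM2l //; move: sr h8 r1 r0; prune7; lra.
have w5 : 0 <= hh m * K by rewrite mulr_ge0 // ltW.
by move: w1 w2 w3 w4 w5 hd h0; prune7; lra.
Qed.

(** Hölder continuity of the second quotients replaces a third derivative: the error is still
    [o(s)], locally uniformly. *)
Lemma space_second (p0 : V * R) : 0 < p0.2 -> exists2 rho, 0 < rho & exists2 K, 0 <= K & forall p, `|p - p0| <= rho ->
  forall i j s, 0 < s -> s <= rho ->
  `|plim j (p + s *: (evec R i, 0)) - plim j p - s * qlim i j p| <= K * (2 * s) `^ al * s.
Proof.
move=> t00; have [rho [K [N [r0 r1 r2 K0 H]]]] := package p0.1 t00.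
exists (rho / 4); first by rewrite divr_gt0.
exists K => // p /near_pair[px pt] i j s s0 sr.
have pt0 : 0 < p.2 by move: pt; rewrite ler_norml => /andP[+ _]; move: r0 r2; prune7; lra.
have [_ pc qc] := limits_cvg pt0.
rewrite shift_space.
have [_ pc' _] := @limits_cvg (p.1 + s *: evec R i, p.2) pt0.
apply: (ulim_taylor FU Foo (pc' j) (pc j) (qc i j)) => d d0.
have [N1 N1P] : exists N : nat, forall m, (N <= m)%N -> hh m <= d / (4 * (K + 1)).
  by apply: mesh_small; rewrite divr_gt0 // mulr_gt0 // ltr_wpDl.
have [N2 N2P] := mesh_small s0.
exists (maxn N (maxn N1 N2)) => m; rewrite !geq_max => /and3P[Nm N1m N2m].
have [h8 Hm] := H m Nm; have h0 := hh0 m.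
have hs := N2P m N2m.
have hd : hh m * (4 * (K + 1)) <= d by rewrite -ler_pdivlMr ?mulr_gt0 ?N1P // ltr_wpDl.
have [dd ddE dds] := rd_shift p.1 i h0 (ltW s0).
rewrite /= ddE; set k := kk m p.2; set x := X m p.1.
have xx : `|x - p0.1| <= rho / 4 + hh m by exact: node_near.
have kt : `|k%:R * tt m - p0.2| <= rho by apply: le_trans (time_near m (ltW pt0) pt) _; move: h8 r0; prune7; lra.
have ddh : dd%:R * hh m <= s + hh m by move: dds; rewrite ler_norml => /andP[_]; prune7; lra.
have xr : `|x - p0.1| <= rho by move: xx h8 r0 h0; prune7; lra.
have [_ q2 q3 _ _] := Hm k x xr kt.
have h20 : 0 < hh m ^+ 2 by rewrite exprn_gt0.
pose w y := df (E m j) (UU m k) y / hh m.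
have e0 : 0 <= K * (2 * s) `^ al by rewrite mulr_ge0 // powR_ge0.
have dfw c : df c w = (fun y => df c (df (E m j) (UU m k)) y / hh m) by apply/funext => y; rewrite df_scale.
have qE : df (E m i) (df (E m j) (UU m k)) x / hh m ^+ 2 = df (E m i) w x / hh m.
  by rewrite dfw; field; rewrite gt_eqF.
rewrite qE -/(w x) -/(w (x + dd%:R *: E m i)) -/(df (dd%:R *: E m i) w x).
have GT := @grid_taylor R n dd (E m i) (hh m) s _ (K * (2 * s) `^ al) w x h0 e0 erefl.
have {}GT := GT _ dds.
apply: le_trans (GT _) _.
  move=> l l0 ld; rewrite dfw df_scale normrM normfV (gtr0_norm h0) ler_pdivrMr //.
  have lh : l%:R * hh m <= 2 * s.
    have : l%:R * hh m <= dd%:R * hh m by rewrite ler_wpM2r ?(ltW h0) // ler_nat ltnW.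
    by move: ddh hs; prune7; lra.
  have -> : hh m * (K * (2 * s) `^ al) * hh m = hh m ^+ 2 * (K * (2 * s) `^ al) by ring.
  apply: le_trans (q3 i j i l l0 _) _; first by move: lh sr r0; prune7; lra.
  rewrite ler_wpM2l ?(ltW h20) // ler_wpM2l //; apply: pow_le => //; exact: mulr_ge0 (ltW h0).
have qq : `|df (E m i) w x / hh m| <= K.
  by rewrite -qE; exact: norm_quot_le.
have w1 : hh m * `|df (E m i) w x / hh m| <= hh m * K by rewrite ler_wpM2l // ltW.
have w2 : dd%:R * hh m * (K * (2 * s) `^ al) <= (s + hh m) * (K * (2 * s) `^ al).
  by rewrite ler_wpM2r.
have w3 : hh m * (K * (2 * s) `^ al) <= hh m * (K * 1).
  rewrite ler_wpM2l ?(ltW h0) // ler_wpM2l //.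
  have p1 : 1 `^ al = 1 :> R by exact: pow_1.
  by rewrite -[leRHS]p1; apply: pow_le => //; [rewrite mulr_ge0 // ltW|move: sr r1 r0; prune7; lra].
have w4 : 0 <= hh m * K by rewrite mulr_ge0 // ltW.
by move: w1 w2 w3 w4 hd h0; prune7; lra.
Qed.

Lemma time_sum m x (k d : nat) (c e : R) : (forall l, (l < d)%N -> `|inc m (k + l) x - c| <= e) ->
  `|UU m (k + d)%N x - UU m k x - d%:R * tt m * c| <= d%:R * tt m * e.
Proof.
elim: d => [|d IH] H; first by rewrite addn0 subrr !mul0r subr0 normr0.
rewrite addnS inc_step -[d.+1%:R]natr1 !mulrDl !mul1r.
have h1 := IH (fun l ld => H l (ltnW ld)); have h2 := H d (ltnSn d).
have -> : UU m (k + d)%N x + tt m * inc m (k + d) x - UU m k x - (d%:R * tt m * c + tt m * c) =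
  (UU m (k + d)%N x - UU m k x - d%:R * tt m * c) + tt m * (inc m (k + d) x - c) by ring.
apply: le_trans (ler_normD _ _) (lerD h1 _).
by rewrite normrM (gtr0_norm (tt0 m)) ler_wpM2l // ltW.
Qed.

Lemma mid_time m (k d l : nat) (t0 r : R) : (l <= d)%N -> `|k%:R * tt m - t0| <= r ->
  `|(k + d)%:R * tt m - t0| <= r -> `|(k + l)%:R * tt m - t0| <= r.
Proof.
move=> ld; rewrite !ler_norml => /andP[a1 a2] /andP[b1 b2].
have t0' := ltW (tt0 m).
have h1 : k%:R * tt m <= (k + l)%:R * tt m by rewrite ler_wpM2r // ler_nat leq_addr.
have h2 : (k + l)%:R * tt m <= (k + d)%:R * tt m by rewrite ler_wpM2r // ler_nat leq_add2l.
by apply/andP; split; lra.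
Qed.

Lemma node_cvg (g : V -> R) x : continuous g -> (fun m => g (X m x)) @ F --> g x.
Proof.
move=> gc; apply: (cvg_close FU Foo (v := fun=> g x)); first exact: cvg_cst.
move=> d d0; have := gc x; move/(@cvgrPdist_le _ _ _ (nbhs x))/(_ _ d0)/nbhs_ballP => [q /= q0 qP].
have q20 : 0 < q / 2 by rewrite divr_gt0.
have [N NP] := mesh_small q20; exists N => m /NP hq; rewrite distrC; apply: qP.
rewrite -ball_normE /ball_ /= distrC; apply: le_lt_trans (rd_near _ (hh0 m)) _; lra.
Qed.

(** Regularity in time without differentiating in time: the scheme is Lipschitz in time,
    interpolation with the spatial bounds makes its first and then its second quotients
    equicontinuous in time, and the equation passes this on to [inc]. *)
Lemma inc_equicontinuous (p0 : V * R) : 0 < p0.2 -> exists2 rho, 0 < rho & forall eps, 0 < eps ->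
  exists2 de, 0 < de & exists N : nat, forall m, (N <= m)%N -> forall k d x, `|x - p0.1| <= rho ->
  `|k%:R * tt m - p0.2| <= rho -> `|(k + d)%:R * tt m - p0.2| <= rho -> d%:R * tt m <= de ->
  `|inc m (k + d) x - inc m k x| <= eps.
Proof.
move=> t00; have [rho [K [N [r0 r1 r2 K0 H]]]] := package p0.1 t00.
have [ds [Bm [S0 [N2 [Bm0 S01 dsS H2]]]]] := local_scheme p0.1.
have [C C0 CP] := @Hlip (`|p0.1| + 1) 0 (lexx _).
exists (rho / 4); first by rewrite divr_gt0.
move=> eps eps0.
pose LC := (size ds)%:R * (Bm * S0%:R ^+ 2) + n%:R * (2 * Bm).
have LC0 : 0 <= LC by apply: addr_ge0; apply: mulr_ge0 => //; apply: mulr_ge0 => //; exact: sqr_ge0.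
have LC1 : 0 < LC + 1 by rewrite ltr_wpDl.
have K1 : 0 < K + 1 by rewrite ltr_wpDl.
have C1 : 0 < C + 1 by rewrite ltr_wpDl.
(* Tolerances are chosen backwards: [th] for the second quotients, [th1] for the first quotients
   compared over the length [s2], and [de] for the values compared over the length [s1]. *)
pose th := eps / (2 * (LC + 1)).
have th0 : 0 < th by rewrite divr_gt0 // mulr_gt0.
have thL : LC * th <= eps / 2.
  have : th * (2 * (LC + 1)) = eps by rewrite /th; field; rewrite gt_eqF.
  by move: th0; lra.
clearbody th.
have K4 : 0 < 4 * (K + 1) by rewrite mulr_gt0.
have [q q0 qP] := @small_powR R al (th / (4 * (K + 1))) al0 (divr_gt0 th0 K4).
have r16 : 0 < rho / 16 by rewrite divr_gt0.
pose s2 := Num.min (rho / 16) (q / 2).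
have s20 : 0 < s2 by rewrite lt_min r16 divr_gt0.
have s2r : s2 <= rho / 16 by rewrite ge_min lexx.
have Ks2 y : 0 <= y -> y <= 2 * s2 -> K * y `^ al <= th / 4.
  move=> y0 ys; have : y `^ al <= th / (4 * (K + 1)).
    by apply: qP => //; apply: le_trans ys _; rewrite mulrC -ler_pdivlMr // ge_min lexx orbT.
  rewrite ler_pdivlMr // => h1; have := powR_ge0 y al; lra.
clearbody s2.
pose th1 := Num.min th (th * s2 / 4).
have th10 : 0 < th1 by rewrite lt_min th0 divr_gt0 // mulr_gt0.
have th1a : th1 <= th by rewrite ge_min lexx.
have th1b : th1 <= th * s2 / 4 by rewrite ge_min lexx orbT.
clearbody th1.
pose s1 := Num.min (rho / 16) (th1 / (8 * (K + 1))).
have s10 : 0 < s1 by rewrite lt_min r16 divr_gt0 // mulr_gt0.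
have s1r : s1 <= rho / 16 by rewrite ge_min lexx.
have s1K : 2 * s1 * K <= th1 / 4.
  have : s1 * (8 * (K + 1)) <= th1 by rewrite -ler_pdivlMr ?mulr_gt0 // ge_min lexx orbT.
  by move: s10; lra.
clearbody s1.
pose de := Num.min (th1 * s1 / (4 * (K + 1))) (eps / (2 * ((C + 1) * (K + 1)))).
have de0 : 0 < de by rewrite lt_min !divr_gt0 ?mulr_gt0.
have deA : K * de <= th1 * s1 / 4.
  have : de * (4 * (K + 1)) <= th1 * s1 by rewrite -ler_pdivlMr // ge_min lexx.
  by move: de0; lra.
have deB : C * (K * de) <= eps / 2.
  have : de * (2 * ((C + 1) * (K + 1))) <= eps by rewrite -ler_pdivlMr ?mulr_gt0 // ge_min lexx orbT.
  have : 0 <= C * de by rewrite mulr_ge0 // ltW.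
  have : 0 <= K * de by rewrite mulr_ge0 // ltW.
  by move: de0; lra.
clearbody de.
exists de => //.
have [M1 M1P] := mesh_small s10; have [M2 M2P] := mesh_small s20.
have [M3 M3P] : exists N : nat, forall m, (N <= m)%N -> hh m <= rho / (48 * S0%:R).
  by apply: mesh_small; rewrite divr_gt0 // mulr_gt0 // ltr0n.
exists (maxn (maxn N N2) (maxn M1 (maxn M2 M3))) => m; rewrite !geq_max => /andP[/andP[Nm N2m] /and3P[m1 m2 m3]] k d x xx kt kdt dde.
have h0 := hh0 m; have [h8 Hm] := H m Nm.
have hs1 := M1P m m1; have hs2 := M2P m m2.
have hS : 48 * (hh m * S0%:R) <= rho.
  have : 0 < 48 * S0%:R :> R by rewrite mulr_gt0 // ltr0n.
  by move=> pp; have := M3P m m3; rewrite ler_pdivlMr //; prune7; lra.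
have S1 : 1 <= S0%:R :> R by rewrite ler1n.
have hS' : hh m <= hh m * S0%:R by rewrite ler_peMr // ltW.
have rq : rho / 4 <= rho by move: r0; prune7; lra.
have kt' := le_trans kt rq; have kdt' := le_trans kdt rq.
have tlip y : `|y - p0.1| <= rho -> `|UU m (k + d)%N y - UU m k y| <= K * de.
  move=> yr; have := @time_sum m y k d 0 K; rewrite mulr0 subr0 => TS; apply: le_trans (TS _) _.
    move=> l ld; rewrite subr0; have [_ _ _ qq _] := Hm _ y yr (mid_time (ltnW ld) kt' kdt'); exact: qq.
  by rewrite mulrC ler_wpM2l.
have near y z (r s : R) : `|y - p0.1| <= r -> `|z - y| <= s -> `|z - p0.1| <= r + s.
  move=> yr zy; have -> : z - p0.1 = (y - p0.1) + (z - y) by rewrite [RHS]addrC addrA subrK.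
  by apply: le_trans (ler_normD _ _) (lerD yr zy).
have lev1 y i : `|y - p0.1| <= rho / 2 -> `|df (E m i) (UU m (k + d)%N) y - df (E m i) (UU m k) y| <= hh m * th1.
  move=> yr.
  have B k' : `|k'%:R * tt m - p0.2| <= rho -> forall j, (0 < j)%N -> j%:R * hh m <= 2 * s1 ->
     `|df (j%:R *: E m i) (df (E m i) (UU m k')) y| <= hh m * (th1 / 4).
    move=> k't j j0 js; have M := @df_multi0 R n j (E m i) (df (E m i) (UU m k')) (hh m ^+ 2 * K) y.
    apply: le_trans (M _) _.
      move=> l lj; have yl : `|y + l%:R *: E m i - p0.1| <= rho.
        apply: le_trans (move_norm yr (norm_steps m i l)) _.
        have : l%:R * hh m <= j%:R * hh m by rewrite ler_wpM2r ?(ltW h0) // ler_nat ltnW.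
        by move: js s1r r0; prune7; lra.
      by have [_ qq _ _ _] := Hm k' _ yl k't.
    have -> : j%:R * (hh m ^+ 2 * K) = hh m * (j%:R * hh m * K) by ring.
    rewrite ler_wpM2l ?(ltW h0) //; apply: le_trans s1K; exact: ler_wpM2r.
  apply: (quotient_close h0 hs1 th10 (B _ kdt') (B _ kt')) => z zy.
  apply: le_trans (tlip z _) deA; apply: le_trans (near y z _ _ yr zy) _; move: s1r r0; prune7; lra.
have lev2 y i j : `|y - p0.1| <= rho / 3 ->
    `|df (E m i) (df (E m j) (UU m (k + d)%N)) y - df (E m i) (df (E m j) (UU m k)) y| <= hh m ^+ 2 * th.
  move=> yr.
  have yr' : `|y - p0.1| <= rho by move: yr r0; prune7; lra.
  pose w k' z := df (E m j) (UU m k') z / hh m.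
  have dfw c k' : df c (w k') = (fun y => df c (df (E m j) (UU m k')) y / hh m) by apply/funext => z; rewrite /w df_scale.
  have B k' : `|k'%:R * tt m - p0.2| <= rho -> forall l, (0 < l)%N -> l%:R * hh m <= 2 * s2 ->
     `|df (l%:R *: E m i) (df (E m i) (w k')) y| <= hh m * (th / 4).
    move=> k't l l0 ls; rewrite dfw df_scale; apply: norm_quot_le => //.
    have [_ _ qq _ _] := Hm k' y yr' k't; apply: le_trans (qq i j i l l0 _) _; first by move: ls s2r r0; prune7; lra.
    have -> : hh m * (hh m * (th / 4)) = hh m ^+ 2 * (th / 4) by ring.
    by rewrite ler_wpM2l ?sqr_ge0 // Ks2 // mulr_ge0 // ltW.
  have QC := quotient_close h0 hs2 th0 (B _ kdt') (B _ kt').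
  have : `|df (E m i) (w (k + d)%N) y - df (E m i) (w k) y| <= hh m * th.
    apply: QC => z zy; rewrite /w -mulrBl; apply: norm_quot_le => //.
    apply: le_trans (lev1 z j _) _; last by rewrite ler_wpM2l // ltW.
    by apply: le_trans (near y z _ _ yr zy) _; move: s2r r0; prune7; lra.
  rewrite !dfw -mulrBl => /(norm_div_le h0) h1; apply: le_trans h1 _.
  by rewrite le_eqVlt; apply/orP; left; apply/eqP; ring.
have x1 : `|x - p0.1| <= 1 by move: xx r1 r0; prune7; lra.
have [a1 a2 a3 _ a5] := H2 x x1.
have incE k' : inc m k' x = Lh bp bm (hh m) ds (UU m k') x + Hf x (UU m k' x).
  by have [e1 _] := a5 m k' N2m; rewrite /inc e1 addrC addKr mulrC mulKf ?gt_eqF.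
rewrite !incE.
have -> : Lh bp bm (hh m) ds (UU m (k + d)%N) x + Hf x (UU m (k + d)%N x) - (Lh bp bm (hh m) ds (UU m k) x + Hf x (UU m k x)) =
  (Lh bp bm (hh m) ds (UU m (k + d)%N) x + (-1) * Lh bp bm (hh m) ds (UU m k) x) + (Hf x (UU m (k + d)%N x) - Hf x (UU m k x)) by ring.
rewrite -(@Lh_comb R n bp bm (hh m) ds (UU m (k + d)%N) (UU m k) (-1) 0).
set D := (fun y : V => _).
have Ddf c y : df c D y = df c (UU m (k + d)%N) y - df c (UU m k) y by rewrite /D /df; ring.
have Ddf' c : df c D = (fun y => df c (UU m (k + d)%N) y - df c (UU m k) y) by apply/funext => y; rewrite Ddf.
have Dddf c c' y : df c (df c' D) y = df c (df c' (UU m (k + d)%N)) y - df c (df c' (UU m k)) y.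
  by rewrite Ddf' /df; ring.
have := @Lh_approx R n bp bm (hh m) ds D x (fun=> 0) (fun _ _ => 0) th Bm S0 h0 (ltW th0) S01 Bm0.
rewrite !big1 ?addr0 ?subr0 -/LC; last first.
- by move=> e _; rewrite big1 ?mulr0 // => i _; rewrite big1 // => j _; rewrite mulr0.
- by move=> i _; rewrite mulr0.
move=> HL; have g1 : `|Lh bp bm (hh m) ds D x| <= LC * th.
  apply: HL => //.
    move=> y i j yx; rewrite mulr0 subr0 Dddf; apply: lev2; apply: le_trans (near x y _ _ xx yx) _; move: hS r0; prune7; lra.
  move=> y i yx; rewrite mulr0 subr0 Ddf; apply: le_trans (lev1 y i _) _; last by rewrite ler_wpM2l // ltW.
  by apply: le_trans (near x y _ _ xx yx) _; move: h8 r0; prune7; lra.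
have xn : `|x| <= `|p0.1| + 1.
  have -> : x = (x - p0.1) + p0.1 by rewrite subrK.
  by apply: le_trans (ler_normD _ _) _; rewrite addrC lerD2l.
have g2 : `|Hf x (UU m (k + d)%N x) - Hf x (UU m k x)| <= eps / 2.
  have := CP x x (UU m (k + d)%N x) (UU m k x) xn xn; rewrite oppr0 subrr normr0 add0r => CC.
  apply: le_trans (CC (UU0 _ _ _) (UU0 _ _ _)) _; apply: le_trans deB; apply: ler_wpM2l => //.
  by apply: tlip; move: xx r0; prune7; lra.
by apply: le_trans (ler_normD _ _) _; move: g1 g2 thL; prune7; lra.
Qed.

Lemma shift_coord_bound (w x : V) l (s r : R) : 0 <= s -> `|w - x| <= r -> `|w + s *: evec R l - x| <= r -> s <= 2 * r.
Proof.
move=> s0 w1 w2; have := coord_le_norm (w + s *: evec R l - x) l; have := coord_le_norm (w - x) l.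
rewrite (addrAC w) coord_add_evec eqxx mulr1 !ler_norml => /andP[a1 a2] /andP[b1 b2].
move: w1 w2 a1 a2 b1 b2; rewrite (addrAC w); prune7; lra.
Qed.

Definition rhs (p : V * R) :=
  \sum_i \sum_j a i j p.1 * qlim i j p + \sum_i b i p.1 * plim i p + Hf p.1 (zlim p).

(** The stencil samples nodes other than the one defining [plim] and [qlim]. Spatial equicontinuity
    replaces all its quotients by the central ones, which do converge. *)
Lemma inc_cvg (p : V * R) : 0 < p.2 -> (fun m => inc m (kk m p.2) (X m p.1)) @ F --> rhs p.
Proof.
move=> t00; have [rho [K [N [r0 r1 r2 K0 H]]]] := package p.1 t00.
have FF : Filter F by exact: filter_filter.
have [ds [Bm [S0 [N2 [Bm0 S01 dsS H2]]]]] := local_scheme p.1.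
have [C C0 CP] := @Hlip (`|p.1| + 1) 0 (lexx _).
have [zc pc qc] := limits_cvg t00.
pose q m i j := df (E m i) (df (E m j) (UU m (kk m p.2))) (X m p.1) / hh m ^+ 2.
pose g m i := df (E m i) (UU m (kk m p.2)) (X m p.1) / hh m.
pose B m := \sum_i \sum_j a i j (X m p.1) * q m i j + \sum_i b i (X m p.1) * g m i
  + Hf (X m p.1) (UU m (kk m p.2) (X m p.1)).
have z0 : 0 <= zlim p.
  rewrite -oppr_le0; have zc' : (fun m => - UU m (kk m p.2) (X m p.1)) @ F --> - zlim p by exact: cvgN.
  apply: (ulim_le FU Foo zc') => d d0; exists 0%N => m _; rewrite add0r; apply: le_trans (ltW d0).
  by rewrite oppr_le0.
have small m : (N <= m)%N -> `|X m p.1 - p.1| <= hh m /\ `|(kk m p.2)%:R * tt m - p.2| <= hh m.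
  move=> _; split; first exact: rd_near.
  by apply: le_trans (trunc_near (tt0 m) (ltW t00)) (tth m).
have nn m : (N <= m)%N -> `|X m p.1| <= `|p.1| + 1.
  move=> Nm; have [n1 _] := small m Nm; have [h8 _] := H m Nm.
  have -> : X m p.1 = (X m p.1 - p.1) + p.1 by rewrite subrK.
  by apply: le_trans (ler_normD _ _) _; move: n1 h8 r1 (hh0 m); prune7; lra.
have Bc : B @ F --> rhs p.
  apply: cvgD; first apply: cvgD.
  - apply: (usum_cvg FU) => i; apply: (usum_cvg FU) => j; apply: cvgM; [exact: node_cvg|exact: qc].
  - by apply: (usum_cvg FU) => i; apply: cvgM; [exact: node_cvg|exact: pc].
  apply/cvgrPdist_le => d d0.
  have C1 : 0 < 2 * (C + 1) by rewrite mulr_gt0 // ltr_wpDl.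
  have e0 : 0 < d / (2 * (C + 1)) by rewrite divr_gt0.
  have [M MP] := mesh_small e0.
  have A1 : F [set m | (maxn N M <= m)%N] by apply: Foo; exists (maxn N M).
  have /cvgrPdist_le/(_ _ e0) A2 := zc.
  apply: filterS (filterI A1 A2) => m /= [mN h2]; move: mN; rewrite geq_max => /andP[Nm Mm].
  have [n1 _] := small m Nm; have n2 := le_trans n1 (MP m Mm).
  have := CP p.1 (X m p.1) (zlim p) (UU m (kk m p.2) (X m p.1)) _ (nn m Nm); rewrite oppr0 => CC.
  apply: le_trans (CC _ z0 (UU0 _ _ _)) _; first by rewrite lerDl.
  rewrite distrC in n2; have := ler_wpM2l C0 (lerD n2 h2).
  have -> : C * (d / (2 * (C + 1)) + d / (2 * (C + 1))) = d * (C / (C + 1)) by field; rewrite gt_eqF // ltr_wpDl.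
  move=> CC'; apply: le_trans CC' _; rewrite ger_pMr // ler_pdivrMr ?ltr_wpDl // mul1r lerDl //.
apply: (cvg_close FU Foo) Bc _ => d d0.
pose LC := (size ds)%:R * (Bm * S0%:R ^+ 2) + n%:R * (2 * Bm).
have LC0 : 0 <= LC by apply: addr_ge0; apply: mulr_ge0 => //; apply: mulr_ge0 => //; exact: sqr_ge0.
pose D := 2 * ((LC + 1) * (n%:R * K + 1)).
have nK : 0 <= n%:R * K by exact: mulr_ge0.
have D0 : 0 < D by rewrite mulr_gt0 // mulr_gt0 // ltr_wpDl.
have S1 : 1 <= S0%:R :> R by rewrite ler1n.
have S30 : 0 < 3 * S0%:R + 1 :> R by move: S1; prune7; lra.
have dD : 0 < d / D by rewrite divr_gt0.
have [y y0 yP] := @small_powR R al (d / D) al0 dD.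
have [M1 M1P] : exists N : nat, forall m, (N <= m)%N -> hh m <= y / (3 * S0%:R + 1) by apply: mesh_small; rewrite divr_gt0.
have [M2 M2P] : exists N : nat, forall m, (N <= m)%N -> hh m <= d / D / 2 by apply: mesh_small; rewrite divr_gt0.
have [M3 M3P] : exists N : nat, forall m, (N <= m)%N -> hh m <= rho / (48 * S0%:R).
  by apply: mesh_small; rewrite divr_gt0 // mulr_gt0 // ltr0n.
exists (maxn (maxn N N2) (maxn M1 (maxn M2 M3))) => m; rewrite !geq_max => /andP[/andP[Nm N2m] /and3P[m1 m2 m3]].
have h0 := hh0 m; have [h8 Hm] := H m Nm; have [xn kt] := small m Nm.
have hS : 48 * (hh m * S0%:R) <= rho.
  have : 0 < 48 * S0%:R :> R by rewrite mulr_gt0 // ltr0n.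
  by move=> pp; have := M3P m m3; rewrite ler_pdivlMr //; prune7; lra.
have hy : 3 * (hh m * S0%:R) + hh m <= y by have := M1P m m1; rewrite ler_pdivlMr //; prune7; lra.
have h2D := M2P m m2.
have hS' : hh m <= hh m * S0%:R by rewrite ler_peMr // ltW.
rewrite /B; set k := kk m p.2 in kt *; set x := X m p.1 in xn *.
have x1 : `|x - p.1| <= 1 by move: xn h8 r1 h0; prune7; lra.
have kr : `|k%:R * tt m - p.2| <= rho by move: kt h8 h0; prune7; lra.
have [a1 a2 a3 a4 a5] := H2 x x1.
have -> : inc m k x = Lh bp bm (hh m) ds (UU m k) x + Hf x (UU m k x).
  by have [e1 _] := a5 m k N2m; rewrite /inc e1 addrC addKr mulrC mulKf ?gt_eqF.
rewrite opprD addrACA subrr addr0.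
have xE : rd (hh m) x = x by exact: rd_idem.
(* After composition with the rounding, arbitrary shifts become whole numbers of steps, so that
   [coordinate_path] applies to the difference quotients. *)
rewrite -(@Lh_rd R n bp bm (hh m) ds (UU m k) x h0 xE).
have rdr z (r : R) : `|z - x| <= r -> r + 2 * hh m <= rho -> `|rd (hh m) z - p.1| <= rho.
  move=> zr rr; have := @node_near m z p.1 (r + hh m) => Q.
  apply: le_trans (Q _) _; last by move: rr; prune7; lra.
  have -> : z - p.1 = (z - x) + (x - p.1) by rewrite addrA subrK.
  by apply: le_trans (ler_normD _ _) (lerD zr xn).
have e0 : 0 <= n%:R * (K * (d / D)) by apply: mulr_ge0 => //; apply: mulr_ge0 => //; exact: ltW.
have := @Lh_approx R n bp bm (hh m) ds (fun y => UU m k (rd (hh m) y)) x (g m) (q m) (n%:R * (K * (d / D))) Bm S0 h0 e0 S01 Bm0.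
rewrite (@directions_quadratic R n a ds x (q m)) //; last by move=> i j; rewrite /q dfC.
have bE : \sum_i (bp i x - bm i x) * g m i = \sum_i b i x * g m i by apply: eq_bigr => i _; rewrite bpm.
rewrite bE {bE}.
rewrite -/LC => HL; apply: le_trans (HL _ _ dsS a1 a2 a3) _.
- move=> z i j zx.
  have df2 w : df (E m i) (df (E m j) (fun y => UU m k (rd (hh m) y))) w = df (E m i) (df (E m j) (UU m k)) (rd (hh m) w).
    have -> : df (E m j) (fun y => UU m k (rd (hh m) y)) = (fun y => df (E m j) (UU m k) (rd (hh m) y)).
      by apply/funext => w'; exact: df_rd.
    exact: (@df_rd R n (hh m) i (df (E m j) (UU m k)) w h0).
  rewrite df2.
  have -> : hh m ^+ 2 * q m i j = df (E m i) (df (E m j) (UU m k)) (rd (hh m) x).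
    by rewrite xE /q -/k -/x; field; rewrite gt_eqF.
  have := @coordinate_path R n (fun w => df (E m i) (df (E m j) (UU m k)) (rd (hh m) w)) x (3 * (hh m * S0%:R))
    (fun s => hh m ^+ 2 * (K * (s + hh m) `^ al)) _ _ z x zx.
  rewrite subrr normr0 => CPa; apply: le_trans (CPa _ _ _) _.
  + move=> s s' s0 ss; rewrite ler_wpM2l ?sqr_ge0 // ler_wpM2l //; apply: pow_le => //; last by rewrite lerD2r.
    by rewrite addr_ge0 // ltW.
  + move=> w l s s0 w1 w2; have [dd ddE dds] := rd_shift w l h0 s0.
    have ddh : dd%:R * hh m <= s + hh m by move: dds; rewrite ler_norml => /andP[_]; prune7; lra.
    rewrite ddE; case: (posnP dd) => [->|dd0].
      rewrite scale0r addr0 subrr normr0 mulr_ge0 ?sqr_ge0 // mulr_ge0 // powR_ge0 //.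
    have wr : `|rd (hh m) w - p.1| <= rho by apply: rdr w1 _; move: hS hS' h0 r0; prune7; lra.
    have sle := shift_coord_bound s0 w1 w2.
    have [_ _ q3 _ _] := Hm k _ wr kr.
    apply: le_trans (q3 i j l dd dd0 _) _; first by move: ddh sle hS hS' r0; prune7; lra.
    by rewrite ler_wpM2l ?sqr_ge0 // ler_wpM2l //; apply: pow_le => //; rewrite mulr_ge0 // ltW.
  + by rewrite mulr_ge0 // mulr_ge0 // ltW.
  rewrite mulrCA ler_wpM2l ?sqr_ge0 // ler_wpM2l // ler_wpM2l //; apply: yP; first by rewrite addr_ge0 // ltW.
  by move: zx hy; prune7; lra.
- move=> z i zx.
  rewrite (@df_rd R n (hh m) i (UU m k) z h0).
  have -> : hh m * g m i = df (E m i) (UU m k) (rd (hh m) x).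
    by rewrite xE /g -/k -/x; field; rewrite gt_eqF.
  have := @coordinate_path R n (fun w => df (E m i) (UU m k) (rd (hh m) w)) x (hh m)
    (fun s => hh m * (K * (s + hh m))) _ _ z x zx.
  rewrite subrr normr0 => CPa; apply: le_trans (CPa _ _ _) _.
  + by move=> s s' s0 ss; rewrite ler_wpM2l ?(ltW h0) // ler_wpM2l // lerD2r.
  + move=> w l s s0 w1 w2; have [dd ddE dds] := rd_shift w l h0 s0.
    have ddh : dd%:R * hh m <= s + hh m by move: dds; rewrite ler_norml => /andP[_]; prune7; lra.
    rewrite ddE.
    have sle := shift_coord_bound s0 w1 w2.
    have M := @df_multi0 R n dd (E m l) (df (E m i) (UU m k)) (hh m ^+ 2 * K) (rd (hh m) w).
    apply: le_trans (M _) _.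
      move=> j jd; have wr : `|rd (hh m) w + j%:R *: E m l - p.1| <= rho.
        have nw : `|rd (hh m) w - p.1| <= 3 * hh m.
          have := @node_near m w p.1 (2 * hh m) => Q; apply: le_trans (Q _) _; last by prune7; lra.
          have -> : w - p.1 = (w - x) + (x - p.1) by rewrite addrA subrK.
          by apply: le_trans (ler_normD _ _) _; move: w1 xn; prune7; lra.
        apply: le_trans (move_norm nw (norm_steps m l j)) _.
        have : j%:R * hh m <= dd%:R * hh m by rewrite ler_wpM2r ?(ltW h0) // ler_nat ltnW.
        by move: ddh sle h8 h0; prune7; lra.
      by have [_ q2 _ _ _] := Hm k _ wr kr; exact: q2.
    have -> : dd%:R * (hh m ^+ 2 * K) = hh m * (K * (dd%:R * hh m)) by ring.
    by rewrite ler_wpM2l ?(ltW h0) // ler_wpM2l.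
  + exact: ltW.
  rewrite mulrCA ler_wpM2l ?(ltW h0) // ler_wpM2l // ler_wpM2l //; move: zx h2D; prune7; lra.
have -> : LC * (n%:R * (K * (d / D))) = d * ((LC * (n%:R * K)) / D) by field; rewrite gt_eqF.
rewrite ger_pMr // ler_pdivrMr // mul1r /D; have : 0 <= LC * (n%:R * K) by exact: mulr_ge0.
move: LC0 nK; prune7; lra.
Qed.

(** Telescoping in time, with [inc] nearly constant over short times; its value at the initial level
    converges to [rhs]. *)
Lemma time_first (p0 : V * R) : 0 < p0.2 -> exists2 rho, 0 < rho & forall e, 0 < e -> exists2 de, 0 < de &
  forall p, `|p - p0| <= rho -> forall s, 0 < s -> s <= de ->
  `|zlim (p + s *: (0, 1)) - zlim p - s * rhs p| <= e * s.
Proof.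
move=> t00; have [rho [K [N [r0 r1 r2 K0 H]]]] := package p0.1 t00.
have [ro ro0 roP] := inc_equicontinuous t00.
pose r := Num.min rho ro / 4.
have r'0 : 0 < Num.min rho ro by rewrite lt_min r0.
have rr0 : 0 < r by rewrite divr_gt0.
have rr : 4 * r <= rho /\ 4 * r <= ro by rewrite mulrC /r divfK // !ge_min !lexx orbT.
case: rr => rr1 rr2; clearbody r.
exists r => // e e0; have [de de0 [N1 N1P]] := roP e e0.
exists (Num.min r (de / 2)); first by rewrite lt_min rr0 divr_gt0.
move=> p /near_pair[px pt] s s0; rewrite le_min => /andP[sr sde].
have pt0 : 0 < p.2 by move: pt; rewrite ler_norml => /andP[+ _]; move: rr1 rr0 r2; prune7; lra.
have [zc _ _] := limits_cvg pt0; have ic := inc_cvg pt0.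
rewrite shift_time; have ps0 : 0 < (p.1, p.2 + s).2 by rewrite addr_gt0.
have [zc' _ _] := limits_cvg ps0.
apply: (ulim_taylor FU Foo zc' zc ic) => d d0.
have [N2 N2P] : exists N : nat, forall m, (N <= m)%N -> hh m <= d / (e + K) by apply: mesh_small; rewrite divr_gt0 // ltr_wpDr.
have [N3 N3P] := mesh_small rr0; have de2 : 0 < de / 2 by rewrite divr_gt0.
have [N4 N4P] := mesh_small de2.
exists (maxn (maxn N N1) (maxn N2 (maxn N3 N4))) => m; rewrite !geq_max => /andP[/andP[Nm N1m] /and3P[m2 m3 m4]].
have h0 := hh0 m; have th := tth m; have h3 := N3P m m3; have h4 := N4P m m4; have [h8 Hm] := H m Nm.
have [dd ddE dds] := trunc_shift (tt0 m) (ltW pt0) (ltW s0).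
have kt2 := @time_near m (p.2 + s) p0.2 (r + s) (ltW ps0).
rewrite /= ddE in kt2 *; set k := kk m p.2 in kt2 *; set x := X m p.1.
have xx : `|x - p0.1| <= r + hh m by exact: node_near.
have kt : `|k%:R * tt m - p0.2| <= r + hh m by exact: time_near (ltW pt0) pt.
have kt3 : `|(k + dd)%:R * tt m - p0.2| <= r + s + hh m.
  apply: kt2; have -> : p.2 + s - p0.2 = (p.2 - p0.2) + s by ring.
  by apply: le_trans (ler_normD _ _) _; rewrite (gtr0_norm s0) lerD2r.
have ddt : dd%:R * tt m <= s + hh m by move: dds; rewrite ler_norml => /andP[_]; move: th; prune7; lra.
have dt0 : 0 <= dd%:R * tt m by rewrite mulr_ge0 // ltW.
have I l : (l < dd)%N -> `|inc m (k + l) x - inc m k x| <= e.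
  move=> ld; have kro : `|k%:R * tt m - p0.2| <= ro by move: kt h3 rr2 rr0; prune7; lra.
  apply: (N1P m N1m) => //; first by move: xx h3 rr2 rr0; prune7; lra.
    by apply: (mid_time (ltnW ld) kro); move: kt3 sr h3 rr2 rr0; prune7; lra.
  have : l%:R * tt m <= dd%:R * tt m by rewrite ler_wpM2r ?(ltW (tt0 m)) // ler_nat ltnW.
  by move: ddt sde h4; prune7; lra.
have TS := time_sum I.
have xr : `|x - p0.1| <= rho by move: xx h3 rr1 rr0; prune7; lra.
have kr : `|k%:R * tt m - p0.2| <= rho by move: kt h3 rr1 rr0; prune7; lra.
have [_ _ _ iK _] := Hm k x xr kr.
have -> : UU m (k + dd)%N x - UU m k x - s * inc m k x =
  (UU m (k + dd)%N x - UU m k x - dd%:R * tt m * inc m k x) + (dd%:R * tt m - s) * inc m k x by ring.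
apply: le_trans (ler_normD _ _) _.
have w1 : dd%:R * tt m * e <= (s + hh m) * e by rewrite ler_wpM2r // ltW.
have w2 : `|(dd%:R * tt m - s) * inc m k x| <= hh m * K.
  by rewrite normrM; apply: ler_pM => //; exact: le_trans dds th.
have w3 : hh m * (e + K) <= d by rewrite -ler_pdivlMr ?N2P // ltr_wpDr.
have : (s + hh m) * e = e * s + hh m * e by ring.
have : hh m * (e + K) = hh m * e + hh m * K by ring.
move: TS w1 w2 w3; prune7; lra.
Qed.

(** A local Lipschitz bound: first differences control the change in space, [inc] the change in
    time. *)
Lemma zlim_continuous (p0 : V * R) : 0 < p0.2 -> {for p0, continuous zlim}.
Proof.
move=> t00; have [rho [K [N [r0 r1 r2 K0 H]]]] := package p0.1 t00.
have n1 : 0 < n.+1%:R :> R by rewrite ltr0n.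
have lip p : `|p - p0| <= rho / 4 -> `|zlim p - zlim p0| <= K * (n.+1%:R * `|p - p0|).
  move=> pp; have [px' pt'] := near_pair (lexx `|p - p0|).
  have [px pt] := near_pair pp.
  have pt0 : 0 < p.2 by move: pt; rewrite ler_norml => /andP[+ _]; move: r0 r2; prune7; lra.
  have [zc _ _] := limits_cvg pt0; have [zc0 _ _] := limits_cvg t00.
  have := ulim_taylor FU Foo zc zc0 zc0 (s := 0); rewrite mul0r subr0; apply => d d0.
  have D0 : 0 < K * n.+2%:R + 1 by rewrite ltr_wpDl // mulr_ge0.
  have [N2 N2P] : exists N : nat, forall m, (N <= m)%N -> hh m <= d / (K * n.+2%:R + 1) by apply: mesh_small; rewrite divr_gt0.
  exists (maxn N N2) => m; rewrite geq_max => /andP[Nm N2m]; rewrite mul0r subr0.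
  have [h8 Hm] := H m Nm; have h0 := hh0 m.
  have hd : hh m * (K * n.+2%:R + 1) <= d by rewrite -ler_pdivlMr // N2P.
  have kt := time_near m (ltW pt0) pt.
  have kt0 : `|(kk m p0.2)%:R * tt m - p0.2| <= 0 + hh m by apply: time_near (ltW t00) _; rewrite subrr normr0.
  set k := kk m p.2 in kt *; set k0 := kk m p0.2 in kt0 *.
  have kr : `|k%:R * tt m - p0.2| <= rho by move: kt h8 r0 h0; prune7; lra.
  have kr0 : `|k0%:R * tt m - p0.2| <= rho by move: kt0 h8 r0 h0; prune7; lra.
  have S1 : `|UU m k (X m p.1) - UU m k (X m p0.1)| <= n%:R * (K * (`|p.1 - p0.1| + hh m)).
    apply: (@coordinate_path R n (fun w => UU m k (rd (hh m) w)) p0.1 (rho / 4) (fun s => K * (s + hh m))) => //.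
    - by move=> s s' s0 ss; rewrite ler_wpM2l // lerD2r.
    - move=> w l s s0 w1 w2; have [dd ddE dds] := rd_shift w l h0 s0.
      have ddh : dd%:R * hh m <= s + hh m by move: dds; rewrite ler_norml => /andP[_]; prune7; lra.
      have sle := shift_coord_bound s0 w1 w2.
      rewrite ddE.
      have M := @df_multi0 R n dd (E m l) (UU m k) (hh m * K) (rd (hh m) w).
      apply: le_trans (M _) _.
        move=> j jd; have wr : `|rd (hh m) w + j%:R *: E m l - p0.1| <= rho.
          have nw := node_near m w1.
          apply: le_trans (move_norm nw (norm_steps m l j)) _.
          have : j%:R * hh m <= dd%:R * hh m by rewrite ler_wpM2r ?(ltW h0) // ler_nat ltnW.
          by move: ddh sle h8 h0 r0; prune7; lra.
        by have [q1 _ _ _ _] := Hm k _ wr kr; exact: q1.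
      have -> : dd%:R * (hh m * K) = K * (dd%:R * hh m) by ring.
      by rewrite ler_wpM2l.
    - by rewrite subrr normr0 divr_ge0 // ltW.
  have xr : `|X m p0.1 - p0.1| <= rho by apply: le_trans (rd_near _ h0) _; move: h8 h0; prune7; lra.
  have T1 (k1 d1 : nat) : `|k1%:R * tt m - p0.2| <= rho -> `|(k1 + d1)%:R * tt m - p0.2| <= rho ->
      `|UU m (k1 + d1)%N (X m p0.1) - UU m k1 (X m p0.1)| <= K * `|(k1 + d1)%:R * tt m - k1%:R * tt m|.
    move=> q1 q2; have TS := @time_sum m (X m p0.1) k1 d1 0 K; rewrite mulr0 subr0 in TS; apply: le_trans (TS _) _.
      by move=> l ld; rewrite subr0; have [_ _ _ qq _] := Hm _ _ xr (mid_time (ltnW ld) q1 q2).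
    by rewrite natrD mulrDl addrC addKr ger0_norm ?mulr_ge0 ?(ltW (tt0 m)) // mulrC.
  have S2 : `|UU m k (X m p0.1) - UU m k0 (X m p0.1)| <= K * `|k%:R * tt m - k0%:R * tt m|.
    case: (leqP k0 k) => kk0.
      by move: (T1 k0 (k - k0)%N kr0); rewrite subnKC //; exact.
    rewrite distrC (distrC (k%:R * tt m)).
    by move: (T1 k (k0 - k)%N kr); rewrite subnKC ?(ltnW kk0) //; exact.
  have S3 : `|k%:R * tt m - k0%:R * tt m| <= `|p.2 - p0.2| + 2 * hh m.
    have kt1 : `|k%:R * tt m - p.2| <= hh m by apply: le_trans (trunc_near (tt0 m) (ltW pt0)) (tth m).
    have -> : k%:R * tt m - k0%:R * tt m = (k%:R * tt m - p.2) + (p.2 - p0.2) - (k0%:R * tt m - p0.2) by ring.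
    apply: le_trans (ler_normB _ _) _; apply: le_trans (lerD (ler_normD _ _) (lexx _)) _; move: kt0 kt1; prune7; lra.
  have -> : UU m k (X m p.1) - UU m k0 (X m p0.1) = (UU m k (X m p.1) - UU m k (X m p0.1)) + (UU m k (X m p0.1) - UU m k0 (X m p0.1)) by ring.
  apply: le_trans (ler_normD _ _) _.
  have w1 : n%:R * (K * (`|p.1 - p0.1| + hh m)) <= n%:R * (K * (`|p - p0| + hh m)).
    by rewrite ler_wpM2l // ler_wpM2l // lerD2r.
  have w2 : K * `|k%:R * tt m - k0%:R * tt m| <= K * (`|p - p0| + 2 * hh m).
    by rewrite ler_wpM2l //; move: S3 pt'; prune7; lra.
  have w3 : n%:R * (K * (`|p - p0| + hh m)) + K * (`|p - p0| + 2 * hh m) = K * (n.+1%:R * `|p - p0|) + hh m * (K * n.+2%:R).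
    by rewrite -[n.+2%:R]natr1 -[n.+1%:R]natr1; ring.
  have w4 : hh m * (K * n.+2%:R + 1) = hh m * (K * n.+2%:R) + hh m by ring.
  by move: S1 S2 w1 w2 w3 w4 hd h0; prune7; lra.
apply/(@cvgrPdist_le _ _ _ (nbhs p0)) => e e0.
have D0 : 0 < K * n.+1%:R + 1 by rewrite ltr_wpDl // mulr_ge0.
apply/nbhs_ballP; exists (Num.min (rho / 4) (e / (K * n.+1%:R + 1))); first by rewrite /= lt_min !divr_gt0.
move=> p; rewrite -ball_normE /= lt_min (ltr_pdivlMr _ _ D0) => /andP[q1 q2].
rewrite distrC in q1 q2; rewrite distrC; apply: le_trans (lip p (ltW q1)) _.
have := normr_ge0 (p - p0); move: q2; prune7; lra.
Qed.

Let D : set (V * R) := [set p | 0 < p.2].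

Lemma positive_time_open : open D.
Proof.
have -> : D = snd @^-1` [set t : R | 0 < t] by [].
by apply: open_comp; [move=> p _; exact: cvg_snd|exact: open_gt].
Qed.

Lemma zlim_space i p : 0 < p.2 -> {for p, continuous (plim i)} /\ is_derive p (evec R i, 0) zlim (plim i p).
Proof.
have H p1 : D p1 -> exists2 rho, 0 < rho & forall e, 0 < e -> exists2 de, 0 < de &
    forall q, `|q - p1| <= rho -> forall s, 0 < s -> s <= de ->
    `|zlim (q + s *: (evec R i, 0)) - zlim q - s * plim i q| <= e * s.
  move=> Dp; have [rho r0 [K K0 H]] := space_first Dp; exists rho => // e e0.
  have K1 : 0 < K + 1 by rewrite ltr_wpDl.
  exists (Num.min rho (e / (K + 1))) => [|q qp s s0]; first by rewrite lt_min r0 divr_gt0.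
  rewrite le_min ler_pdivlMr // => /andP[sr se]; apply: le_trans (H q qp i s s0 sr) _.
  by rewrite ler_wpM2r ?(ltW s0) //; move: s0 se; prune7; lra.
move=> Dp; split; first exact: (uniform_difference_continuous positive_time_open zlim_continuous H Dp).
exact: (uniform_difference_derive positive_time_open zlim_continuous H Dp).
Qed.

Lemma plim_space i j p : 0 < p.2 -> {for p, continuous (qlim i j)} /\ is_derive p (evec R i, 0) (plim j) (qlim i j p).
Proof.
have H p1 : D p1 -> exists2 rho, 0 < rho & forall e, 0 < e -> exists2 de, 0 < de &
    forall q, `|q - p1| <= rho -> forall s, 0 < s -> s <= de ->
    `|plim j (q + s *: (evec R i, 0)) - plim j q - s * qlim i j q| <= e * s.
  move=> Dp; have [rho r0 [K K0 H]] := space_second Dp; exists rho => // e e0.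
  have K1 : 0 < K + 1 by rewrite ltr_wpDl.
  have [y y0 yP] := @small_powR R al (e / (K + 1)) al0 (divr_gt0 e0 K1).
  exists (Num.min rho (y / 2)) => [|q qp s s0]; first by rewrite lt_min r0 divr_gt0.
  rewrite le_min ler_pdivlMr // => /andP[sr se]; apply: le_trans (H q qp i j s s0 sr) _.
  rewrite ler_wpM2r ?(ltW s0) //; have := yP (2 * s); rewrite mulr_ge0 ?(ltW s0) // mulrC => /(_ isT se).
  rewrite mulrC ler_pdivlMr // => h1; have := powR_ge0 (2 * s) al; move: h1; prune7; lra.
have pc q : D q -> {for q, continuous (plim j)} by move=> Dq; have [] := zlim_space j Dq.
move=> Dp; split; first exact: (uniform_difference_continuous positive_time_open pc H Dp).
exact: (uniform_difference_derive positive_time_open pc H Dp).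
Qed.

Lemma zlim_time p : 0 < p.2 -> {for p, continuous rhs} /\ is_derive p (0, 1) zlim (rhs p).
Proof.
move=> Dp; split; first exact: (uniform_difference_continuous positive_time_open zlim_continuous time_first Dp).
exact: (uniform_difference_derive positive_time_open zlim_continuous time_first Dp).
Qed.

Lemma is_derive_fst (G : V * R -> R) (v : V) (x : V) (t l : R) :
  is_derive (x, t) (v, 0) G l -> is_derive x v (fun y => G (y, t)) l.
Proof.
have E' : (fun s : R => s^-1 *: (((fun y => G (y, t)) \o shift x) (s *: v) - G (x, t))) =
   (fun s : R => s^-1 *: ((G \o shift (x, t)) (s *: ((v, 0) : V * R)) - G (x, t))).
  apply/funext => s /=; congr (_ *: (G _ - _)).
  by congr pair; rewrite /= scaler0 add0r.
by case=> d1 d2; split; rewrite /derivable /derive /= E'.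
Qed.

Lemma is_derive_snd (G : V * R -> R) (x : V) (t l : R) :
  is_derive (x, t) (0, 1) G l -> is_derive t (1 : R) (fun s => G (x, s)) l.
Proof.
have E' : (fun s : R => s^-1 *: (((fun y => G (x, y)) \o shift t) (s *: (1 : R)) - G (x, t))) =
   (fun s : R => s^-1 *: ((G \o shift (x, t)) (s *: ((0, 1) : V * R)) - G (x, t))).
  apply/funext => s /=; congr (_ *: (G _ - _)).
  by congr pair; rewrite /= scaler0 add0r.
by case=> d1 d2; split; rewrite /derivable /derive /= E'.
Qed.

Lemma continuous_near_eq (g1 g2 : V * R -> R) p : (forall q, D q -> g1 q = g2 q) -> D p ->
  {for p, continuous g2} -> {for p, continuous g1}.
Proof.
move=> E' Dp gc; rewrite /prop_for /continuous_at E' //; apply: cvg_trans gc; apply: near_eq_cvg.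
by apply: filterS (open_nbhs_nbhs (conj positive_time_open Dp)) => q Dq; rewrite E'.
Qed.

Variable W : V -> R.
Hypothesis CW : C2 W.
(** The candidate solution of the Cauchy problem with zero data. *)
Definition deficit (x : V) (t : R) := W x - zlim (x, t).

Lemma deficit_time (x : V) (t : R) : 0 < t -> is_derive t (1 : R) (deficit x) (- rhs (x, t)).
Proof.
move=> t00; have [_ d] := @zlim_time (x, t) t00.
by rewrite -sub0r; apply: is_deriveB; exact: is_derive_snd.
Qed.

Lemma deficit_first i (x : V) (t : R) : 0 < t -> is_derive x (evec R i) (fun y => deficit y t) (pd i W x - plim i (x, t)).
Proof.
move=> t00; have [_ d] := @zlim_space i (x, t) t00; case: (CW) => _ [dW _].
by apply: is_deriveB; [apply: derivableP; exact: dW|exact: is_derive_fst].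
Qed.

Lemma deficit_pd j (t : R) : 0 < t -> pd j (fun y => deficit y t) = (fun y => pd j W y - plim j (y, t)).
Proof. by move=> t00; apply/funext => x; apply: (derive_val (is_derive := deficit_first j x t00)). Qed.

Lemma deficit_second i j (x : V) (t : R) : 0 < t ->
  is_derive x (evec R i) (pd j (fun y => deficit y t)) (pd i (pd j W) x - qlim i j (x, t)).
Proof.
move=> t00; rewrite deficit_pd //; have [_ d] := @plim_space i j (x, t) t00; case: (CW) => _ [_ [_ [ddW _]]].
by apply: is_deriveB; [apply: derivableP; exact: ddW|exact: is_derive_fst].
Qed.

Lemma deficit_C21 : C21 deficit.
Proof.
case: (CW) => cW [dW [c1 [ddW c2]]].
have cf (g : V -> R) (p : V * R) : continuous g -> {for p, continuous (fun q : V * R => g q.1)}.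
  by move=> gc; apply: (@continuous_comp _ _ _ fst g); [exact: cvg_fst|exact: gc].
split; first by move=> x t t00; case: (deficit_time x t00).
split.
  move=> p Dp; apply: (continuous_near_eq (g2 := (fun q => - rhs q)) _ Dp).
    by move=> [x t] t00; apply: (derive_val (is_derive := deficit_time x t00)).
  by apply: cvgN; have [] := zlim_time Dp.
split; first by move=> i x t t00; case: (deficit_first i x t00).
split.
  move=> i p Dp; apply: (continuous_near_eq (g2 := (fun q => pd i W q.1 - plim i q)) _ Dp).
    by move=> [x t] t00; rewrite /= deficit_pd.
  by apply: cvgB; [exact: cf|have [] := zlim_space i Dp].
split; first by move=> i j x t t00; case: (deficit_second i j x t00).
move=> i j p Dp; apply: (continuous_near_eq (g2 := (fun q => pd i (pd j W) q.1 - qlim i j q)) _ Dp).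
  by move=> [x t] t00; apply: (derive_val (is_derive := deficit_second i j x t00)).
by apply: cvgB; [exact: cf|have [] := plim_space i j Dp].
Qed.

Lemma deficit_equation (x : V) (t : R) : 0 < t ->
  'D_1 (deficit x) t = Lop a b (fun y => deficit y t) x - Lop a b W x - Hf x (zlim (x, t)).
Proof.
move=> t00; rewrite (derive_val (is_derive := deficit_time x t00)) /Lop.
under [Y in _ = Y + _ - _ - _]eq_bigr => i _.
  under eq_bigr => j _ do rewrite /pd (derive_val (is_derive := deficit_second i j x t00)) mulrBr.
  rewrite sumrB; over.
under [Y in _ = _ + Y - _ - _]eq_bigr => i _ do rewrite deficit_pd // mulrBr.
rewrite !sumrB /rhs /=; ring.
Qed.

End SchemeLimit.

(** * The scheme attached to a stationary solution *)

Section StationaryScheme.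
Variables (R : realType) (n : nat) (al : R).
Hypotheses (al0 : 0 < al) (al1 : al < 1).
Local Notation V := 'rV[R]_n.
Local Notation dir := (seq ('I_n * bool) * (V -> R))%type.
Local Notation lh := (@loc_holder R n al).
Variables (a : 'I_n -> 'I_n -> V -> R) (b : 'I_n -> V -> R) (f : V -> R -> R) (W : V -> R).
Hypotheses (blh : forall i, lh (b i)) (flip : f_loc_lip f) (f0 : forall x, f x 0 = 0).
Hypothesis WS : stationary_sol a b f W.
Variable ds : nat -> seq dir.
Hypothesis dslh : forall m d, d \in ds m -> lh d.2.
Hypothesis ds0 : forall m d x, d \in ds m -> `|x| <= m.+1%:R -> 0 <= d.2 x.
Hypothesis dsE : forall m x i j, `|x| <= m.+1%:R ->
  \sum_(d <- ds m) d.2 x * (vec R d.1 0 i * vec R d.1 0 j) = sa a i j x.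
Hypothesis dsA : forall (m k : nat) x (F : seq ('I_n * bool) -> R), (m <= k)%N -> `|x| <= m%:R ->
  \sum_(d <- ds k) d.2 x * F d.1 = \sum_(d <- ds m) d.2 x * F d.1.

Let W0 x : 0 <= W x. Proof. by case: WS => _ []. Qed.
Let WC : C2 W. Proof. by case: WS. Qed.
Let Weq x : Lop a b W x + f x (W x) = 0. Proof. by case: WS => _ []. Qed.

Definition bp i (x : V) := Num.max (b i x) 0.
Definition bm i (x : V) := Num.max (- b i x) 0.
Lemma bp_ge0 i x : 0 <= bp i x. Proof. by rewrite le_max lexx orbT. Qed.
Lemma bm_ge0 i x : 0 <= bm i x. Proof. by rewrite le_max lexx orbT. Qed.
Lemma bpm i x : bp i x - bm i x = b i x.
Proof. by rewrite /bp /bm /Num.max; case: ltP => ?; case: ltP => ?; lra. Qed.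
Lemma max0_contract (s t : R) : `|Num.max s 0 - Num.max t 0| <= `|s - t|.
Proof.
have := ler_norm (s - t); have := ler_norm (- (s - t)); rewrite normrN.
by rewrite /Num.max; case: ltP => ?; case: ltP => ?; rewrite ler_norml; lra.
Qed.
Lemma bp_lh i : lh (bp i).
Proof. by apply: lh_contract (blh i) _ => x y; exact: max0_contract. Qed.
Lemma bm_lh i : lh (bm i).
Proof. by apply: lh_contract (lh_opp (blh i)) _ => x y; exact: max0_contract. Qed.

Local Notation L h m := (Lh bp bm h (ds m)).

(** Clipping [W - z] at 0 keeps the second argument of [f] nonnegative and freezes the reaction at
    [f(x, W)] for [z >= W]. The discrete solution may thus exceed [W] slightly, and the Lipschitz
    bound requires only a lower bound on [z]. *)
Definition Hf (x : V) (z : R) := f x (W x) - f x (Num.max (W x - z) 0).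

Lemma Hf0 x : Hf x 0 = 0.
Proof. by rewrite /Hf subr0 max_l // subrr. Qed.

Lemma Hf_lip (r M : R) : 0 <= M -> exists2 C, 0 <= C & forall x y z z', `|x| <= r -> `|y| <= r ->
  - M <= z -> - M <= z' -> `|Hf x z - Hf y z'| <= C * (`|x - y| + `|z - z'|).
Proof.
move=> M0; have cW : continuous W by case: WC.
have [B B0 BP] := @continuous_bounded_ball R n W r cW.
have [K K0 KP] := C2_lipschitz WC r.
have [C CP] := flip 0 r (B + M); pose C' := `|C|.
have C'P x y u v : `|x| <= r -> `|y| <= r -> 0 <= u <= B + M -> 0 <= v <= B + M ->
    `|f x u - f y v| <= C' * (`|x - y| + `|u - v|).
  move=> xr yr ur vr; apply: le_trans (CP x y u v _ _ ur vr) _; rewrite ?subr0 //.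
  by rewrite ler_wpM2r ?ler_norm // addr_ge0.
exists (C' * (2 + 2 * K)); first by apply: mulr_ge0; [exact: normr_ge0|apply: addr_ge0 => //; exact: mulr_ge0].
move=> x y z z' xr yr zM z'M.
have WB u : `|u| <= r -> W u <= B by move=> /BP; apply: le_trans; exact: ler_norm.
have KW := KP x y xr yr.
rewrite /Hf; set u := Num.max _ 0; set v := Num.max _ 0.
have uv : `|u - v| <= K * `|x - y| + `|z - z'|.
  apply: le_trans (max0_contract _ _) _.
  have -> : W x - z - (W y - z') = (W x - W y) - (z - z') by ring.
  by apply: le_trans (ler_normB _ _) _; rewrite lerD2r.
have h1 : `|f x (W x) - f y (W y)| <= C' * (`|x - y| + `|W x - W y|).
  by apply: C'P => //; rewrite W0 /=; apply: le_trans (WB _ _) _ => //; rewrite lerDl.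
have h2 : `|f x u - f y v| <= C' * (`|x - y| + `|u - v|).
  have := WB x xr; have := WB y yr => ? ?.
  by apply: C'P => //; rewrite le_max lexx orbT /= ge_max; apply/andP; split; lra.
have -> : f x (W x) - f x u - (f y (W y) - f y v) = (f x (W x) - f y (W y)) - (f x u - f y v) by ring.
apply: le_trans (ler_normB _ _) _; apply: le_trans (lerD h1 h2) _.
rewrite -mulrDr -mulrA; apply: ler_wpM2l; first exact: normr_ge0.
have p1 : 0 <= K * `|z - z'| by rewrite mulr_ge0.
have p2 : 0 <= `|z - z'| by []. have p3 : 0 <= `|x - y| by [].
by move: KW uv p1 p2 p3; lra.
Qed.

Lemma W_consistent (m : nat) (eps : R) : 0 < eps -> exists2 de, 0 < de & forall h x, 0 < h -> h <= de ->
  `|x| <= m%:R -> `|L h m W x - Lop a b W x| <= eps.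
Proof.
move=> eps0; case: (WC) => _ [_ [c1 [_ c2]]].
have [B1 [S0 [B10 S01 B1P]]] := directions_bounded al0 (0 : V) m%:R (@dslh m).
have [B2 B20 B2P] := family_bounded al0 (0 : V) m%:R bp_lh.
have [B3 B30 B3P] := family_bounded al0 (0 : V) m%:R bm_lh.
pose Bm := B1 + B2 + B3; have Bm0 : 0 <= Bm by rewrite !addr_ge0.
pose K := (size (ds m))%:R * (Bm * S0%:R ^+ 2) + n%:R * (2 * Bm).
have K0 : 0 <= K by apply: addr_ge0; apply: mulr_ge0 => //; apply: mulr_ge0 => //; exact: sqr_ge0.
pose e := eps / (2 * (K + 1)).
have e0 : 0 < e by rewrite divr_gt0 // mulr_gt0 // ltr_wpDl.
have [d1 d10 d1P] := C2_first_consistent WC m.+1%:R e0.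
have [d2 d20 d2P] := C2_second_consistent WC m.+1%:R e0.
have [d3 d30 d3P] : exists2 de, 0 < de & forall i x y, `|x| <= m%:R -> `|x - y| <= de -> `|pd i W x - pd i W y| <= e.
  suff H (s : seq 'I_n) : exists2 de, 0 < de & forall i x y, i \in s -> `|x| <= m%:R -> `|x - y| <= de -> `|pd i W x - pd i W y| <= e.
    by have [de de0 deP] := H (enum 'I_n); exists de => // i x y; apply: deP; rewrite mem_enum.
  elim: s => [|j s [de de0 deP]]; first by exists 1.
  have [de' de'0 de'P] := @unif_continuous_ball R n (pd j W) m%:R e (c1 j) e0.
  exists (Num.min de de') => [|i x y]; first by rewrite lt_min de0.
  rewrite inE le_min => /orP[/eqP ->|ii] xr /andP[q1 q2]; [exact: de'P|exact: deP].
have [d4 d40 d4P] : exists2 de, 0 < de & forall i j x y, `|x| <= m%:R -> `|x - y| <= de ->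
    `|pd i (pd j W) x - pd i (pd j W) y| <= e.
  suff H (s : seq ('I_n * 'I_n)) : exists2 de, 0 < de & forall i j x y, (i, j) \in s -> `|x| <= m%:R -> `|x - y| <= de ->
      `|pd i (pd j W) x - pd i (pd j W) y| <= e.
    by have [de de0 deP] := H (enum {: 'I_n * 'I_n}); exists de => // i j x y; apply: deP; rewrite mem_enum.
  elim: s => [|[k l] s [de de0 deP]]; first by exists 1.
  have [de' de'0 de'P] := @unif_continuous_ball R n (pd k (pd l W)) m%:R e (c2 k l) e0.
  exists (Num.min de de') => [|i j x y]; first by rewrite lt_min de0.
  rewrite inE le_min => /orP[/eqP[-> ->]|ii] xr /andP[q1 q2]; [exact: de'P|exact: deP].
pose S3 := 3 * S0%:R : R.
have S31 : 1 <= S3 by rewrite /S3; have : 1 <= S0%:R :> R by [rewrite ler1n]; lra.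
have S30 : 0 < S3 by exact: lt_le_trans S31.
exists (Num.min (Num.min d1 d2) (Num.min 1 (Num.min d3 d4) / S3)) => [|h x h0].
  by rewrite !lt_min d10 d20 /= divr_gt0 // !lt_min ltr01 d30 d40.
rewrite !le_min ler_pdivlMr // !le_min => /and3P[/andP[hd1 hd2] hS1 /andP[hS3 hS4]] xm.
have hS : h <= h * S3 by rewrite ler_peMr // ltW.
have near_m y : `|y - x| <= 1 -> `|y| <= m.+1%:R.
  move=> yx; have -> : y = (y - x) + x by rewrite subrK.
  by apply: le_trans (ler_normD _ _) _; rewrite -natr1 addrC lerD.
have x0 : `|x - 0| <= m%:R by rewrite subr0.
pose Q i j := pd i (pd j W) x; pose P i := pd i W x.
have := @Lh_approx R n bp bm h (ds m) W x P Q (2 * e) Bm S0 h0 _ S01 Bm0.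
rewrite -/K (@directions_quadratic R n a (ds m) x Q); last first.
- by move=> i j; exact: C2_symmetric.
- by move=> i j; apply: dsE; apply: le_trans xm _; rewrite ler_nat.
under [X in `|_ - (_ + X)|]eq_bigr do rewrite bpm.
have -> : K * (2 * e) = eps * (K / (K + 1)).
  by rewrite /e; field; rewrite gt_eqF // ltr_wpDl.
rewrite -/(Lop a b W x) => H; apply: le_trans (H _ _ _ _ _ _ _) _.
- by rewrite mulr_ge0 // ltW.
- move=> y i j yx; have yx' : `|y - x| <= h * S3 by rewrite /S3 mulrCA.
  have := d2P h y i j h0 hd2 (near_m y (le_trans yx' hS1)).
  have := d4P i j x y xm; rewrite distrC => /(_ (le_trans yx' hS4)).
  rewrite /Q; move: (pd i _ x) (pd i _ y) (df _ _ y) => q1 q2 D h1 h2.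
  have -> : D - h ^+ 2 * q1 = (D - h ^+ 2 * q2) - h ^+ 2 * (q1 - q2) by ring.
  apply: le_trans (ler_normB _ _) _; rewrite mulrDl mul1r mulrDr; apply: lerD => //.
  by rewrite normrM (ger0_norm (sqr_ge0 h)); apply: ler_wpM2l => //; exact: sqr_ge0.
- move=> y i yx; have yx' : `|y - x| <= h * S3 by apply: le_trans hS.
  have := d1P h y i h0 hd1 (near_m y (le_trans yx' hS1)).
  have := d3P i x y xm; rewrite distrC => /(_ (le_trans yx' hS3)).
  rewrite /P; move: (pd i _ x) (pd i _ y) (df _ _ y) => q1 q2 D h1 h2.
  have -> : D - h * q1 = (D - h * q2) - h * (q1 - q2) by ring.
  apply: le_trans (ler_normB _ _) _; rewrite mulrDl mul1r mulrDr; apply: lerD => //.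
  by rewrite normrM (ger0_norm (ltW h0)); apply: ler_wpM2l => //; exact: ltW.
- by move=> d /B1P[].
- by move=> d /B1P[_ /(_ x x x0 x0)[q _]]; apply: le_trans q _; rewrite /Bm; lra.
- by move=> i; have [q _] := B2P i x x x0 x0; apply: le_trans q _; rewrite /Bm; lra.
- by move=> i; have [q _] := B3P i x x x0 x0; apply: le_trans q _; rewrite /Bm; lra.
rewrite ger_pMr // ler_pdivrMr ?ltr_wpDl // mul1r lerDl //.
Qed.

Hypotheses (Gub : forall u, 0 <= u -> has_ubound (Gset f u)) (Glip : loc_lip0 (Gsup f)).
Variable c : R.
Hypotheses (c0 : 0 <= c) (cneg : forall u, c <= u -> Gsup f u < 0).
Local Notation G := (Gsup f).
Ltac prune3 := clear - a b f W ds c W0 WC Weq al0 al1 blh flip f0 WS dslh ds0 dsE dsA Gub Glip c0 cneg.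

Lemma Gsup_ge x u v : 0 <= u -> u <= v -> f x v - f x (v - u) <= G u.
Proof. by move=> u0 uv; apply: (ub_le_sup (Gub u0)); exists x => //; exists v. Qed.

(** What the passage to the limit retains of the m-th scheme. In [ss_tauh] the factor [m.+1] makes
    the step restriction hold eventually for the coefficients on any fixed ball. *)
Record scheme_spec (T : R) (m : nat) (h tau : R) (U : nat -> V -> R) : Prop := SchemeSpec {
  ss_h : 0 < h; ss_hm : h <= m.+1%:R^-1;
  ss_stencil : forall d, d \in ds m -> h * (size d.1)%:R <= 1;
  ss_tau : 0 < tau; ss_tauh : tau * m.+1%:R <= h ^+ 2;
  ss_init : forall x, `|x| < m%:R -> U 0%N x = W x;
  ss_eq : forall k x, `|x| < m%:R -> U k.+1 x = U k x + tau * (L h m (U k) x + Hf x (U k x));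
  ss_ge0 : forall k x, 0 <= U k x;
  ss_le : forall k x, k%:R * tau <= m%:R -> U k x <= W x + m.+1%:R^-1;
  ss_dec : forall k x, T < k%:R * tau -> k%:R * tau <= m%:R -> U k x <= c;
  ss_mono : forall w v x, `|x| < m%:R -> (forall y, `|y - x| <= 1 -> w y <= v y) -> 0 <= w x ->
    w x + tau * (L h m w x + Hf x (w x)) <= v x + tau * (L h m v x + Hf x (v x));
  ss_cons : forall x, `|x| <= m%:R -> `|L h m W x - Lop a b W x| <= 1 }.

(** The value 0 off the ball amounts to prescribing [u = W] there. *)
Fixpoint scheme_iter (m : nat) (h tau : R) (k : nat) (x : V) : R :=
  if `|x| < m%:R then
    if k is k'.+1 then scheme_iter m h tau k' x +
      tau * (L h m (scheme_iter m h tau k') x + Hf x (scheme_iter m h tau k' x))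
    else W x
  else 0.

Section Fixed.
Variables (m : nat) (h tau eps BB C de : R).
Hypotheses (tau0 : 0 < tau) (eps0 : 0 < eps).
Hypothesis mono : forall w v x, `|x| < m%:R -> (forall y, `|y - x| <= 1 -> w y <= v y) -> 0 <= w x ->
    w x + tau * (L h m w x + Hf x (w x)) <= v x + tau * (L h m v x + Hf x (v x)).
Hypothesis cons : forall x, `|x| <= m%:R -> `|L h m W x - Lop a b W x| <= eps.
Local Notation U := (scheme_iter m h tau).

Lemma scheme_out k x : m%:R <= `|x| -> U k x = 0.
Proof. by case: k => [|k] mx /=; rewrite ltNge mx. Qed.

Lemma scheme_ge0 k x : 0 <= U k x.
Proof.
elim: k x => [|k IH] x /=; case: ifP => // xm.
have := @mono (fun=> 0) (U k) x xm (fun y _ => IH y) (lexx _).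
by rewrite Lh_cst Hf0 addr0 mulr0 addr0.
Qed.

(** [W] plus [eps] times the time is a supersolution: [W] is stationary up to the consistency error,
    and above [W] the clipped reaction keeps the value [f(x, W)]. *)
Lemma scheme_le k x : U k x <= W x + eps * (k%:R * tau).
Proof.
elim: k x => [|k IH] x.
  by rewrite mul0r mulr0 addr0 /=; case: ifP.
have p k' : 0 <= eps * (k'%:R * tau) by rewrite !mulr_ge0 // ltW.
rewrite /=; case: ifP => xm; last by rewrite addr_ge0.
pose v y := W y + 0 * W y + eps * (k%:R * tau).
have vE y : v y = W y + eps * (k%:R * tau) by rewrite /v mul0r addr0.
apply: le_trans (@mono (U k) v x xm _ (scheme_ge0 k x)) _.
  by move=> y _; rewrite vE.
have -> : Hf x (v x) = f x (W x).
  rewrite vE /Hf max_r ?f0 ?subr0 // opprD addrA subrr sub0r oppr_le0 //.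
rewrite Lh_comb mul0r addr0 vE.
have := cons (ltW xm); rewrite ler_norml => /andP[_ q]; have E := Weq x.
have : L h m W x + f x (W x) <= eps by move: q E; lra.
move=> /(ler_wpM2l (ltW tau0)) q'.
rewrite -[k.+1%:R]natr1 mulrDl mul1r mulrDr addrA; lra.
Qed.

Hypotheses (cB : c <= BB) (WB : forall x, `|x| < m%:R -> W x <= BB) (C0 : 0 <= C) (de0 : 0 < de).
Hypothesis GC : forall u v, 0 <= u <= BB -> 0 <= v <= BB -> `|G u - G v| <= C * `|u - v|.
Hypothesis Gde : forall u, c <= u -> u <= BB -> G u <= - de.
Hypotheses (Ceps : C * (eps * m%:R) <= de / 4) (Ctau : C * tau <= 1 / 2).

(** Comparison with the constant function equal to the current Euler value [y]; it remains to bound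
    the reaction at [y] by half of [G y], or to reach the next Euler value otherwise. *)
Lemma scheme_decay k x : k%:R * tau <= m%:R -> U k x <= euler G c tau BB k.
Proof.
elim: k x => [|k IH] x km.
  by rewrite /=; case: ifP => xm; [exact: WB|exact: le_trans c0 cB].
have eg j : c <= euler G c tau BB j by exact: euler_ge.
case: (leP m%:R `|x|) => xm; first by rewrite scheme_out //; exact: le_trans c0 (eg _).
have {}IH y : U k y <= euler G c tau BB k.
  by apply: IH; apply: le_trans km; rewrite ler_wpM2r ?(ltW tau0) // ler_nat.
have := eg k.+1; have := eg k; have yB : euler G c tau BB k <= BB.
  by apply: euler_le => //; exact: ltW.
have := scheme_le k.+1 x; have : U k.+1 x <= euler G c tau BB k + tau * Hf x (euler G c tau BB k).
  rewrite /= xm; apply: le_trans (@mono (U k) (fun=> euler G c tau BB k) x xm _ (scheme_ge0 k x)) _.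
    by move=> y _; exact: IH.
  by rewrite Lh_cst add0r.
have : euler G c tau BB k + tau / 2 * G (euler G c tau BB k) <= euler G c tau BB k.+1 by rewrite /= le_max lexx orbT.
move: yB; move: (euler G c tau BB k) (euler G c tau BB k.+1) (U k.+1 x) => y y' u yB yy' u1 u2 cy cy'.
have Gy := Gde cy yB.
have y0 : 0 <= y := le_trans c0 cy.
have G0 : 0 <= - G y by move: Gy de0; lra.
have tG : tau * (G y) <= tau / 2 * G y.
  have : 0 <= tau * (- G y) by apply: mulr_ge0 => //; exact: ltW.
  by lra.
(* For [y <= W x] the reaction is [f x (W x) - f x (W x - y)], one of the quantities whose supremum
   is [G y]. *)
case: (leP y (W x)) => wy.
  apply: le_trans u1 _; apply: le_trans yy'; rewrite lerD2l.
  apply: le_trans tG; rewrite ler_pM2l // /Hf max_l ?subr_ge0 //; exact: Gsup_ge.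
rewrite /Hf max_r ?subr_le0 ?(ltW wy) // f0 subr0 in u1.
(* For [y > W x] the reaction is only [f x (W x) <= G (W x)]. Unless the bound by [W] plus the
   accumulated error settles the claim, it forces [y - W x] to be small, and the Lipschitz bound
   gives [G (W x) <= G y / 2]: this is where half of the speed is given up. *)
case: (leP (W x + eps * (k.+1%:R * tau)) y') => H1; first exact: le_trans u2 H1.
have H2 : f x (W x) <= G (W x) by have := Gsup_ge x (W0 x) (lexx (W x)); rewrite subrr f0 subr0.
have H3 : G (W x) - G y <= C * (y - W x).
  have -> : y - W x = `|W x - y| by rewrite distrC gtr0_norm // subr_gt0.
  apply: le_trans (ler_norm _) _; apply: GC.
    by rewrite W0 /= (le_trans (ltW wy)).
  by rewrite y0.
have H4 : y - W x <= eps * m%:R + tau / 2 * (- G y).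
  have : eps * (k.+1%:R * tau) <= eps * m%:R by rewrite ler_pM2l.
  by lra.
have H5 := ler_wpM2l C0 H4.
have H6 : C * tau * (- G y) <= 1 / 2 * (- G y) by rewrite ler_wpM2r.
have H7 : G (W x) <= 1 / 2 * G y by move: Ceps de0 H3 H5 H6 Gy; lra.
apply: le_trans u1 _; apply: le_trans yy'; rewrite lerD2l.
have := ler_wpM2l (ltW tau0) (le_trans H2 H7); lra.
Qed.

End Fixed.

Lemma scheme_family (A : R) : 0 <= A -> (forall u, A <= u -> G u < 0) ->
  (\int[lebesgue_measure]_(u in `[A, +oo[) ((- G u)^-1)%:E < +oo)%E ->
  exists2 T, 0 <= T & forall m, exists h tau U, scheme_spec T m h tau U.
Proof.
move=> A0 An Aint.
have [T T0 TP] := euler_decay Glip A0 An Aint c0 cneg.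
exists T => // m.
have cW : continuous W by case: WC.
have [B0 B00 B0P] := @continuous_bounded_ball R n W m%:R cW.
pose BB := Num.max c B0.
have cB : c <= BB by rewrite le_max lexx.
have [C' C'P] := Glip BB; pose C := `|C'|.
have C0 : 0 <= C by exact: normr_ge0.
have GC u v : 0 <= u <= BB -> 0 <= v <= BB -> `|G u - G v| <= C * `|u - v|.
  by move=> ub vb; apply: le_trans (C'P u v ub vb) _; rewrite ler_wpM2r // ler_norm.
clearbody C.
have [de de0 deP] := negative_gap Glip c0 cneg BB.
have [LH LH0 LHP] := @Hf_lip m%:R 0 (lexx _).
pose eps' := Num.min 1 (de / (4 * (C + 1))).
have C1 : 0 < C + 1 by rewrite ltr_wpDl.
have eps'0 : 0 < eps' by rewrite lt_min ltr01 divr_gt0 // mulr_gt0.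
have eps'1 : eps' <= 1 by rewrite ge_min lexx.
have eps'C : C * eps' <= de / 4.
  have : eps' * (4 * (C + 1)) <= de by rewrite -ler_pdivlMr ?mulr_gt0 // ge_min lexx orbT.
  by move: eps'0; lra.
clearbody eps'.
have m1 : 0 < m.+1%:R :> R by rewrite ltr0n.
(* Consistency errors accumulate up to time [m]; the square leaves a total of at most
   [eps' / m.+1]. *)
pose eps := eps' / m.+1%:R ^+ 2.
have m1_2 : 0 < m.+1%:R ^+ 2 :> R by rewrite exprn_gt0.
have eps0 : 0 < eps by rewrite divr_gt0.
have mle : m%:R <= m.+1%:R :> R by rewrite ler_nat.
have m1ge : 1 <= m.+1%:R :> R by rewrite ler1n.
have epsm : eps * m%:R <= eps' / m.+1%:R.
  have -> : eps' / m.+1%:R = eps * m.+1%:R by rewrite /eps; field; rewrite gt_eqF.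
  by rewrite ler_wpM2l // ltW.
have epsm' : eps' / m.+1%:R <= eps' by rewrite ler_pdivrMr // ler_peMr // ltW.
have eps1 : eps <= 1.
  by rewrite /eps ler_pdivrMr // mul1r; apply: le_trans eps'1 _; rewrite -[leLHS](expr1n _ 2) ler_pXn2r ?nnegrE.
have [dh dh0 dhP] := W_consistent m eps0.
have [B1 [S0 [B10 S01 B1P]]] := directions_bounded al0 (0 : V) m%:R (@dslh m).
have [B2 B20 B2P] := family_bounded al0 (0 : V) m%:R bp_lh.
have [B3 B30 B3P] := family_bounded al0 (0 : V) m%:R bm_lh.
have S00 : 0 < S0%:R :> R by rewrite ltr0n.
pose h := Num.min (Num.min dh m.+1%:R^-1) S0%:R^-1.
have h0 : 0 < h by rewrite !lt_min dh0 !invr_gt0 m1.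
have hdh : h <= dh by rewrite !ge_min lexx.
have hm : h <= m.+1%:R^-1 by rewrite !ge_min lexx orbT.
have h1 : h <= 1 by apply: le_trans hm _; rewrite invf_le1.
have hS : h * S0%:R <= 1 by rewrite -ler_pdivlMr // div1r !ge_min lexx !orbT.
clearbody h.
pose Lam := (size (ds m))%:R * (2 * B1 / h ^+ 2) + n%:R * ((B2 + B3) / h).
have Lam0 : 0 <= Lam.
  apply: addr_ge0; apply: mulr_ge0 => //; apply: divr_ge0; rewrite ?(ltW h0) ?sqr_ge0 //.
    exact: mulr_ge0.
  exact: addr_ge0.
have LamP x : `|x| <= m%:R -> \sum_(d <- ds m) 2 * d.2 x / h ^+ 2 + \sum_i (bp i x + bm i x) / h <= Lam.
  move=> xm; have x0 : `|x - 0| <= m%:R by rewrite subr0.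
  apply: lerD.
    have -> : (size (ds m))%:R * (2 * B1 / h ^+ 2) = \sum_(d <- ds m) (2 * B1 / h ^+ 2).
      by rewrite big_const_seq count_predT iter_addr_0 -mulr_natl; ring.
    rewrite big_seq [leRHS]big_seq; apply: ler_sum => d /B1P[_ /(_ x x x0 x0)[q _]].
    rewrite ler_wpM2r ?invr_ge0 ?sqr_ge0 // ler_wpM2l //; exact: le_trans (ler_norm _) q.
  have -> : n%:R * ((B2 + B3) / h) = \sum_(i < n) ((B2 + B3) / h).
    by rewrite sumr_const card_ord -mulr_natl; ring.
  apply: ler_sum => i _; rewrite ler_wpM2r ?invr_ge0 ?(ltW h0) //.
  have [q1 _] := B2P i x x x0 x0; have [q2 _] := B3P i x x x0 x0.
  by apply: lerD; apply: le_trans (ler_norm _) _.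
clearbody Lam.
pose D := Lam + LH + 2 * C + 1.
have D0 : 0 < D by rewrite /D; lra.
pose tau := Num.min (h ^+ 2 / m.+1%:R) D^-1.
have tau0 : 0 < tau by rewrite lt_min divr_gt0 ?exprn_gt0 // invr_gt0.
have tauh : tau * m.+1%:R <= h ^+ 2 by rewrite -ler_pdivlMr // ge_min lexx.
have tauD : tau * D <= 1 by rewrite -ler_pdivlMr // div1r ge_min lexx orbT.
clearbody tau.
have p1 : 0 <= tau * LH by rewrite mulr_ge0 // ltW.
have p2 : 0 <= tau * C by rewrite mulr_ge0 // ltW.
have p3 : 0 <= tau * Lam by rewrite mulr_ge0 // ltW.
have tL : tau * (Lam + LH) <= 1 by move: tauD p2 tau0; rewrite /D; prune3; lra.
have tC : 2 * (C * tau) <= 1 by move: tauD p1 p3 tau0; rewrite /D; prune3; lra.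
have mono w v x : `|x| < m%:R -> (forall y, `|y - x| <= 1 -> w y <= v y) -> 0 <= w x ->
    w x + tau * (L h m w x + Hf x (w x)) <= v x + tau * (L h m v x + Hf x (v x)).
  move=> xm wv w0; have xm' := ltW xm.
  have wvx : w x <= v x by apply: wv; rewrite subrr normr0.
  apply: (@step_mono R n bp bm h tau (ds m) w v x Lam LH (Hf x)) => //.
  - by move=> d dd; apply: ds0 dd _; apply: le_trans xm' _.
  - move=> d /B1P[q _]; apply: le_trans hS; rewrite ler_wpM2l ?(ltW h0) // ler_nat //.
  - by move=> i; exact: bp_ge0.
  - by move=> i; exact: bm_ge0.
  - exact: LamP.
  - exact: ltW.
  - have := LHP x x (w x) (v x) xm' xm'; rewrite oppr0 subrr normr0 add0r => /(_ w0 (le_trans w0 wvx)) q.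
    by apply: le_trans (ler_norm _) _; apply: le_trans q _; rewrite distrC ger0_norm ?subr_ge0.
have cons x : `|x| <= m%:R -> `|L h m W x - Lop a b W x| <= eps by exact: dhP.
exists h, tau, (scheme_iter m h tau); split => //.
- by move=> d /B1P[q _]; apply: le_trans hS; rewrite ler_wpM2l ?(ltW h0) // ler_nat.
- by move=> x xm /=; rewrite xm.
- by move=> k x xm; rewrite [LHS]/= xm.
- exact: scheme_ge0.
- move=> k x km; apply: le_trans (scheme_le tau0 eps0 mono cons k x) _; rewrite lerD2l.
  apply: le_trans (ler_wpM2l (ltW eps0) km) _; apply: le_trans epsm _.
  by rewrite ler_pdivrMr // mulVf ?gt_eqF.
- move=> k x kT km.
  have <- : euler G c tau BB k = c.
    by apply: (TP BB tau C) => //; move: tC p2; prune3; lra.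
  apply: (scheme_decay tau0 eps0 mono cons cB _ C0 de0 GC) => //.
  + by move=> y /ltW/B0P ym; rewrite le_max (le_trans (ler_norm _) ym) orbT.
  + by apply: le_trans eps'C; apply: ler_wpM2l => //; exact: le_trans epsm epsm'.
  + by move: tC; prune3; lra.
- by move=> x xm; apply: le_trans (cons x xm) eps1.
Qed.

Lemma qn_scale (h : R) (v : V) : qn (h *: v) = h ^+ 2 * qn v.
Proof. by rewrite /qn mulr_sumr; apply: eq_bigr => i _; rewrite mxE exprMn. Qed.

Lemma qn_shift_coord (x : V) (h : R) i : qn (x + h *: evec R i) - qn x = 2 * h * x 0 i + h ^+ 2.
Proof.
rewrite /qn -sumrB (bigD1 i) //= big1 => [|j ji]; rewrite coord_add_evec.
  by rewrite eqxx mulr1; ring.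
by rewrite (negbTE ji) mulr0 addr0 subrr.
Qed.

Lemma L_agree (N m : nat) h w (x : V) : (N <= m)%N -> `|x| <= N%:R -> L h m w x = L h N w x.
Proof. by move=> Nm xN; apply: Lh_eq_op => F; exact: dsA. Qed.

(** Keeps [z] close to [W] near [x0] for short times, which gives the initial values and continuity
    at time 0. [B] bounds [W] near [x0], so the barrier is nonpositive at distance 1 or more from
    [x0]; the linear term in time absorbs the operator and the reaction. *)
Lemma scheme_barrier (x0 : V) : exists B K (N : nat), [/\ 0 <= B, 0 <= K & forall T m h tau U,
  scheme_spec T m h tau U -> (N <= m)%N -> forall k x, `|x - x0| <= 2 ->
  W x - B * qn (x - x0) - K * (k%:R * tau) <= U k x].
Proof.
have [N NP] := nat_above (`|x0| + 3).
have cW : continuous W by case: WC.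
have [B B0 BP] := @continuous_bounded_ball R n W N%:R cW.
have [LH LH0 LHP] := @Hf_lip N%:R 0 (lexx _).
have [B1 [S0 [B10 S01 B1P]]] := directions_bounded al0 (0 : V) N%:R (@dslh N).
have [B2 B20 B2P] := family_bounded al0 (0 : V) N%:R bp_lh.
have [B3 B30 B3P] := family_bounded al0 (0 : V) N%:R bm_lh.
pose K2 := \sum_(d <- ds N) B1 * (2 * qn (vec R d.1)) + n%:R * (5 * B2 + 5 * B3).
have K20 : 0 <= K2.
  apply: addr_ge0; first by apply: sumr_ge0 => d _; apply: mulr_ge0 => //; apply: mulr_ge0 => //; exact: qn_ge0.
  by apply: mulr_ge0 => //; apply: addr_ge0; apply: mulr_ge0.
pose q y := qn (y - x0).
have inN x : `|x - x0| <= 2 -> `|x| <= N%:R - 1.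
  by move=> xx; have -> : x = (x - x0) + x0 by [rewrite subrK]; apply: le_trans (ler_normD _ _) _; lra.
have Lq h x : 0 < h -> h <= 1 -> `|x - x0| <= 1 -> `|L h N q x| <= K2.
  move=> h0 h1 xx.
  have h20 : 0 < h ^+ 2 by rewrite exprn_gt0.
  have xN : `|x - 0| <= N%:R by rewrite subr0; have := inN x; lra.
  rewrite /Lh; apply: le_trans (ler_normD _ _) _; apply: lerD.
    apply: le_trans (ler_norm_sum _ _ _) _; rewrite big_seq [leRHS]big_seq; apply: ler_sum => d /B1P[_ /(_ x x xN xN)[dB _]].
    have -> : sd h d.1 q x / h ^+ 2 = 2 * qn (vec R d.1).
      have := qn_second_difference (x - x0) (h *: vec R d.1); rewrite /sd /q.
      have e1 : x + h *: vec R d.1 - x0 = x - x0 + h *: vec R d.1 by rewrite addrAC.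
      have e2 : x - h *: vec R d.1 - x0 = x - x0 - h *: vec R d.1 by rewrite addrAC.
      by rewrite e1 e2 => ->; rewrite qn_scale; field; rewrite gt_eqF.
    rewrite normrM (ger0_norm (mulr_ge0 _ (qn_ge0 _))) //; apply: ler_wpM2r => //.
    by apply: mulr_ge0 => //; exact: qn_ge0.
  rewrite /drift; apply: le_trans (ler_norm_sum _ _ _) _.
  have -> : n%:R * (5 * B2 + 5 * B3) = \sum_(i < n) (5 * B2 + 5 * B3).
    by rewrite sumr_const card_ord -mulr_natl; ring.
  apply: ler_sum => i _.
  have [b2 _] := B2P i x x xN xN; have [b3 _] := B3P i x x xN xN.
  have dq y : `|y - x0| <= 2 -> `|df (h *: evec R i) q y / h| <= 5.
    move=> yx; rewrite /df /q (addrAC y) qn_shift_coord.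
    have -> : (2 * h * (y - x0) 0 i + h ^+ 2) / h = 2 * (y - x0) 0 i + h by field; rewrite gt_eqF.
    have := coord_le_norm (y - x0) i; rewrite !ler_norml => /andP[p1 p2].
    by apply/andP; split; lra.
  have d1 : `|df (h *: evec R i) q x / h| <= 5 by apply: dq; lra.
  have d2 : `|df (h *: evec R i) q (x - h *: evec R i) / h| <= 5.
    apply: dq; rewrite addrAC; apply: le_trans (ler_normB _ _) _.
    have := norm_scale_evec i (ltW h0); lra.
  apply: le_trans (ler_normB _ _) _; rewrite !normrM -!normrM ![5 * _]mulrC; apply: lerD; rewrite normrM; exact: ler_pM.
exists B, (1 + 2 * (LH * B) + B * K2), N; split => //.
  have p1 : 0 <= LH * B by exact: mulr_ge0.
  have p2 : 0 <= B * K2 by exact: mulr_ge0.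
  lra.
move=> T m h tau U S Nm; elim=> [|k IH] x xx.
  have xm : `|x| < m%:R.
    apply: le_lt_trans (inN x xx) _; apply: (@lt_le_trans _ _ N%:R); last by rewrite ler_nat.
    by rewrite ltrBlDr ltrDl.
  rewrite (ss_init S xm) mul0r mulr0 subr0 gerBl; apply: mulr_ge0 => //; exact: qn_ge0.
have tau0 := ss_tau S.
have h0 := ss_h S.
have h1 : h <= 1 by apply: le_trans (ss_hm S) _; rewrite invf_le1 ?ltr0n // ler1n.
have xN := inN x xx.
have WB : W x <= B by apply: le_trans (ler_norm _) (BP x _); lra.
have p0 : 0 <= LH * B by exact: mulr_ge0.
have pp : 0 <= (1 + 2 * (LH * B) + B * K2).
  have p2 : 0 <= B * K2 by exact: mulr_ge0.
  lra.
have pk j : 0 <= (1 + 2 * (LH * B) + B * K2) * (j%:R * tau) by apply: mulr_ge0 => //; apply: mulr_ge0 => //; exact: ltW.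
case: (leP 1 `|x - x0|) => x1.
  apply: le_trans (ss_ge0 S _ _); have := pk k.+1.
  have : B <= B * qn (x - x0).
    rewrite ler_peMr //; apply: le_trans (sqr_norm_le_qn _); rewrite -[leLHS](expr1n _ 2) ler_pXn2r ?nnegrE //.
  by lra.
(* Where the barrier is negative, nonnegativity of the scheme suffices; elsewhere the comparison
   function is nonnegative at [x], as [ss_mono] demands. *)
case: (leP 0 (W x - B * qn (x - x0) - (1 + 2 * (LH * B) + B * K2) * (k.+1%:R * tau))) => ph; last first.
  exact: le_trans (ltW ph) (ss_ge0 S _ _).
have xm : `|x| < m%:R.
  apply: le_lt_trans xN _; apply: (@lt_le_trans _ _ N%:R); last by rewrite ler_nat.
  by rewrite ltrBlDr ltrDl.
set K := 1 + _ + _ in ph pp pk IH *.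
pose w y := W y + (- B) * q y + (- (K * (k%:R * tau))).
have wE y : w y = W y - B * qn (y - x0) - K * (k%:R * tau) by rewrite /w mulNr.
have Kt : 0 <= K * tau by rewrite mulr_ge0 // ltW.
have kS : K * (k.+1%:R * tau) = K * (k%:R * tau) + K * tau by rewrite -[k.+1%:R]natr1; ring.
have w0 : 0 <= w x by rewrite wE; move: ph; rewrite kS; lra.
rewrite (ss_eq S k xm); apply: le_trans (ss_mono S (w := w) xm _ w0); last first.
  move=> y yx; rewrite wE; apply: IH.
  have -> : y - x0 = (y - x) + (x - x0) by rewrite addrA subrK.
  by apply: le_trans (ler_normD _ _) _; lra.
have wB : w x <= B.
  rewrite wE; have := pk k; have : 0 <= B * qn (x - x0) by apply: mulr_ge0 => //; exact: qn_ge0.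
  by lra.
have xN' : `|x| <= N%:R by lra.
have H1 : - (LH * B) <= Hf x (w x).
  have := LHP x x (w x) 0 xN' xN'; rewrite oppr0 subrr normr0 add0r addr0 Hf0 subr0 => /(_ w0 (lexx _)).
  rewrite ler_norml => /andP[q1 _]; apply: le_trans q1; rewrite lerN2; apply: ler_wpM2l => //.
  by rewrite ger0_norm.
have H2 : - (LH * B) - 1 <= L h m W x.
  have := LHP x x (W x) 0 xN' xN'; rewrite oppr0 subrr normr0 add0r addr0 Hf0 subr0 => /(_ (W0 x) (lexx _)).
  have -> : Hf x (W x) = - Lop a b W x by rewrite /Hf subrr maxxx f0 subr0; have := Weq x; lra.
  rewrite (ger0_norm (W0 x)) normrN ler_norml => /andP[q1 _].
  have q2 : LH * W x <= LH * B by exact: ler_wpM2l.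
  have := ss_cons S (ltW xm); rewrite ler_norml => /andP[q3 _]; lra.
have H3 : B * L h m q x <= B * K2.
  by apply: ler_wpM2l => //; rewrite (L_agree _ _ Nm xN'); apply: le_trans (ler_norm _) (Lq h x h0 h1 (ltW x1)).
have H4 : - K <= L h m w x + Hf x (w x).
  rewrite /w Lh_comb -/w /K; move: H1 H2 H3; rewrite -/(w x); lra.
have := ler_wpM2l (ltW tau0) H4; rewrite wE kS; lra.
Qed.

Hypothesis dsc : forall m, exists2 c0, 0 < c0 & forall i, exists d, [/\ d \in ds m, d.1 = [:: (i, true)]
  & forall x, `|x| <= m.+1%:R -> c0 <= d.2 x].

Local Notation E h i := (h *: evec R i).
Ltac prune := clear - a b f W ds c W0 WC Weq al0 al1 blh flip f0 WS dslh ds0 dsE dsA Gub Glip c0 cneg dsc.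

(** The directions of a fixed stage [N1] are used near [x0], where they define the same operator as
    those of any later stage; the Schauder constant therefore does not depend on [m]. *)
Lemma local_bounds (x0 : V) (t0 : R) : 0 < t0 -> exists rho K (N : nat), [/\ 0 < rho, 0 <= K &
  forall T m h tau U, scheme_spec T m h tau U -> (N <= m)%N -> forall k x, `|x - x0| <= rho ->
  `|k%:R * tau - t0| <= rho ->
  [/\ forall i, `|df (E h i) (U k) x| <= h * K,
      forall i j, `|df (E h i) (df (E h j) (U k)) x| <= h ^+ 2 * K
    & forall i j l d, (0 < d)%N -> d%:R * h <= rho ->
       `|df (d%:R *: E h l) (df (E h i) (df (E h j) (U k))) x| <= h ^+ 2 * (K * (d%:R * h) `^ al)]].
Proof.
move=> t00; pose s0 := Num.min 1 t0.
have s00 : 0 < s0 by rewrite lt_min ltr01.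
have s01 : s0 <= 1 by rewrite ge_min lexx.
have s0t : s0 <= t0 by rewrite ge_min lexx orbT.
clearbody s0.
have [N1 N1P] := nat_above (`|x0| + 3).
have cW : continuous W by case: WC.
have [B B0 BP] := @continuous_bounded_ball R n W N1%:R cW.
pose M := B + 1; have M0 : 0 <= M by rewrite /M; lra.
have [LH LH0 LHP] := @Hf_lip N1%:R M M0.
have [B1 [S0 [B10 S01 B1P]]] := directions_bounded al0 (0 : V) N1%:R (@dslh N1).
have [B2 B20 B2P] := family_bounded al0 (0 : V) N1%:R bp_lh.
have [B3 B30 B3P] := family_bounded al0 (0 : V) N1%:R bm_lh.
pose Bm := B1 + B2 + B3.
have [b1 b2 b3] : [/\ B1 <= Bm, B2 <= Bm & B3 <= Bm] by rewrite /Bm; split; lra.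
have Bm0 : 0 <= Bm by exact: le_trans b1.
clearbody Bm.
have [cc cc0 ccP] := dsc N1.
have [NN NN0 NNP] := schauder_uniform al0 al1 n (size (ds N1)) Bm0 Bm0 LH0 cc0 M0 s00 s01 S01.
(* Small enough for the margins of 5, 6 and 12 lengths in the interpolation lemmas to fit into the
   half cylinder. *)
pose r := s0 / 100; have r0 : 0 < r by rewrite divr_gt0.
have omM x y : 0 <= x -> 0 <= y -> (x * y) `^ al = x `^ al * y `^ al by exact: powRM.
have om_le x y : 0 <= x -> x <= y -> x `^ al <= y `^ al by apply: pow_le.
have om_ge x : 0 <= x -> x <= 1 -> x <= x `^ al by apply: pow_ge.
have om1 : 1 `^ al = 1 :> R by exact: pow_1.
have om2 : 1 < 2 `^ al :> R by exact: pow_2_gt1.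
have om22 : 2 `^ al <= 2 :> R by exact: pow_2_le2.
pose om := (fun x : R => x `^ al).
pose k1 := 20 * M / r + Ca om * NN * (r * om r).
pose k2 := 16 * M / r ^+ 2 + Ca om * NN * om r.
pose k3 := C4 om * NN.
pose K := `|k1| + `|k2| + `|k3|.
have [kk1 kk2 kk3] : [/\ k1 <= K, k2 <= K & k3 <= K].
  have := ler_norm k1; have := ler_norm k2; have := ler_norm k3.
  have := normr_ge0 k1; have := normr_ge0 k2; have := normr_ge0 k3.
  by rewrite /K; prune; split; lra.
have K0 : 0 <= K by rewrite /K !addr_ge0.
clearbody K.
have [N2 N2P] := nat_above (2 * ((size (ds N1))%:R * Bm) + 3 * Bm).
have [N3 N3P] := nat_above (t0 + 1).
have [N4 N4P] := nat_above r^-1.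
exists r, K, (maxn (maxn N1 N2) (maxn N3 N4)); split => // T m h tau U S.
rewrite !geq_max => /andP[/andP[m1 m2] /andP[m3 m4]].
have tau0 := ss_tau S; have h0 := ss_h S; have tauh := ss_tauh S.
have mN (N : nat) : (N <= m)%N -> N%:R <= m.+1%:R :> R by move=> ?; rewrite ler_nat leqW.
have m10 : 0 < m.+1%:R :> R by rewrite ltr0n.
have h1 : h <= 1 by apply: le_trans (ss_hm S) _; rewrite invf_le1 // ler1n.
have hr : h <= r.
  apply: le_trans (ss_hm S) _; rewrite -[r]invrK lef_pV2 ?posrE ?invr_gt0 //.
  exact: le_trans N4P (mN _ m4).
have nx x : `|x - x0| <= s0 -> `|x| <= N1%:R - 1.
  by move=> xx; have -> : x = (x - x0) + x0 by [rewrite subrK]; apply: le_trans (ler_normD _ _) _; move: xx N1P s01; prune; lra.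
have nx1 x : `|x - x0| <= s0 -> `|x| <= N1%:R by move=> /nx; prune; lra.
have nx0 x : `|x - x0| <= s0 -> `|x - 0| <= N1%:R by rewrite subr0; exact: nx1.
have N3m : N3%:R <= m%:R :> R by rewrite ler_nat.
have N1m : N1%:R <= m%:R :> R by rewrite ler_nat.
have uM k x : `|x - x0| <= s0 -> t0 - s0 <= k%:R * tau -> k%:R * tau <= t0 + s0 -> `|U k x| <= M.
  move=> xx k1' k2'; rewrite ger0_norm ?(ss_ge0 S) //; apply: le_trans (ss_le S _ _) _; first by move: k2' N3P N3m s01; prune; lra.
  rewrite /M; apply: lerD; first by apply: le_trans (ler_norm _) (BP x (nx1 x xx)).
  by rewrite invf_le1 // ler1n.
have SO : scheme_on al h tau s0 (t0 - s0) (t0 + s0) M x0 U (ds N1) (fun d => d.1) (fun d => d.2) bp bm Hf Bm Bm LH cc S0.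
  split => //.
  - apply: le_trans tauh; rewrite ler_peMr ?(ltW tau0) // ler1n //.
  - by rewrite subr_ge0.
  - by move=> d x dd xx; apply: ds0 dd _; apply: le_trans (nx1 x xx) _; rewrite ler_nat.
  - move=> d x dd xx; have [_ q] := B1P d dd; have [q1 _] := q x x (nx0 x xx) (nx0 x xx).
    by apply: le_trans (ler_norm _) (le_trans q1 _).
  - move=> d x y dd xx yy; have [_ q] := B1P d dd; have [_ q1] := q x y (nx0 x xx) (nx0 y yy).
    by apply: le_trans q1 _; rewrite ler_wpM2r ?powR_ge0.
  - by move=> i x xx; have [q1 _] := B2P i x x (nx0 x xx) (nx0 x xx); apply: le_trans q1 _.
  - move=> i x y xx yy; have [_ q1] := B2P i x y (nx0 x xx) (nx0 y yy).
    by apply: le_trans q1 _; rewrite ler_wpM2r ?powR_ge0.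
  - by move=> i x xx; have [q1 _] := B3P i x x (nx0 x xx) (nx0 x xx); apply: le_trans q1 _.
  - move=> i x y xx yy; have [_ q1] := B3P i x y (nx0 x xx) (nx0 y yy).
    by apply: le_trans q1 _; rewrite ler_wpM2r ?powR_ge0.
  - move=> i; have [d [d1 d2 d3]] := ccP i; exists d; split => // x xx; apply: d3.
    by apply: le_trans (nx1 x xx) _; rewrite ler_nat.
  - by move=> d /B1P[].
  - move=> x y z z' xx yy zM z'M; apply: LHP; [exact: nx1|exact: nx1| |].
      by move: zM; rewrite ler_norml => /andP[].
    by move: z'M; rewrite ler_norml => /andP[].
  - have h20 : 0 < h ^+ 2 by rewrite exprn_gt0.
    rewrite mulrAC ler_pdivrMr // mul1r; apply: le_trans tauh; rewrite ler_wpM2l ?(ltW tau0) //.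
    exact: le_trans N2P (mN _ m2).
  - move=> k x xx _ _; rewrite (ss_eq S); last first.
      by apply: le_lt_trans (nx x xx) _; rewrite ltrBlDr (le_lt_trans N1m) // ltrDl.
    by rewrite (L_agree _ _ m1 (nx1 x xx)).
have TB := NNP _ _ _ _ _ _ _ _ _ _ _ _ _ erefl SO.
move=> k x xx kt.
have it : in_time tau s0 (t0 - s0) (t0 + s0) (s0 / 2) k.
  move: kt; rewrite ler_norml /in_time /r => /andP[q1 q2]; apply/andP; move: q1 q2 s00; prune; split; lra.
split.
- move=> i; have := @interpolation_first R n om omM om_le om_ge om1 om2 h tau s0 (t0 - s0) (t0 + s0) M x0 U h0 M0 uM (s0 / 2) NN k NN0 TB it _ r x i hr.
  move=> H; apply: le_trans (H _ _) _; [by move: s00; prune; lra|by move: xx s00; rewrite /r; prune; lra|].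
  by apply: ler_wpM2l => //; exact: ltW.
- move=> i j; have := @interpolation_second R n om omM om_le om_ge om1 om2 h tau s0 (t0 - s0) (t0 + s0) M x0 U h0 M0 uM (s0 / 2) NN k NN0 TB it _ r x i j hr.
  move=> H; apply: le_trans (H _ _) _; [by move: s00; prune; lra|by move: xx s00; rewrite /r; prune; lra|].
  by apply: ler_wpM2l => //; exact: sqr_ge0.
- move=> i j l d d0 dr; have := @second_holder R n om omM om_le om_ge om1 om2 om22 h tau s0 (t0 - s0) (t0 + s0) x0 U h0 (s0 / 2) NN k NN0 TB it d x i j l d0.
  move=> H; apply: le_trans (H _) _; first by move: xx dr s00; rewrite /r; prune; lra.
  by apply: ler_wpM2l; [exact: sqr_ge0|apply: ler_wpM2r => //; exact: powR_ge0].
Qed.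

Hypothesis alh : forall i j, lh (a i j).
Ltac prune9 := clear - a b f W ds c W0 WC Weq al0 al1 blh flip f0 WS dslh ds0 dsE dsA Gub Glip c0 cneg dsc alh.

Lemma qn_le (y : V) : qn y <= n%:R * `|y| ^+ 2.
Proof.
have -> : n%:R * `|y| ^+ 2 = \sum_(i < n) `|y| ^+ 2 by rewrite sumr_const card_ord mulr_natl.
apply: ler_sum => i _; rewrite -real_normK ?num_real // ler_pXn2r ?nnegrE //; exact: coord_le_norm.
Qed.

Lemma stationary_le (A : R) : 0 <= A -> (forall u, A <= u -> G u < 0) ->
  (\int[lebesgue_measure]_(u in `[A, +oo[) ((- G u)^-1)%:E < +oo)%E ->
  (forall u : V -> R -> R, classical_sol a b f (fun=> 0) u -> forall x t, 0 <= t -> u x t = 0) ->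
  forall x, W x <= c.
Proof.
move=> A0 An Aint uniq.
have [T T0 TP] := scheme_family A0 An Aint.
have /choice[g gP] : forall m, exists g : R * R * (nat -> V -> R), scheme_spec T m g.1.1 g.1.2 g.2.
  by move=> m; have [h [tau [U S]]] := TP m; exists (h, tau, U).
pose hh m := (g m).1.1; pose tt m := (g m).1.2; pose UU m := (g m).2.
have S m : scheme_spec T m (hh m) (tt m) (UU m) := gP m.
clearbody hh tt UU.
have [F [FU Foo]] := ultraFilterLemma (_ : ProperFilter \oo).
have cW : continuous W by case: WC.
have hh0 m := ss_h (S m); have hhm m := ss_hm (S m); have tt0 m := ss_tau (S m).
have UU0 m k x := ss_ge0 (S m) k x.
have m10 m : 0 < m.+1%:R :> R by rewrite ltr0n.
have hh1 m : hh m <= 1 by apply: le_trans (hhm m) _; rewrite invf_le1 // ler1n.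
have tth m : tt m <= hh m.
  apply: le_trans (_ : tt m * m.+1%:R <= _); first by rewrite ler_peMr ?ler1n // ltW.
  by apply: le_trans (ss_tauh (S m)) _; rewrite expr2 ger_pMr.
have LS (x0 : V) : exists (ds : seq dir) (Bm : R) (S0 N : nat), [/\ 0 <= Bm, (1 <= S0)%N,
  forall d, d \in ds -> (size d.1 <= S0)%N & forall x, `|x - x0| <= 1 ->
  [/\ forall d, d \in ds -> `|d.2 x| <= Bm, forall i, `|bp i x| <= Bm, forall i, `|bm i x| <= Bm,
      forall i j, \sum_(d <- ds) d.2 x * (vec R d.1 0 i * vec R d.1 0 j) = sa a i j x
    & forall m k, (N <= m)%N ->
      UU m k.+1 x = UU m k x + tt m * (Lh bp bm (hh m) ds (UU m k) x + Hf x (UU m k x)) /\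
      (k%:R * tt m <= m%:R -> UU m k x <= Bm)]].
  have [N1 N1P] := nat_above (`|x0| + 3).
  have [B B0 BP] := @continuous_bounded_ball R n W N1%:R cW.
  have [B1 [S0 [B10 S01 B1P]]] := directions_bounded al0 (0 : V) N1%:R (@dslh N1).
  have [B2 B20 B2P] := family_bounded al0 (0 : V) N1%:R bp_lh.
  have [B3 B30 B3P] := family_bounded al0 (0 : V) N1%:R bm_lh.
  pose Bm := B1 + B2 + B3 + B + 1.
  have [b1 b2 b3 b4] : [/\ B1 <= Bm, B2 <= Bm, B3 <= Bm & B + 1 <= Bm].
    by move: B0 B10 B20 B30; rewrite /Bm; prune9; split; lra.
  exists (ds N1), Bm, S0, N1; split => //; first exact: le_trans b1.
    by move=> d /B1P[].
  move=> x xx.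
  have xN : `|x| <= N1%:R - 1.
    have -> : x = (x - x0) + x0 by rewrite subrK.
    by apply: le_trans (ler_normD _ _) _; move: xx N1P; prune9; lra.
  have xN1 : `|x| <= N1%:R by apply: le_trans xN _; rewrite gerBl.
  have xN0 : `|x - 0| <= N1%:R by rewrite subr0.
  split.
  - by move=> d /B1P[_ /(_ x x xN0 xN0)[q _]]; exact: le_trans q b1.
  - by move=> i; have [q _] := B2P i x x xN0 xN0; exact: le_trans q b2.
  - by move=> i; have [q _] := B3P i x x xN0 xN0; exact: le_trans q b3.
  - by move=> i j; apply: dsE; apply: le_trans xN1 _; rewrite ler_nat.
  move=> m k Nm; split.
    rewrite (ss_eq (S m)); last first.
      by apply: le_lt_trans xN _; rewrite ltrBlDr (le_lt_trans (_ : _ <= m%:R)) ?ler_nat // ltrDl.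
    by rewrite (L_agree _ _ Nm xN1).
  move=> km; apply: le_trans (ss_le (S m) x km) _; apply: le_trans b4; apply: lerD.
    by apply: le_trans (ler_norm _) (BP x xN1).
  by rewrite invf_le1 // ler1n.
have LE (x0 : V) (t0 : R) : 0 < t0 -> exists rho K (N : nat), [/\ 0 < rho, 0 <= K &
  forall m, (N <= m)%N -> forall k x, `|x - x0| <= rho -> `|k%:R * tt m - t0| <= rho ->
  [/\ forall i, `|df (E (hh m) i) (UU m k) x| <= hh m * K,
      forall i j, `|df (E (hh m) i) (df (E (hh m) j) (UU m k)) x| <= hh m ^+ 2 * K
    & forall i j l d, (0 < d)%N -> d%:R * hh m <= rho ->
       `|df (d%:R *: E (hh m) l) (df (E (hh m) i) (df (E (hh m) j) (UU m k))) x| <= hh m ^+ 2 * (K * (d%:R * hh m) `^ al)]].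
  move=> t00; have [rho [K [N [r0 K0 H]]]] := local_bounds x0 t00.
  by exists rho, K, N; split => // m Nm; exact: H (S m) Nm.
have ac i j : continuous (a i j) := lh_continuous al0 (alh i j).
have bc i : continuous (b i) := lh_continuous al0 (blh i).
pose z := zlim hh tt UU F.
pose u := deficit hh tt UU F W.
have zE x t : u x t = W x - z (x, t) by [].
have FP : ProperFilter F by exact: ultra_proper.
have FF : Filter F by exact: filter_filter.
have small e : 0 < e -> exists N : nat, forall m, (N <= m)%N -> hh m <= e.
  by move=> e0; exact (mesh_small hhm e0).
have ktime m t : 0 <= t -> (Num.trunc (t / tt m))%:R * tt m <= t.
  by move=> t0; rewrite -ler_pdivlMr // truncn_le divr_ge0 // ltW.
have nearX m (x : V) : `|rd (hh m) x - x| <= hh m by exact: rd_near.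
have Wnode x : (fun m => W (rd (hh m) x)) @ F --> W x by exact (node_cvg hh0 hhm FU Foo cW).
(* Valid at time 0 as well: the bounds [0] and [W] plus an error suffice here, without interior
   estimates. *)
have zc x t : 0 <= t -> (fun m => UU m (Num.trunc (t / tt m)) (rd (hh m) x)) @ F --> z (x, t).
  move=> t0; have [B B0 BP] := @continuous_bounded_ball R n W (`|x| + 1) cW.
  have [N NP] := nat_above t.
  apply: (ulim_cvg FU Foo (B := B + 1) (N := N)) => m Nm; rewrite ger0_norm //.
  apply: le_trans (ss_le (S m) _ _) _.
    by apply: le_trans (ktime m t t0) (le_trans NP _); rewrite ler_nat.
  apply: lerD; last by rewrite invf_le1 // ler1n.
  apply: le_trans (ler_norm _) (BP _ _).
  have -> : rd (hh m) x = (rd (hh m) x - x) + x by rewrite subrK.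
  have q : `|rd (hh m) x - x| <= 1 by apply: (le_trans (nearX m x)).
  by apply: le_trans (ler_normD _ _) _; move: q; prune9; lra.
have uc x t : 0 <= t -> (fun m => W (rd (hh m) x) - UU m (Num.trunc (t / tt m)) (rd (hh m) x)) @ F --> u x t.
  by move=> t0; apply: cvgB; [exact: Wnode|exact: zc].
have u0 x t : 0 <= t -> 0 <= u x t.
  move=> t0; rewrite -oppr_le0; have nc : (fun m => - (W (rd (hh m) x) - UU m (Num.trunc (t / tt m)) (rd (hh m) x))) @ F --> - u x t.
    by apply: cvgN; exact: uc.
  apply: (ulim_le FU Foo nc) => d d0; have [N NP] := nat_above t; have [N2 N2P] := nat_above d^-1; exists (maxn N N2) => m; rewrite geq_max => /andP[Nm N2m].
  have km : (Num.trunc (t / tt m))%:R * tt m <= m%:R.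
    by apply: le_trans (ktime m t t0) (le_trans NP _); rewrite ler_nat.
  have h1 := ss_le (S m) (rd (hh m) x) km.
  have : m.+1%:R^-1 <= d.
    rewrite -[d]invrK lef_pV2 ?posrE ?invr_gt0 //; apply: le_trans N2P _; rewrite ler_nat; exact: leqW.
  by move=> hd; rewrite opprB add0r lerBlDl; apply: le_trans h1 _; rewrite lerD2l.
(* Within distance 1 the quadratic term of the barrier is at most linear, so [u] is small near
   [(x0, 0)]. *)
have uup x0 : exists2 K, 0 <= K & forall x t, `|x - x0| <= 1 -> 0 <= t -> u x t <= K * (`|x - x0| + t).
  have [B [K [N [B0 K0 H]]]] := scheme_barrier x0.
  have nB : 0 <= n%:R * B by rewrite mulr_ge0.
  exists (n%:R * B + K); first exact: addr_ge0.
  move=> x t xx t0.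
  suff h : u x t <= n%:R * B * `|x - x0| + K * t.
    apply: le_trans h _; have p1 : 0 <= n%:R * B * t by rewrite mulr_ge0.
    have p2 : 0 <= K * `|x - x0| by rewrite mulr_ge0.
    by move: p1 p2; prune9; lra.
  apply: (ulim_le FU Foo (uc x t t0)) => d d0.
  have D0 : 0 < 3 * (n%:R * B) + 1 by rewrite ltr_wpDl // mulr_ge0.
  have [N2 N2P] := small _ (divr_gt0 d0 D0).
  exists (maxn N N2) => m; rewrite geq_max => /andP[Nm N2m].
  have hd : hh m * (3 * (n%:R * B) + 1) <= d by rewrite -ler_pdivlMr // N2P.
  have h0 := hh0 m; have h1 := hh1 m.
  set X := rd (hh m) x; set k := Num.trunc _.
  have Xx : `|X - x0| <= `|x - x0| + hh m.
    have -> : X - x0 = (x - x0) + (X - x) by rewrite [RHS]addrC addrA subrK.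
    by apply: le_trans (ler_normD _ _) _; rewrite lerD2l; exact: nearX.
  have X2 : `|X - x0| <= 2 by move: Xx xx h1; prune9; lra.
  have := H T m _ _ _ (S m) Nm k X X2.
  have q1 : B * qn (X - x0) <= n%:R * B * (`|x - x0| + 3 * hh m).
    rewrite [n%:R * B]mulrC -mulrA; apply: ler_wpM2l => //; apply: le_trans (qn_le _) _; apply: ler_wpM2l => //.
    apply: le_trans (_ : (`|x - x0| + hh m) ^+ 2 <= _).
      by rewrite ler_pXn2r ?nnegrE // addr_ge0 // ltW.
    have g1 : `|x - x0| * `|x - x0| <= `|x - x0| by rewrite -[leRHS]mulr1 ler_wpM2l.
    have g2 : hh m * hh m <= hh m by rewrite ger_pMr.
    have g3 : hh m * `|x - x0| <= hh m by rewrite ger_pMr.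
    by rewrite expr2; move: g1 g2 g3; prune9; lra.
  have q2 : K * (k%:R * tt m) <= K * t by apply: ler_wpM2l => //; exact: ktime.
  by move: q1 q2 hd h0; prune9; lra.
have ui x : u x 0 = 0.
  apply/eqP; rewrite eq_le u0 // andbT; have [K K0 H] := uup x.
  by have := H x 0; rewrite subrr normr0 addr0 mulr0 => /(_ ler01 (lexx _)).
have uC := deficit_C21 al0 ac bc (@bpm) Hf_lip hh0 hhm tt0 tth UU0 LS LE FU Foo WC.
have sol : classical_sol a b f (fun=> 0) u.
  split; first exact: uC.
  split.
    (* Positive times are covered by the interior estimates, time 0 by [uup]. *)
    apply/subspace_continuousP => p /= p0; case: (ltgtP 0 p.2) p0 => // [pp _|pe _].
      apply: cvg_within_filter.
      have -> : unc u = (fun q : V * R => W q.1 - z q) by apply/funext => -[q1 q2].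
      apply: cvgB; last exact (zlim_continuous Hf_lip hh0 hhm tt0 tth UU0 LS LE FU Foo pp).
      by apply: (@continuous_comp _ _ _ fst W); [exact: cvg_fst|exact: cW].
    have up : unc u p = 0 by rewrite /unc -pe ui.
    suff L0 : unc u x @[x --> within [set q : V * R | 0 <= q.2] (nbhs p)] --> unc u p by exact: L0.
    rewrite up; apply/cvgrPdist_le => e e0; have [K K0 H] := uup p.1.
    have K1 : 0 < 2 * (K + 1) by rewrite mulr_gt0 // ltr_wpDl.
    change (nbhs p [set q : V * R | 0 <= q.2 -> `|0 - unc u q| <= e]).
    apply/nbhs_ballP; exists (Num.min 1 (e / (2 * (K + 1)))); first by rewrite /= lt_min ltr01 divr_gt0.
    move=> q; rewrite -ball_normE /= lt_min (ltr_pdivlMr _ _ K1) => /andP[q1 q2] q0.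
    rewrite /unc sub0r normrN (ger0_norm (u0 _ _ q0)).
    have [n1 n2] := near_pair (lexx `|q - p|); rewrite -pe subr0 (ger0_norm q0) in n2; rewrite distrC in q1 q2.
    apply: le_trans (H q.1 q.2 (le_trans n1 (ltW q1)) q0) _.
    have := ler_wpM2l K0 (lerD n1 n2); have := normr_ge0 (q - p); move: q2; prune9; lra.
  split; last by split => // x; exact: ui.
  move=> x t t0.
  have eqn := deficit_equation al0 ac bc (@bpm) Hf_lip hh0 hhm tt0 tth UU0 LS LE FU Foo WC x t0.
  (* As [u >= 0], the clipping in [Hf] is inactive on the limit. *)
  have HE : Hf x (zlim hh tt UU F (x, t)) = f x (W x) - f x (u x t).
    by rewrite /Hf -[W x - _]/(u x t) max_l // u0 // ltW.
  rewrite HE in eqn; etransitivity; first exact: eqn.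
  have LW : Lop a b W x = - f x (W x) by apply/eqP; rewrite -addr_eq0 Weq.
  rewrite LW; change (Lop a b (fun y => deficit hh tt UU F W y t) x) with (Lop a b (fun y => u y t) x).
  move: (Lop _ _ _ x) (f x (W x)) (f x (u x t)) => l1 f1 f2; ring.
(* At time [T + 1], rounding down to a time level loses at most [tt m <= 1 / 2], so the level still
   lies beyond [T]. *)
move=> x; have T1 : 0 <= T + 1 by rewrite addr_ge0.
have := uniq u sol x (T + 1) T1; rewrite zE => /eqP; rewrite subr_eq0 => /eqP ->.
apply: (ulim_le FU Foo (zc x (T + 1) T1)) => d d0.
have h20 : 0 < 2^-1 :> R by rewrite invr_gt0.
have [N NP] := nat_above (T + 1); have [N2 N2P] := small _ h20; exists (maxn N N2) => m; rewrite geq_max => /andP[Nm N2m].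
apply: le_trans (_ : c <= _); last by rewrite lerDl ltW.
apply: (ss_dec (S m)); last by apply: le_trans (ktime m _ T1) (le_trans NP _); rewrite ler_nat.
have := trunc_near (tt0 m) T1; rewrite ler_norml => /andP[+ _]; have := N2P m N2m; have := tth m; prune9; lra.
Qed.

End StationaryScheme.

(** A nonnegative value of [G] beyond [c0] would, by the intermediate value theorem, produce a root
    beyond [c0], since [G] is negative for large arguments. *)
Lemma Gsup_negative (R : realType) (n : nat) (f : 'rV[R]_n -> R -> R) (A c0 c : R) : loc_lip0 (Gsup f) ->
  (forall u, A <= u -> Gsup f u < 0) -> 0 <= c0 -> (forall u, 0 <= u -> Gsup f u = 0 -> u <= c0) -> c0 < c ->
  forall u, c <= u -> Gsup f u < 0.
Proof.
move=> Gl An c00 cmax cc u cu.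
have u0 : 0 <= u by lra.
rewrite ltNge; apply/negP => Gu.
pose B := Num.max A u.
have uB : u <= B by rewrite le_max lexx orbT.
have GB : Gsup f B < 0 by apply: An; rewrite le_max lexx.
have [||v] := @IVT R (fun v => Gsup f (Num.max v 0)) u B 0 uB.
- by apply: continuous_subspaceT; exact: clip_continuous.
- have B0 : 0 <= B := le_trans u0 uB.
  by rewrite (max_l u0) (max_l B0) ge_min le_max Gu (ltW GB) orbT.
rewrite in_itv /= => /andP[uv _] Gv; have v0 : 0 <= v := le_trans u0 uv.
by rewrite max_l // in Gv; have := cmax v v0 Gv; lra.
Qed.

Theorem theorem2 (R : realType) (n : nat)
  (a : 'I_n -> 'I_n -> 'rV[R]_n -> R) (b : 'I_n -> 'rV[R]_n -> R)
  (f : 'rV[R]_n -> R -> R)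
  (* coefficients in C^alpha *)
  (Hholder : exists alpha : R, 0 < alpha < 1 /\
      (forall i j, loc_holder alpha (a i j)) /\ (forall i, loc_holder alpha (b i)))
  (* ellipticity *)
  (Hell : forall (x nu : 'rV[R]_n), nu != 0 ->
      0 < \sum_(i < n) \sum_(j < n) a i j x * nu 0 i * nu 0 j)
  (* f locally Lipschitz in x and u *)
  (Hf : f_loc_lip f)
  (* (F-1') *)
  (HF1 : exists M : R, forall u, 0 < u -> Fsup f u <= M)
  (* (F-2') *)
  (HF2 : exists (m : nat) (eps : R), 0 < eps /\
      (fun u => Fsup f u / (u * (\prod_(1 <= i < m.+1) logi i u) ^+ 2
                              * (logi m.+1 u) `^ (2 + eps)))
        @ +oo --> -oo)
  (* (F-3) *)
  (HF3 : (forall x, f x 0 = 0) /\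
      (forall u, 0 <= u -> has_ubound (range (fun x => f x u))) /\
      loc_lip0 (Fsup f))
  (* (F-4a) *)
  (HF4 : (forall u, 0 <= u -> has_ubound (Gset f u)) /\
      loc_lip0 (Gsup f) /\
      exists A : R, 0 <= A /\ (forall u, A <= u -> Gsup f u < 0) /\
        (\int[lebesgue_measure]_(u in `[A, +oo[) ((- Gsup f u)^-1)%:E < +oo)%E)
  (* uniqueness of the trivial solution of (1.1) with g = 0 *)
  (Huniq : forall u : 'rV[R]_n -> R -> R,
      classical_sol a b f (fun _ => 0) u -> forall x t, 0 <= t -> u x t = 0) :
  (forall c0 : R,
      (0 <= c0 /\ Gsup f c0 = 0 /\ (forall u, 0 <= u -> Gsup f u = 0 -> u <= c0)) ->
      forall W, stationary_sol a b f W -> forall x, W x <= c0) /\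
  ((forall u, 0 < u -> Gsup f u < 0) ->
      forall W, stationary_sol a b f W -> forall x, W x = 0).
Proof.
case: Hholder => al [/andP[al0 al1] [alh blh]].
case: HF3 => f0 _; case: HF4 => Gub [Glip [A [A0 [An Aint]]]].
have [ds [d1 d2 d3 d4 d5]] := exhausting_directions al0 al1 alh Hell.
(* Formulated for any upper bound of the nonnegative roots, so that it also serves with [c0 = 0]
   when [G] is negative on the positive axis. *)
have main c0 : 0 <= c0 -> (forall u, 0 <= u -> Gsup f u = 0 -> u <= c0) ->
    forall W, stationary_sol a b f W -> forall x, W x <= c0.
  move=> c00 cmax W WS x; apply/ler_addgt0Pr => e e0.
  (* [G] may vanish at [c0], where the descent would stall; the decay is run down to [c0 + e]
     only. *)
  have c1 : 0 <= c0 + e by rewrite addr_ge0 // ltW.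
  apply: (stationary_le al0 al1 blh Hf f0 WS d1 d2 d4 d5 Gub Glip c1 _ d3 alh A0 An Aint Huniq).
  by apply: (Gsup_negative Glip An c00 cmax); rewrite ltrDl.
split; first by move=> c0 [c00 [_ cmax]]; exact: main.
move=> Gneg W WS x; apply/eqP; rewrite eq_le.
have [_ [W0 _]] := WS; rewrite W0 andbT; apply: (main 0 (lexx _)) => // u u0 Gu.
by rewrite leNgt; apply/negP => /Gneg; rewrite Gu ltxx.
Qed.
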